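(* Let $N\ge2$, let $\Omega\subset\mathbb{R}^N$ be an open set, let $2\le p_1\le\dots\le p_{N-1}\le p_N$, $\mathbf{p}=(p_1,\dots,p_N)$, and let $f\in W^{1,\mathbf{p}'}_{\rm loc}(\Omega)$. Let $g_1,\dots,g_N:\mathbb{R}\to\mathbb{R}^+$ be $C^2$ convex functions such that, for some $\mathcal{C}\ge1$ and $\delta\ge0$, \[ \frac{1}{\mathcal{C}}(|s|-\delta)_+^{p_i-2}\le g_i''(s)\le\mathcal{C}\,(|s|^{p_i-2}+1),\qquad s\in\mathbb{R},\ i=1,\dots,N. \] Let $u\in W^{1,\mathbf{p}}_{\rm loc}(\Omega)$ be a local minimizer of \[ \mathfrak{F}(u;\Omega')=\sum_{i=1}^N\int_{\Omega'}g_i(u_{x_i})\,dx+\int_{\Omega'}f\,u\,dx,\qquad\Omega'\Subset\Omega, \] and suppose that $u\in L^\infty_{\rm loc}(\Omega)$. Set $\mathcal{V}_i=V_i(u_{x_i})$ with $V_i(t)=\int_0^t\sqrt{g_i''(\tau)}\,d\tau$. Then for every $i=1,\dots,N$ we have \[ \mathcal{V}_i\in\mathcal{N}^{\mathbf{t},2}_{\infty,{\rm loc}}(\Omega),\qquad\text{where }\ \mathbf{t}=\left(\frac{p_1}{p_N},\dots,\frac{p_{N-1}}{p_N},1\right). \]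
   Context: $W^{1,\mathbf{p}}_{\rm loc}(\Omega)=\{u\in W^{1,1}_{\rm loc}(\Omega): u_{x_i}\in L^{p_i}_{\rm loc}(\Omega)\ \forall i\}$ and $W^{1,\mathbf{p}}_0(E)=\{u\in W^{1,1}_0(E): u_{x_i}\in L^{p_i}(E)\ \forall i\}$; $\mathbf{p}'=(p_1',\dots,p_N')$ with $p_i'=p_i/(p_i-1)$; $(\cdot)_+$ is the positive part. $E\Subset\Omega$ means that $E$ is open with compact closure contained in $\Omega$. A function $u\in W^{1,\mathbf{p}}_{\rm loc}(\Omega)$ is a local minimizer of $\mathfrak{F}$ if $\mathfrak{F}(u;\Omega')\le\mathfrak{F}(v;\Omega')$ for every $\Omega'\Subset\Omega$ and every $v$ with $v-u\in W^{1,\mathbf{p}}_0(\Omega')$. Anisotropic Besov–Nikol'skiĭ spaces: let $\{\mathbf{e}_1,\dots,\mathbf{e}_N\}$ be the canonical basis and $\delta_{\mathbf{h}}\psi(x)=\psi(x+\mathbf{h})-\psi(x)$. For an open set $E$ and $\mathbf{h}\ne0$, $E_{\mathbf{h}}=\{x\in E: x+\tau\mathbf{h}\in E\ \text{for every }\tau\in[0,1]\}$. For $0<t\le1$, $m\ge1$ and $\psi\in L^m(E)$ set $[\psi]_{\mathfrak{n}^{t,m}_{\infty,i}(E)}=\sup_{|h|>0}\big\|\,|h|^{-t}\delta_{h\mathbf{e}_i}\psi\big\|_{L^m(E_{h\mathbf{e}_i})}$. For $\mathbf{t}=(t_1,\dots,t_N)\in(0,1]^N$, $\mathcal{N}^{\mathbf{t},m}_\infty(E)=\{\psi\in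 L^m(E):\sum_{i=1}^N[\psi]_{\mathfrak{n}^{t_i,m}_{\infty,i}(E)}<+\infty\}$, and $\mathcal{N}^{\mathbf{t},m}_{\infty,{\rm loc}}(\Omega)$ is the set of $\psi\in L^m_{\rm loc}(\Omega)$ with $\psi\in\mathcal{N}^{\mathbf{t},m}_\infty(E)$ for every $E\Subset\Omega$. *)

(* Defs.v *)
From HB Require Import structures.
From mathcomp Require Import all_boot all_order all_algebra.
From mathcomp Require Import all_classical all_reals all_analysis.

Set Implicit Arguments.
Unset Strict Implicit.
Unset Printing Implicit Defensive.
Import Order.TTheory GRing.Theory Num.Theory.
Import numFieldNormedType.Exports.

Local Open Scope classical_set_scope.
Local Open Scope ring_scope.

(** * Lebesgue measure on R^N

    R^N is ['rV[R]_N], with the sigma-algebra generated by the coordinates,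
    i.e. the Borel sigma-algebra of the product topology.  Every Lebesgue
    measurable function agrees almost everywhere with a Borel measurable one, so
    that Borel representatives suffice for Lebesgue and Sobolev spaces. *)

Definition rV_display : measure_display -> measure_display.
Proof. exact. Qed.

Section measurable_rV.
Context d (T : measurableType d) (n : nat).

Let coor (i : 'I_n) (x : 'rV[T]_n) : T := x ord0 i.

Let rV_set0 : g_sigma_preimage coor set0.
Proof. exact: sigma_algebra0. Qed.

Let rV_setC A : g_sigma_preimage coor A -> g_sigma_preimage coor (~` A).
Proof. exact: sigma_algebraC. Qed.

Let rV_bigcup (F : (set 'rV[T]_n)^nat) :
  (forall i, g_sigma_preimage coor (F i)) ->
  g_sigma_preimage coor (\bigcup_i F i).
Proof. exact: sigma_algebra_bigcup. Qed.

HB.instance Definition _ := @isMeasurable.Build (rV_display d) 'rV[T]_n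
  (g_sigma_preimage coor) rV_set0 rV_setC rV_bigcup.

Lemma measurable_coor (i : 'I_n) :
  measurable_fun [set: 'rV[T]_n] (fun x : 'rV[T]_n => x ord0 i).
Proof.
move=> _ Y mY; rewrite setTI; apply: sub_sigma_algebra => /=.
rewrite -bigcup_seq/=; exists i => /=; first by rewrite mem_index_enum.
by exists Y => //; rewrite setTI.
Qed.

Lemma measurable_fun_coorP d' (U : measurableType d') (f : U -> 'rV[T]_n) :
  (forall i, measurable_fun setT (fun x => f x ord0 i)) ->
  measurable_fun setT f.
Proof.
move=> mf _ A mA; rewrite setTI.
apply: (mA [set B | measurable (f @^-1` B)]); split.
  split => /=.
  - by rewrite preimage_set0.
  - by move=> B mB; rewrite setTD preimage_setC; exact: measurableC.
  - by move=> B mB; rewrite preimage_bigcup; exact: bigcup_measurable.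
rewrite -bigcup_seq => B [i _ [C mC <-]] /=.
by rewrite setTI; have := mf i measurableT C mC; rewrite setTI.
Qed.

End measurable_rV.

Section lebesgue_rV.
Context {R : realType}.

Definition rV_snoc n (z : 'rV[R]_n * measurableTypeR R) : 'rV[R]_n.+1 :=
  \row_i (if unlift ord_max i is Some j then z.1 ord0 j else z.2).

Lemma measurable_rV_snoc n : measurable_fun setT (@rV_snoc n).
Proof.
apply: measurable_fun_coorP => i; rewrite /rV_snoc.
under eq_fun do rewrite mxE.
case: (unlift ord_max i) => [j|]; last exact: measurable_snd.
by apply: (measurableT_comp (@measurable_coor _ _ n j)); exact: measurable_fst.
Qed.

Section snoc_measure.
Context n (mu : {measure set 'rV[R]_n -> \bar R}).

Definition rV_snoc_measure : set 'rV[R]_n.+1 -> \bar R :=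
  pushforward (mu \x @lebesgue_measure R)%E (@rV_snoc n).

Let snoc_measure0 : rV_snoc_measure set0 = 0%E.
Proof. by rewrite /rV_snoc_measure /pushforward preimage_set0 measure0. Qed.

Let snoc_measure_ge0 A : (0 <= rV_snoc_measure A)%E.
Proof. by rewrite /rV_snoc_measure /pushforward; exact: measure_ge0. Qed.

Let snoc_measure_sigma_additive : semi_sigma_additive rV_snoc_measure.
Proof.
move=> F mF tF mUF; rewrite /rV_snoc_measure /pushforward preimage_bigcup.
have mpre (B : set 'rV[R]_n.+1) :
    measurable B -> measurable (@rV_snoc n @^-1` B).
  by move=> mB; rewrite -[X in measurable X]setTI; exact: measurable_rV_snoc.
apply: measure_semi_sigma_additive.
- by move=> k; exact: mpre.
- apply/trivIsetP => /= i j _ _ ij; rewrite -preimage_setI.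
  by move/trivIsetP : tF => /(_ _ _ _ _ ij) ->//; rewrite preimage_set0.
- by rewrite -preimage_bigcup; exact: mpre.
Qed.

HB.instance Definition _ := isMeasure.Build _ _ _ rV_snoc_measure
  snoc_measure0 snoc_measure_ge0 snoc_measure_sigma_additive.

End snoc_measure.

Fixpoint lebesgue_rV n : {measure set 'rV[R]_n -> \bar R} :=
  if n is m.+1 then [the measure _ _ of rV_snoc_measure (lebesgue_rV m)]
  else [the measure _ _ of \d_(0 : 'rV[R]_0)].

Lemma lebesgue_rV_box n (A : 'I_n -> set R) :
  (forall i, measurable (A i)) ->
  lebesgue_rV n [set x | forall i, A i (x ord0 i)] =
    (\prod_(i < n) @lebesgue_measure R (A i))%E.
Proof.
elim: n A => [|n IH] A mA.
  rewrite big_ord0 /= diracE mem_set// => -[].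
  by case.
pose B := [set x : 'rV[R]_n |
  forall i, A (widen_ord (leqnSn n) i) (x ord0 i)].
rewrite big_ord_recr/= -(IH (fun i => A (widen_ord (leqnSn n) i)))//.
rewrite -/B /rV_snoc_measure /pushforward.
have -> : @rV_snoc n @^-1` [set x | forall i, A i (x ord0 i)] =
    B `*` (A ord_max : set (measurableTypeR R)).
  apply/seteqP; split => -[x y] /=.
    move=> H; split => /=.
      move=> i; have := H (widen_ord (leqnSn n) i); rewrite /rV_snoc mxE.
      have -> : widen_ord (leqnSn n) i = lift ord_max i.
        by apply/val_inj; rewrite /= /bump leqNgt ltn_ord.
      by rewrite liftK.
    by have := H ord_max; rewrite /rV_snoc mxE unlift_none.
  move=> [/= Bx Ay] i; rewrite /rV_snoc mxE.
  case: unliftP => [j ->|->//] /=.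
  have -> : lift ord_max j = widen_ord (leqnSn n) j.
    by apply/val_inj; rewrite /= /bump leqNgt ltn_ord.
  exact: Bx.
rewrite product_measure1E//; last exact: mA.
have -> : B = \bigcap_(i in [set: 'I_n])
    ((fun x : 'rV[R]_n => x ord0 i) @^-1` A (widen_ord (leqnSn n) i)).
  by apply/seteqP; split => x /= Bx i => [_|]; exact: Bx.
apply: fin_bigcap_measurable => // i _.
by rewrite -[X in measurable X]setTI; exact: measurable_coor.
Qed.

End lebesgue_rV.

(** * Lebesgue and Sobolev spaces

    Classes of functions modulo equality almost everywhere are represented by
    functions on the whole of R^N, of which only the values on the set at hand
    matter. *)

Section sobolev.
Context {R : realType} {N : nat}.
Implicit Types (E Om : set 'rV[R]_N) (u v w phi : 'rV[R]_N -> R).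
Implicit Types (p : 'I_N -> R).

Local Notation leb := (lebesgue_rV N).

Definition unit_vector (i : 'I_N) : 'rV[R]_N := delta_mx ord0 i.

Definition compactly_inside E Om :=
  [/\ open E, compact (closure E) & closure E `<=` Om].

Definition Lp_space (m : \bar R) E u := u \_ E \in Lfun leb m.

Definition Lp_loc (m : \bar R) Om u :=
  forall E, compactly_inside E Om -> Lp_space m E u.

Definition norm_on (m : \bar R) E u : \bar R :=
  'N[leb]_m [EFin \o (u \_ E)]%E.

Definition partial (i : 'I_N) phi : 'rV[R]_N -> R :=
  fun x => 'D_(unit_vector i) phi x.

Fixpoint C_k (k : nat) phi : Prop :=
  continuous phi /\
  if k is k'.+1 then
    forall i, (forall x, derivable phi x (unit_vector i)) /\
              C_k k' (partial i phi)
  else True.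

(* C_c^infty(Om) *)
Definition test_function Om phi :=
  let supp := closure [set x | phi x != 0] in
  [/\ forall k, C_k k phi, compact supp & supp `<=` Om].

Definition is_weak_partial Om (i : 'I_N) u w :=
  [/\ Lp_loc 1 Om u, Lp_loc 1 Om w &
      forall phi, test_function Om phi ->
        \int[leb]_(x in Om) (u x * partial i phi x) =
        - \int[leb]_(x in Om) (w x * phi x)].

(* [wpartial Om i u] is a representative of u_{x_i} on Om, which is unique up to
   a null set; it is 0 if u has no weak i-th derivative on Om *)
Definition wpartial Om (i : 'I_N) u : 'rV[R]_N -> R :=
  xget (cst 0) [set w | is_weak_partial Om i u w].

Definition weakly_differentiable Om u :=
  forall i, exists w, is_weak_partial Om i u w.

(* W^{1,1}_loc is the class of weakly differentiable functions, since
   [is_weak_partial] includes the local integrability of u and u_{x_i} *)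
Definition W1p_loc p Om u :=
  weakly_differentiable Om u /\
  forall i, Lp_loc (p i)%:E Om (wpartial Om i u).

Definition W11 E u :=
  [/\ weakly_differentiable E u, Lp_space 1 E u &
      forall i, Lp_space 1 E (wpartial E i u)].

(* the closure of C_c^infty(E) in W^{1,1}(E) *)
Definition W11_0 E u :=
  W11 E u /\
  forall e : R, 0 < e -> exists2 phi, test_function E phi &
    (norm_on 1 E (u \- phi)%R +
     \sum_(i < N) norm_on 1 E (wpartial E i u \- partial i phi)%R < e%:E)%E.

Definition W1p_0 p E u :=
  W11_0 E u /\ forall i, Lp_space (p i)%:E E (wpartial E i u).

Definition conjugate_exponents p (i : 'I_N) : R := p i / (p i - 1).

End sobolev.

(** * Local minimizers of the orthotropic functional *)

Section functional.
Context {R : realType} {N : nat}.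
Implicit Types (E Om : set 'rV[R]_N) (u v f : 'rV[R]_N -> R).
Implicit Types (p : 'I_N -> R) (g : 'I_N -> R -> R).

Definition C2 (h : R -> R) :=
  [/\ forall x, derivable h x 1,
      forall x, derivable (derive1n 1 h) x 1 & continuous (derive1n 2 h)].

Definition functional g f u E : \bar R :=
  ((\sum_(i < N) \int[lebesgue_rV N]_(x in E) (g i (wpartial E i u x))%:E) +
   \int[lebesgue_rV N]_(x in E) (f x * u x)%:E)%E.

Definition local_minimizer p g f Om u :=
  W1p_loc p Om u /\
  forall E v, compactly_inside E Om -> W1p_0 p E (v \- u) ->
    (functional g f u E <= functional g f v E)%E.

(* the oriented integral of sqrt(h'') from 0 to t *)
Definition V_fun (h : R -> R) (t : R) : R :=
  if 0 <= t
  then \int[@lebesgue_measure R]_(s in `[0, t]) Num.sqrt (derive1n 2 h s)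
  else - \int[@lebesgue_measure R]_(s in `[t, 0]) Num.sqrt (derive1n 2 h s).

End functional.

(** * Anisotropic Besov-Nikolskii spaces *)

Section besov.
Context {R : realType} {N : nat}.
Implicit Types (E Om : set 'rV[R]_N) (psi : 'rV[R]_N -> R).

Definition increment (h : 'rV[R]_N) psi : 'rV[R]_N -> R :=
  fun x => psi (x + h) - psi x.

Definition shift_domain E (h : 'rV[R]_N) : set 'rV[R]_N :=
  [set x | E x /\ forall tau : R, 0 <= tau <= 1 -> E (x + tau *: h)].

Definition nikolskii_seminorm (t m : R) (i : 'I_N) E psi : \bar R :=
  ereal_sup [set norm_on m%:E (shift_domain E (h *: unit_vector i))
                   (fun x => `|h| `^ (- t) * increment (h *: unit_vector i) psi x)
            | h in [set h : R | 0 < `|h|]].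

Definition besov_nikolskii (t : 'I_N -> R) (m : R) E psi :=
  Lp_space m%:E E psi /\
  (\sum_(i < N) nikolskii_seminorm (t i) m i E psi < +oo)%E.

Definition besov_nikolskii_loc (t : 'I_N -> R) (m : R) Om psi :=
  Lp_loc m%:E Om psi /\
  forall E, compactly_inside E Om -> besov_nikolskii t m E psi.

End besov.

(* Main.v *)
Require Import Defs.
From HB Require Import structures.
From mathcomp Require Import all_boot all_order all_algebra.
From mathcomp Require Import all_classical all_reals all_analysis.
From mathcomp Require Import measurable_realfun ess_sup_inf ring lra.

Set Implicit Arguments.
Unset Strict Implicit.
Unset Printing Implicit Defensive.
Import Order.TTheory GRing.Theory Num.Theory.
Import numFieldNormedType.Exports.

Local Open Scope classical_set_scope.
Local Open Scope ring_scope.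

(** Test the minimality of u with phi = psi - psi(. - h e_j), where
    psi = zeta^2 D u, D v = v(. + h e_j) - v and zeta is a cutoff function.
    The inequalities (V b - V a)^2 <= (g' b - g' a)(b - a) and
    (g' b - g' a)^2 <= sup g'' (V b - V a)^2 then bound the integral of
    zeta^2 |D V_i|^2 by those of
    |grad zeta|^2 |D u|^2 (1 + |u_{x_i}|^(p_i - 2) + |u_{x_i}(. + h e_j)|^(p_i - 2))
    and |D f| |D u|.  With t_j = p_j / p_N, Young's inequality reduces the claim
    to bounds, uniform in h, for D f / h in L^(p_j'), D u / h in L^(p_j), which
    come from the weak derivatives, and |h|^(-t_j) D u in L^(p_i).  The last one
    follows from the local boundedness of u: |D u|^(p_N) <= C |D u|^(p_j), and
    |h|^(t_j p_N) = |h|^(p_j). *)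

(** * Integrable functions *)

(** Translations leave [Om], so all data are restricted to a cube of radius 6r and extended by zero;
    multiplying by a cutoff then gives a [weak_pair] on the whole space, where a shift preserves
    integrals. The test function must lie in the L^1 closure of the smooth ones, which is why
    mollification, and behind it the density of [Cc], has to be developed. Minimality is used to
    first order only, and as an inequality: convexity gives g(a + e b) - g(a) <= e g'(a) b + O(e^2)
    with an integrable remainder, and [e] tends to 0. The sign is the useful one because the
    monotonicity of g' makes the leading term nonnegative. The loss of smoothness comes from the
    cutoff term: a shift along j controls D u in L^(p_j), while the i-th term asks for L^(p_i),
    possibly with p_i > p_j. The source term is of order h^2, so it never limits the exponent.
    Everything above concerns small [h] near one point. Compactness of the closure of [E] makes it
    uniform, and for [|h|] bounded below the L^2 norm is enough. *)

Section L1.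
Context d (T : measurableType d) (R : realType) (mu : {measure set T -> \bar R}).
Implicit Types f g : T -> R.

Definition L1 f := mu.-integrable setT (EFin \o f).
Definition Int f := \int[mu]_x f x.

Lemma L1_meas f : L1 f -> measurable_fun setT f.
Proof. by move=> /integrableP[/measurable_EFinP]. Qed.

Lemma L1_le g f : measurable_fun setT f -> L1 g ->
  (forall x, `|f x| <= g x) -> L1 f.
Proof.
move=> mf Lg fg; apply: (le_integrable measurableT _ _ Lg).
  exact/measurable_EFinP.
by move=> x _ /=; rewrite lee_fin (le_trans (fg x))// ler_norm.
Qed.

Lemma L10 : L1 (fun=> 0).
Proof. exact: integrable0. Qed.

Lemma L1D f g : L1 f -> L1 g -> L1 (fun x => f x + g x).
Proof. by move=> Lf Lg; have := integrableD measurableT Lf Lg. Qed.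

Lemma L1N f : L1 f -> L1 (fun x => - f x).
Proof. by move=> Lf; have := integrableN Lf. Qed.

Lemma L1B f g : L1 f -> L1 g -> L1 (fun x => f x - g x).
Proof. by move=> Lf Lg; exact: L1D Lf (L1N Lg). Qed.

Lemma L1Z c f : L1 f -> L1 (fun x => c * f x).
Proof. by move=> Lf; have := integrableZl measurableT c Lf. Qed.

Lemma L1_sum (J : Type) (s : seq J) (F : J -> T -> R) :
  (forall j, L1 (F j)) -> L1 (fun x => \sum_(j <- s) F j x).
Proof.
move=> LF; elim: s => [|j s IH].
  by under eq_fun do rewrite big_nil; exact: L10.
by under eq_fun do rewrite big_cons; exact: L1D.
Qed.

Lemma L1_abs f : L1 f -> L1 (fun x => `|f x|).
Proof. by move=> Lf; have := integrable_abse Lf. Qed.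

Lemma L1_bound_mul (c : R) (b f : T -> R) : measurable_fun setT b ->
  (forall x, `|b x| <= c) -> L1 f -> L1 (fun x => b x * f x).
Proof.
move=> mb bc Lf; apply: (L1_le _ (L1Z c (L1_abs Lf))).
  exact: measurable_funM (L1_meas Lf).
by move=> x; rewrite normrM ler_wpM2r.
Qed.

Lemma L1_indic (A : set T) : measurable A -> (mu A < +oo)%E -> L1 (\1_A : T -> R).
Proof.
move=> mA Aoo; apply/integrableP; split; first exact/measurable_EFinP.
under eq_integral do rewrite /= ger0_norm//.
by rewrite integral_indic// setIT.
Qed.

Lemma IntD f g : L1 f -> L1 g -> Int (fun x => f x + g x) = Int f + Int g.
Proof. by move=> Lf Lg; rewrite /Int RintegralD. Qed.

Lemma IntZ c f : L1 f -> Int (fun x => c * f x) = c * Int f.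
Proof. by move=> Lf; rewrite /Int RintegralZl. Qed.

Lemma IntN f : L1 f -> Int (fun x => - f x) = - Int f.
Proof.
by move=> Lf; rewrite -mulN1r -IntZ//; congr Int; apply/funext => x; rewrite mulN1r.
Qed.

Lemma IntB f g : L1 f -> L1 g -> Int (fun x => f x - g x) = Int f - Int g.
Proof. by move=> Lf Lg; rewrite /Int RintegralB. Qed.

Lemma Int0 : Int (fun=> 0) = 0.
Proof. by rewrite /Int /Rintegral integral0. Qed.

Lemma Int_sum (J : Type) (s : seq J) (F : J -> T -> R) :
  (forall j, L1 (F j)) ->
  Int (fun x => \sum_(j <- s) F j x) = \sum_(j <- s) Int (F j).
Proof.
move=> LF; elim: s => [|j s IH].
  by under eq_fun do rewrite big_nil; rewrite Int0 big_nil.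
under eq_fun do rewrite big_cons.
by rewrite IntD ?IH ?big_cons//; exact: L1_sum.
Qed.

Lemma Int_ge0 f : (forall x, 0 <= f x) -> 0 <= Int f.
Proof. by move=> f0; apply: Rintegral_ge0. Qed.

Lemma Int_le f g : L1 f -> L1 g -> (forall x, f x <= g x) -> Int f <= Int g.
Proof. by move=> Lf Lg fg; apply: le_Rintegral. Qed.

Lemma Int_norm f : L1 f -> `|Int f| <= Int (fun x => `|f x|).
Proof. by move=> Lf; apply: le_normr_Rintegral. Qed.

Lemma Int_ae_eq f g : measurable_fun setT f -> measurable_fun setT g ->
  {ae mu, forall x, f x = g x} -> Int f = Int g.
Proof.
move=> mf mg fg; rewrite /Int /Rintegral; congr fine.
apply: ae_eq_integral => //; try exact/measurable_EFinP.
by apply: filterS fg => x /= -> _.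
Qed.

Lemma L1_ae_eq f g : L1 f -> measurable_fun setT g ->
  {ae mu, forall x, f x = g x} -> L1 g.
Proof.
move=> Lf mg fg; apply/integrableP; split; first exact/measurable_EFinP.
have /integrableP[_] := Lf; apply: le_lt_trans.
rewrite le_eqVlt; apply/orP; left; apply/eqP; apply: ae_eq_integral => //.
- by apply: measurableT_comp => //; exact/measurable_EFinP.
- by apply: measurableT_comp => //; exact/measurable_EFinP/L1_meas.
- by apply: filterS fg => x /= -> _.
Qed.

(** Replacing [g] by the maximum of [f] and [g], which agrees with it almost everywhere, makes the
    inequality hold everywhere. *)
Lemma Int_le_ae f g : L1 f -> L1 g -> {ae mu, forall x, f x <= g x} -> Int f <= Int g.
Proof.
move=> Lf Lg fg; pose h x := Num.max (f x) (g x).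
have mh : measurable_fun setT h by apply: measurable_maxr; exact: L1_meas.
have gh : {ae mu, forall x, g x = h x}.
  by apply: filterS fg => x; rewrite /h => /max_idPr ->.
rewrite (Int_ae_eq (L1_meas Lg) mh gh); apply: Int_le => //.
  exact: L1_ae_eq gh.
by move=> x; rewrite /h le_max lexx.
Qed.

Lemma Int_norm_eq0 f : L1 f -> Int (fun x => `|f x|) <= 0 -> {ae mu, forall x, f x = 0}.
Proof.
move=> Lf If0.
have : (\int[mu]_x `|(EFin \o f) x| = 0)%E.
  have -> : (fun x => `|(EFin \o f) x|)%E = EFin \o (fun x => `|f x|) by [].
  apply/eqP; rewrite -fine_eq0; last exact: (integrable_fin_num _ (L1_abs Lf)).
  by rewrite eq_le If0 Int_ge0.
have mf : measurable_fun setT (EFin \o f) by exact/measurable_EFinP/L1_meas.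
move=> /(ae_eq_integral_abs mu measurableT mf).
by apply: filterS => x /= /(_ Logic.I) [].
Qed.

Lemma L1_EFin f : L1 f -> (\int[mu]_x (f x)%:E = (Int f)%:E)%E.
Proof. by move=> Lf; rewrite /Int fineK//; exact: (integrable_fin_num _ Lf). Qed.

Lemma L1_fin f : measurable_fun setT f -> (forall x, 0 <= f x) ->
  (\int[mu]_x (f x)%:E < +oo)%E -> L1 f.
Proof.
move=> mf f0 fo; apply/integrableP; split; first exact/measurable_EFinP.
by under eq_integral do rewrite /= ger0_norm//.
Qed.

End L1.

(** * Cubes and translations *)

Section boxes.
Context {R : realType} {n : nat}.
Local Notation X := 'rV[R]_n.
Implicit Types (c x y h : X) (r : R).

Definition Q c r : set X := [set x | forall i, `|x ord0 i - c ord0 i| < r].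

(* [lebesgue_rV n] is a [Fixpoint], to which no sigma-finite instance can be attached. *)
Definition lebm : set X -> \bar R := lebesgue_rV n.
HB.instance Definition _ := Measure.copy lebm (lebesgue_rV n : set X -> \bar R).
Local Notation leb := lebm.

Lemma measurable_box (A : 'I_n -> set R) : (forall i, measurable (A i)) ->
  measurable [set x : X | forall i, A i (x ord0 i)].
Proof.
move=> mA.
have -> : [set x : X | forall i, A i (x ord0 i)] =
    \bigcap_(i in [set: 'I_n]) ((fun x : X => x ord0 i) @^-1` A i).
  by apply/seteqP; split => x /= Bx i => [_|]; exact: Bx.
apply: fin_bigcap_measurable => // i _.
by rewrite -[X in measurable X]setTI; exact: measurable_coor.
Qed.

Definition Q_itv c r (i : 'I_n) : set R := `](c ord0 i - r), (c ord0 i + r)[%classic.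

Lemma Q_box c r :
  Q c r = [set x | forall i, Q_itv c r i (x ord0 i)].
Proof.
apply/seteqP; split => x /= H i; have := H i; rewrite /Q_itv /= in_itv/= ltr_distl//.
Qed.

Lemma measurable_Q c r : measurable (Q c r).
Proof. by rewrite Q_box; apply: measurable_box => i; exact: measurable_itv. Qed.

Lemma leb_box (A : 'I_n -> set R) : (forall i, measurable (A i)) ->
  leb [set x | forall i, A i (x ord0 i)] = (\prod_(i < n) @lebesgue_measure R (A i))%E.
Proof. exact: lebesgue_rV_box. Qed.

Lemma leb_Q c r : (leb (Q c r) < +oo)%E.
Proof.
rewrite Q_box leb_box; last by move=> i; exact: measurable_itv.
(* Finiteness of a product in the extended reals passes from factor to factor only together with
   nonnegativity, so the induction carries both. *)
apply: (@proj2 (0 <= \prod_(i < n) lebesgue_measure (Q_itv c r i))%E).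
apply: (@big_ind _ (fun z => 0 <= z /\ z < +oo)%E).
- by rewrite ltry lee_fin.
- move=> x y [x0 xoo] [y0 yoo]; split; first exact: mule_ge0.
  by rewrite lte_mul_pinfty// ge0_fin_numE.
- move=> i _; rewrite /Q_itv lebesgue_measure_itv/=.
  split; first by case: ifPn => // ?; rewrite -EFinD lee_fin subr_ge0 ltW.
  by case: ifP => _; rewrite ?ltry// -EFinD ltry.
Qed.

Lemma Q_cover x : exists k : nat, Q 0 k%:R x.
Proof.
exists (Num.truncn (\sum_i `|x ord0 i|)).+1 => i; rewrite mxE subr0.
apply: le_lt_trans (truncnS_gt _); rewrite (bigD1 i)//= lerDl.
exact: sumr_ge0.
Qed.

Lemma leb_sigma_finite : sigma_finite setT leb.
Proof.
exists (fun k => Q 0 k%:R).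
  by apply/seteqP; split => x // _; have [k] := Q_cover x; exists k.
by move=> k; split; [exact: measurable_Q | exact: leb_Q].
Qed.

HB.instance Definition _ := Measure_isSigmaFinite.Build _ _ _ leb leb_sigma_finite.

End boxes.

(** * Translation invariance of Lebesgue measure *)

Section translation.
Context {R : realType}.

(** The pushforward agrees with Lebesgue measure on half-open intervals, and these determine it. *)
Lemma lebesgue_measure_shift (a : R) (A : set R) : measurable A ->
  @lebesgue_measure R ((fun x => x + a) @^-1` A) = lebesgue_measure A.
Proof.
move=> mA.
have mshift : measurable_fun setT ((fun x => x + a) : measurableTypeR R -> measurableTypeR R).
  by apply: measurable_funD.
pose nu : {measure set (measurableTypeR R) -> \bar R} := pushforward lebesgue_measure
  ((fun x => x + a) : measurableTypeR R -> measurableTypeR R).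
rewrite [RHS](@lebesgue_measure_unique _ (nu mshift))// => _ [[b c]] _ <-.
rewrite /nu /= /pushforward.
rewrite (_ : _ @^-1` _ = `](b - a), (c - a)]%classic); last first.
  by apply/seteqP; split => x /=; rewrite !in_itv/= ltrBlDr lerBrDr.
rewrite !lebesgue_measure_itv/= !lte_fin ltrD2r.
by case: ifP => // _; rewrite -!EFinD; congr EFin; ring.
Qed.

Context {n : nat}.
Local Notation X := 'rV[R]_n.
Local Notation leb := (@lebm R n).
Implicit Types (c x y h : X) (r : R).

Lemma measurable_shift h : measurable_fun setT (fun x : X => x + h).
Proof.
apply: measurable_fun_coorP => i; under eq_fun do rewrite mxE.
by apply: measurable_funD => //; exact: measurable_coor.
Qed.

Definition boxes : set (set X) :=
  [set B | exists A : 'I_n -> set R, (forall i, measurable (A i)) /\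
     B = [set x : X | forall i, A i (x ord0 i)]].

Lemma boxes_setI : setI_closed boxes.
Proof.
move=> _ _ [A [mA ->]] [B [mB ->]]; exists (fun i => A i `&` B i); split.
  by move=> i; exact: measurableI.
apply/seteqP; split => x /=; first by move=> [HA HB] i; split.
by move=> H; split => i; case: (H i).
Qed.

Lemma measurable_boxes : @measurable _ X = <<s boxes >>.
Proof.
apply/seteqP; split => [B mB|B]; last first.
  move=> sB; apply: (sB (@measurable _ X)); split.
    exact: sigma_algebra_measurable.
  by move=> _ [A [mA ->]]; exact: measurable_box.
apply: (mB <<s boxes >>); split; first exact: smallest_sigma_algebra.
rewrite -bigcup_seq => C [i _ [A mA <-]]; apply: sub_sigma_algebra.
exists (fun j => if j == i then A else setT); split.
  by move=> j; case: ifP.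
apply/seteqP; split => x /=; rewrite ?setTI.
  by move=> Ax j; case: eqVneq => // ->; case: Ax.
by move=> /(_ i); rewrite eqxx.
Qed.

Lemma boxes_Q c r : boxes (Q c r).
Proof.
exists (Q_itv c r); split; last exact: Q_box.
by move=> i; exact: measurable_itv.
Qed.

(** Both measures agree on the pi-system [boxes], which generates the sigma-algebra and contains an
    exhaustion by cubes of finite measure. *)
Lemma leb_shift h (A : set X) : measurable A ->
  leb ((fun x => x + h) @^-1` A) = leb A.
Proof.
move=> mA.
pose nu : {measure set X -> \bar R} := pushforward leb (fun x : X => x + h).
apply/esym; rewrite [RHS](_ : _ = nu (measurable_shift h) A)//.
apply: (@measure_unique _ _ _ boxes (fun k : nat => Q 0 k%:R)) => //.
- exact: measurable_boxes.
- exact: boxes_setI.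
- by move=> i; exact: boxes_Q.
- by apply/seteqP; split => x // _; have [k] := Q_cover x; exists k.
- move=> _ [B [mB ->]]; rewrite /nu /= /pushforward.
  have -> : (fun x : X => x + h) @^-1` [set x | forall i, B i (x ord0 i)] =
      [set x | forall i, (fun i => (fun t => t + h ord0 i) @^-1` B i) i (x ord0 i)].
    by apply/seteqP; split => x /= H i; have := H i; rewrite mxE.
  have mB' i : measurable ((fun t => t + h ord0 i) @^-1` B i).
    rewrite -[X in measurable X]setTI.
    by apply: (measurable_funD (@measurable_id _ _ setT) (measurable_cst _)).
  rewrite /lebm lebesgue_rV_box// [RHS](lebesgue_rV_box mB').
  by apply: eq_bigr => i _; rewrite lebesgue_measure_shift.
- by move=> k; exact: leb_Q.
Qed.

End translation.

(** * Topology of cubes, Borel sets and shifts of integrals *)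

Section topo.
Context {R : realType} {n : nat}.
Local Notation X := 'rV[R]_n.
Local Notation leb := (@lebm R n).
Implicit Types (c x y h : X) (r : R).

Lemma QE c r : 0 < r -> Q c r = ball c r.
Proof.
move=> r0; apply/seteqP; split => x /=.
  by move=> H; split => // i j; rewrite ord1 /ball /= distrC; exact: H.
by move=> [_ H] i; have := H ord0 i; rewrite /ball /= distrC.
Qed.

Lemma Q_norm x r : 0 < r -> Q 0 r x <-> `|x| < r.
Proof.
move=> r0; rewrite QE// -ball_normE /=; split; by rewrite sub0r normrN.
Qed.

Lemma coord_norm x i : `|x ord0 i| <= `|x|.
Proof.
rewrite leNgt; apply/negP => H.
have x0 : 0 < `|x ord0 i| by rewrite (le_lt_trans _ H).
have := (Q_norm x x0).2 H i; by rewrite mxE subr0 ltxx.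
Qed.

Lemma nbhs_Q c (A : set X) : nbhs c A -> exists2 r, 0 < r & Q c r `<=` A.
Proof.
by move=> /nbhs_ballP[r /= r0 rA]; exists r => //; rewrite QE.
Qed.

Lemma open_Q c r : open (Q c r).
Proof.
have [r0|r0] := ltP 0 r; first by rewrite QE//; exact: ball_open.
(* In dimension 0 the condition on coordinates is vacuous, so [Q c r] is the whole space even for
   [r <= 0]. *)
have [n0|n0] := posnP n.
  rewrite (_ : Q c r = setT); first exact: openT.
  by apply/seteqP; split => x // _ i; exfalso; move: (ltn_ord i); rewrite {2}n0.
rewrite (_ : Q c r = set0); first exact: open0.
apply/seteqP; split => x //= /(_ (Ordinal n0)); rewrite ltNge => /negP.
by apply; rewrite (le_trans r0).
Qed.

Definition Qc c r : set X := [set x | forall i, `|x ord0 i - c ord0 i| <= r].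

Lemma compact_Qc c r : compact (Qc c r).
Proof.
pose A i : set R := `[c ord0 i - r, c ord0 i + r]%classic.
rewrite (_ : Qc c r = [set x | forall i, A i (x ord0 i)]).
  by apply: rV_compact => i; exact: segment_compact.
by apply/seteqP; split => x /= H i; have := H i; rewrite /A /= in_itv/= ler_distl.
Qed.

Lemma closed_Qc c r : closed (Qc c r).
Proof.
rewrite (_ : Qc c r = \bigcap_(i in [set: 'I_n])
    (fun x : X => x ord0 i) @^-1` [set t | `|t - c ord0 i| <= r]).
  apply: closed_bigI => i _; apply: (closed_comp _ _) => //.
    by move=> x _; exact: coord_continuous.
  rewrite (_ : [set t | _] = `[c ord0 i - r, c ord0 i + r]%classic).
    exact: interval_closed.
  by apply/seteqP; split => x /=; rewrite in_itv/= ler_distl.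
by apply/seteqP; split => x /= H i => [_|]; exact: H.
Qed.

Lemma Q_Qc c r : Q c r `<=` Qc c r.
Proof. by move=> x H i; exact/ltW/H. Qed.

Lemma Qc_Q c r s : r < s -> Qc c r `<=` Q c s.
Proof. by move=> rs x H i; exact: le_lt_trans (H i) rs. Qed.

Lemma closure_Q c r : closure (Q c r) `<=` Qc c r.
Proof.
move=> x /(closure_subset (@Q_Qc c r)).
by rewrite -(closure_id _).1//; exact: closed_Qc.
Qed.

Lemma compactly_inside_Q c r Om : Qc c r `<=` Om -> compactly_inside (Q c r) Om.
Proof.
move=> QOm; split; first exact: open_Q.
  apply: (subclosed_compact _ (@compact_Qc c r)); first exact: closed_closure.
  exact: closure_Q.
exact: subset_trans (@closure_Q c r) QOm.
Qed.

Lemma open_Qc (Om : set X) c : open Om -> Om c -> exists2 r, 0 < r & Qc c r `<=` Om.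
Proof.
move=> oOm Omc; have [r r0 rOm] := nbhs_Q (open_nbhs_nbhs (conj oOm Omc)).
exists (r / 2); first by rewrite divr_gt0.
by apply: subset_trans rOm; apply: Qc_Q; rewrite ltr_pdivrMr// mulr_natr mulr2n ltrDl.
Qed.

(** The sigma-algebra is generated by the coordinates, not by the open sets. An open set is
    therefore written as a countable union of cubes with rational centre and radius 1/(m+1),
    enumerated through [unpickle]. *)
Lemma open_measurable_rV (U : set X) : open U -> measurable U.
Proof.
move=> oU.
pose F (k : nat) : set X :=
  if unpickle k is Some qm then
    let B := Q (map_mx ratr (qm.1 : 'rV[rat]_n)) (qm.2 : nat).+1%:R^-1 in
    if `[< B `<=` U >] then B else set0
  else set0.
suff -> : U = \bigcup_k F k.
  apply: bigcupT_measurable => k; rewrite /F; case: unpickle => [qm|//].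
  by case: ifP => // _; exact: measurable_Q.
apply/seteqP; split => [x Ux|x [k _]]; last first.
  rewrite /F; case: unpickle => [qm|//].
  by case: ifPn => //= /asboolP; apply.
have [e e0 eU] := nbhs_Q (open_nbhs_nbhs (conj oU Ux)).
(* A cube of radius [r] containing [x] lies in the cube of radius [2 * r] about [x], hence the
   requirement [2 * r <= e]. *)
pose m := Num.truncn (2 / e); set r : R := m.+1%:R^-1.
have r0 : 0 < r by rewrite invr_gt0.
have re : 2 * r <= e.
  rewrite /r ler_pdivrMr// mulrC -ler_pdivrMr//.
  by apply: ltW; exact: truncnS_gt.
have /choice[q qx] (i : 'I_n) : exists q : rat, `|ratr q - x ord0 i| < r.
  have [|q] := @rat_in_itvoo _ (x ord0 i - r) (x ord0 i + r).
    by rewrite ltrD2l gtrN.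
  by rewrite in_itv/= -ltr_distl => ?; exists q.
pose qv : 'rV[rat]_n := \row_i q i.
exists (pickle (qv, m)) => //; rewrite /F pickleK /= -/r.
rewrite ifT.
  by move=> i; rewrite !mxE distrC.
apply/asboolP => y Hy; apply: eU => i.
have := Hy i; have := qx i; rewrite !mxE => h1 h2.
apply: lt_le_trans re; rewrite mulr_natl mulr2n.
rewrite -(subrKA (ratr (q i))) (le_lt_trans (ler_normD _ _))//.
exact: ltrD.
Qed.

Lemma continuous_measurable_rV (f : X -> R) : continuous f -> measurable_fun setT f.
Proof.
move=> /continuousP cf; apply: (measurability _ (RGenOpens.measurableE R)).
move=> _ [_ [a [b ->] <-]]; rewrite setTI; apply: open_measurable_rV.
exact/cf/interval_open.
Qed.

Lemma ge0_integral_shift h (f : X -> \bar R) : measurable_fun setT f ->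
  (forall x, 0 <= f x)%E ->
  (\int[leb]_x f (x + h)%R = \int[leb]_x f x)%E.
Proof.
move=> mf f0.
have := @ge0_integral_pushforward _ _ X X R (fun x : X => x + h)
  (measurable_shift h) leb setT f measurableT mf (fun x _ => f0 x).
rewrite preimage_setT => <-.
by apply: eq_measure_integral => [|mh A mA _]; [exact: measurable_shift|exact: (leb_shift h mA)].
Qed.

Lemma L1_shift h (f : X -> R) : L1 leb f -> L1 leb (fun x => f (x + h)).
Proof.
move=> Lf; apply/integrableP; split.
  apply/measurable_EFinP.
  exact: measurableT_comp (L1_meas Lf) (measurable_shift h).
rewrite (@ge0_integral_shift h (fun x => `|(f x)%:E|)%E)//.
  by case/integrableP: Lf.
by have /measurable_EFinP := L1_meas (L1_abs Lf).
Qed.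

Lemma Int_shift h (f : X -> R) : L1 leb f -> Int leb (fun x => f (x + h)) = Int leb f.
Proof.
move=> Lf; rewrite /Int /Rintegral; congr fine.
have mf : measurable_fun setT (EFin \o f) by have /measurable_EFinP := L1_meas Lf.
have := @integral_pushforward _ _ X X R (fun x : X => x + h)
  (measurable_shift h) leb setT (EFin \o f) mf.
rewrite preimage_setT => <-//.
  by apply: eq_measure_integral => [|mh A mA _]; [exact: measurable_shift|exact: (leb_shift h mA)].
exact: L1_shift.
Qed.

End topo.

(** * Dominated convergence in L^1 *)

Section dct.
Context d (T : measurableType d) (R : realType) (mu : {measure set T -> \bar R}).

Lemma L1_dct (F : nat -> T -> R) (f G : T -> R) :
  (forall k, measurable_fun setT (F k)) -> L1 mu G ->
  (forall k x, `|F k x| <= G x) ->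
  (forall x, F k x @[k --> \oo] --> f x) ->
  L1 mu f /\ forall e, 0 < e -> \forall k \near \oo, Int mu (fun x => `|F k x - f x|) <= e.
Proof.
move=> mF LG FG Ff.
have mF' k : measurable_fun setT (EFin \o F k) by exact/measurable_EFinP.
have Ff' x : (EFin \o F k) x @[k --> \oo] --> (EFin \o f) x.
  by apply: cvg_EFin; [exact: nearW|exact: Ff].
have mf : measurable_fun setT (EFin \o f).
  by apply: (emeasurable_fun_cvg (fun k => EFin \o F k)) => // x _; exact: Ff'.
have [//|//||||Lf lim0 _] := @dominated_convergence _ _ _ mu setT measurableT
  (fun k => EFin \o F k) (EFin \o f) (EFin \o G).
- by apply: aeW => x _; exact: Ff'.
- by [].
- by apply: aeW => x k _; rewrite /= lee_fin.
split=> // e e0.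
have LFk k : L1 mu (F k) by exact: L1_le LG (FG k).
move/fine_cvgP : lim0 => [_ /cvgrPdist_le /(_ e e0)].
apply: filterS => k /=; rewrite sub0r normrN /Int /Rintegral => H.
by apply: le_trans H; rewrite ler_norm.
Qed.

End dct.

(** * Continuity of translations in L^1 *)

Section density.
Context {R : realType} {n : nat}.
Local Notation X := 'rV[R]_n.
Local Notation leb := (@lebm R n).
Implicit Types (c x y : X) (r : R) (f g h : X -> R).

Definition Cc f := continuous f /\ exists k : nat, forall x, ~ Q 0 k%:R x -> f x = 0.

(** Density of [Cc] in L^1, stated for one function, so that it can be propagated through sums,
    multiples and L^1 limits up to all integrable functions. *)
Definition L1_approx f := L1 leb f /\
  forall e, 0 < e -> exists g, [/\ Cc g, L1 leb g & Int leb (fun x => `|f x - g x|) <= e].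

Lemma L1_ball_bound (g : X -> R) (k M : R) : measurable_fun setT g ->
  (forall x, ~ Q 0 k x -> g x = 0) -> (forall x, `|g x| <= M) ->
  L1 leb g.
Proof.
move=> mg g0 gM; apply: (@L1_le _ _ _ _ (fun x => M * \1_(Q 0 k) x)) => //.
  by apply: L1Z; apply: L1_indic; [exact: measurable_Q|exact: leb_Q].
move=> x; rewrite indicE; have [xQ|] := boolP (x \in Q 0 k).
  by rewrite mulr1.
by rewrite notin_setE => /g0 ->; rewrite normr0 mulr0.
Qed.

Lemma Cc_bounded g : Cc g -> exists M, forall x, `|g x| <= M.
Proof.
move=> [cg [k gk]].
have : compact (Qc (0 : X) k%:R) by exact: compact_Qc.
move=> /(@continuous_compact _ _ g _ (continuous_subspaceT cg)) /compact_bounded.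
move=> [M [_ HM]]; exists (Num.max 0 (M + 1)) => x.
have [xQ|xQ] := pselect (Q 0 k%:R x); last by rewrite gk// normr0 le_max lexx.
rewrite le_max; apply/orP; right; apply: HM; first by rewrite ltrDl.
by exists x => //; exact: Q_Qc.
Qed.

Lemma Cc_L1 g : Cc g -> L1 leb g.
Proof.
move=> Cg; have [M gM] := Cc_bounded Cg; have [cg [k gk]] := Cg.
exact: L1_ball_bound (continuous_measurable_rV cg) gk gM.
Qed.

Lemma Cc_D f g : Cc f -> Cc g -> Cc (fun x => f x + g x).
Proof.
move=> [cf [k fk]] [cg [l gl]]; split.
  by move=> x; exact: (cvgD (cf x) (cg x)).
have leQ (a b : nat) x : (a <= b)%N -> Q 0 a%:R x -> Q 0 b%:R x.
  by move=> ab H i; apply: lt_le_trans (H i) _; rewrite ler_nat.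
exists (maxn k l) => x nQ; rewrite fk ?gl ?addr0// => H; apply: nQ.
  by apply: leQ H; exact: leq_maxr.
by apply: leQ H; exact: leq_maxl.
Qed.

Lemma Cc_Z a f : Cc f -> Cc (fun x => a * f x).
Proof.
move=> [cf [k fk]]; split.
  by move=> x; exact: (cvgM (cvg_cst a) (cf x)).
by exists k => x nQ; rewrite fk ?mulr0.
Qed.

Lemma L1_dist_trans f g h : L1 leb f -> L1 leb g -> L1 leb h ->
  Int leb (fun x => `|f x - h x|) <=
  Int leb (fun x => `|f x - g x|) + Int leb (fun x => `|g x - h x|).
Proof.
move=> Lf Lg Lh; rewrite -IntD//; try by apply/L1_abs/L1B.
apply: Int_le => [||x]; last exact: ler_distD.
  exact/L1_abs/L1B.
by apply: L1D; exact/L1_abs/L1B.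
Qed.

Lemma L1_approx_lim f : L1 leb f ->
  (forall e, 0 < e -> exists2 g, L1_approx g & Int leb (fun x => `|f x - g x|) <= e) ->
  L1_approx f.
Proof.
move=> Lf H; split => // e e0; have e2 : 0 < e / 2 by rewrite divr_gt0.
have [g [Lg Hg] fg] := H _ e2; have [h [Ch Lh gh]] := Hg _ e2.
exists h; split => //; apply: le_trans (L1_dist_trans Lf Lg Lh) _.
by rewrite [leRHS]splitr lerD.
Qed.

Lemma L1_approxD f g : L1_approx f -> L1_approx g -> L1_approx (fun x => f x + g x).
Proof.
move=> [Lf Hf] [Lg Hg]; split; first exact: L1D.
move=> e e0; have e2 : 0 < e / 2 by rewrite divr_gt0.
have [f' [Cf' Lf' ff']] := Hf _ e2; have [g' [Cg' Lg' gg']] := Hg _ e2.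
exists (fun x => f' x + g' x); split; [exact: Cc_D|exact: L1D|].
apply: (@le_trans _ _ (Int leb (fun x => `|f x - f' x| + `|g x - g' x|))).
  apply: Int_le => [||x]; last by rewrite opprD addrACA ler_normD.
    by apply: L1_abs; apply: L1B; exact: L1D.
  by apply: L1D; exact/L1_abs/L1B.
rewrite [leRHS]splitr IntD; [exact: lerD| |]; exact/L1_abs/L1B.
Qed.

Lemma L1_approxZ a f : L1_approx f -> L1_approx (fun x => a * f x).
Proof.
move=> [Lf Hf]; split; first exact: L1Z.
move=> e e0; have e2 : 0 < e / (`|a| + 1) by rewrite divr_gt0// ltr_wpDl.
have [f' [Cf' Lf' ff']] := Hf _ e2.
exists (fun x => a * f' x); split; [exact: Cc_Z|exact: L1Z|].
rewrite (_ : (fun _ => _) = fun x => `|a| * `|f x - f' x|); last first.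
  by apply/funext => x; rewrite -mulrBr normrM.
rewrite IntZ; last exact/L1_abs/L1B.
apply: le_trans (ler_wpM2l (normr_ge0 _) ff') _.
by rewrite mulrCA ger_pMr// ler_pdivrMr ?mul1r ?ler_wpDr// ltr_wpDl.
Qed.

Lemma L1_approx_sum (J : Type) (s : seq J) (F : J -> X -> R) :
  (forall j, L1_approx (F j)) -> L1_approx (fun x => \sum_(j <- s) F j x).
Proof.
move=> LF; elim: s => [|j s IH].
  under eq_fun do rewrite big_nil.
  split; first exact: L10.
  move=> e e0; exists (fun=> 0); split => //; last 2 first.
  - exact: L10.
  - by under eq_fun do rewrite subr0 normr0; rewrite Int0 ltW.
  - by split; [exact: cst_continuous|exists 0%N].
by under eq_fun do rewrite big_cons; exact: L1_approxD.
Qed.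

Definition obox (a b : X) : set X := [set x | forall i, a ord0 i < x ord0 i < b ord0 i].

(** A second generating pi-system beside [boxes]: open intervals as sides make the indicators limits
    of continuous functions. *)
Definition oboxes : set (set X) := [set B | exists a b, B = obox a b].

Lemma oboxes_setI : setI_closed oboxes.
Proof.
move=> _ _ [a [b ->]] [a' [b' ->]].
exists (\row_i Num.max (a ord0 i) (a' ord0 i)), (\row_i Num.min (b ord0 i) (b' ord0 i)).
apply/seteqP; split => x /=.
  move=> [H H'] i; rewrite !mxE gt_max lt_min.
  by have /andP[-> ->] := H i; have /andP[-> ->] := H' i.
move=> H; split => i; have := H i; rewrite !mxE gt_max lt_min.
  by move=> /andP[/andP[-> _] /andP[-> _]].
by move=> /andP[/andP[_ ->] /andP[_ ->]].
Qed.

Lemma obox_Q r : obox (const_mx (- r)) (const_mx r) = Q (0 : X) r.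
Proof.
by apply/seteqP; split => x H i; have := H i; rewrite !mxE subr0 ltr_norml.
Qed.

Lemma measurable_obox a b : measurable (obox a b).
Proof.
have := @measurable_box R n (fun i => `]a ord0 i, b ord0 i[%classic).
rewrite (_ : obox a b = [set x | forall i, `]a ord0 i, b ord0 i[%classic (x ord0 i)]).
  by apply=> i; exact: measurable_itv.
by apply/seteqP; split => x /= H i; have := H i; rewrite /= in_itv.
Qed.

Lemma measurable_oboxes : @measurable _ X = <<s oboxes >>.
Proof.
apply/seteqP; split => [B mB|B]; last first.
  move=> sB; apply: (sB (@measurable _ X)); split.
    exact: sigma_algebra_measurable.
  by move=> _ [a [b ->]]; exact: measurable_obox.
have sS := @smallest_sigma_algebra _ setT oboxes.
apply: (mB <<s oboxes >>); split => //.
rewrite -bigcup_seq => C [i _ [A mA <-]]; rewrite setTI.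
suff : [set A : set R | <<s oboxes >> ((fun x : X => x ord0 i) @^-1` A)] A by [].
have {}mA : (@RGenOpens.G R).-sigma.-measurable A by rewrite -RGenOpens.measurableE.
apply: mA; split.
  split => /=.
  - by rewrite preimage_set0; apply: sigma_algebra0.
  - by move=> D HD; rewrite setTD preimage_setC -setTD; apply: sigma_algebraCD.
  - by move=> F HF; rewrite preimage_bigcup; exact: sigma_algebra_bigcup.
move=> _ [a [b ->]] /=.
(* The slab a < x_i < b is unbounded in the other directions; it is the union of the boxes whose
   other sides run from -k to k. *)
pose E k := obox (\row_j if j == i then a else - k%:R) (\row_j if j == i then b else k%:R).
rewrite (_ : _ @^-1` _ = \bigcup_k E k).
  apply: sigma_algebra_bigcup => k; apply: sub_sigma_algebra.
  by eexists; eexists; reflexivity.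
apply/seteqP; split => [x /=|x [k _] /(_ i)]; last by rewrite !mxE eqxx /= in_itv.
rewrite in_itv/= => xab; have [k xk] := Q_cover x; exists k => // j.
rewrite !mxE; case: eqVneq => [->//|_].
by have := xk j; rewrite mxE subr0 ltr_norml.
Qed.

Lemma continuous_prod (J : Type) (s : seq J) (F : J -> X -> R) :
  (forall j, continuous (F j)) -> continuous (fun x => \prod_(j <- s) F j x).
Proof.
move=> cF; elim: s => [|j s IH].
  by under eq_fun do rewrite big_nil; exact: cst_continuous.
by under eq_fun do rewrite big_cons; move=> x; exact: (cvgM (cF j x) (IH x)).
Qed.

Lemma Q_mono c r s : r <= s -> Q c r `<=` Q c s.
Proof. by move=> rs x H i; exact: lt_le_trans (H i) rs. Qed.

(** The approximants are products of min(1, k d_i), where d_i is the distance to the nearer end of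
    the i-th side, cut at 0. They vanish off the box and lie between 0 and 1, so the indicator
    itself dominates them. *)
Lemma L1_approx_obox a b r : obox a b `<=` Q 0 r -> L1_approx (\1_(obox a b)).
Proof.
move=> abr.
pose d (i : 'I_n) (t : R) := Num.max 0 (Num.min (t - a ord0 i) (b ord0 i - t)).
pose F (k : nat) (x : X) := \prod_(i < n) Num.min 1 (k%:R * d i (x ord0 i)).
have d0 i t : 0 <= d i t by rewrite le_max lexx.
have F01 k x i : 0 <= Num.min 1 (k%:R * d i (x ord0 i)) <= 1.
  by rewrite ge_min lexx le_min ler01 mulr_ge0.
have cF k : continuous (F k).
  apply: continuous_prod => i x.
  have cx : (fun y : X => y ord0 i) y @[y --> x] --> x ord0 i by exact: coord_continuous.
  apply: (@continuous_min _ _ (cst 1) (fun y : X => k%:R * d i (y ord0 i))).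
    exact: cst_continuous.
  apply: continuousM; first exact: cst_continuous.
  apply: (@continuous_max _ _ (cst 0)
    (fun y : X => Num.min (y ord0 i - a ord0 i) (b ord0 i - y ord0 i))).
    exact: cst_continuous.
  apply: (@continuous_min _ _ (fun y : X => y ord0 i - a ord0 i)
     (fun y : X => b ord0 i - y ord0 i)).
    exact: (cvgB cx (cvg_cst _)).
  exact: (cvgB (cvg_cst _) cx).
have F0 k x : ~ obox a b x -> F k x = 0.
  move=> /existsNP[i /negP]; rewrite negb_and -!leNgt => Hi.
  rewrite /F (bigD1 i)//= (_ : d i _ = 0) ?mulr0 ?min_r ?mul0r//.
  apply/max_idPl; rewrite ge_min !subr_le0.
  by case/orP: Hi => ->; rewrite ?orbT.
have F1 k x : 0 <= F k x <= 1.
  rewrite prodr_ge0 => [|i _]; last by case/andP: (F01 k x i).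
  by rewrite prodr_ile1// => i _; exact: F01.
have L1ab : L1 leb (\1_(obox a b) : X -> R).
  apply: L1_indic; first exact: measurable_obox.
  apply: le_lt_trans (leb_Q 0 r); apply: le_measure; rewrite ?inE//.
    exact: measurable_obox.
  exact: measurable_Q.
have Fcvg x : F k x @[k --> \oo] --> (\1_(obox a b) x : R).
  have [Bx|Bx] := pselect (obox a b x); last first.
    rewrite indicE memNset//; apply: cvg_near_cst; apply: nearW => k; exact: F0.
  rewrite indicE mem_set//; apply: cvg_near_cst.
  have H i : \forall k \near \oo, Num.min 1 (k%:R * d i (x ord0 i)) = 1.
    have dp : 0 < d i (x ord0 i).
      rewrite lt_max; apply/orP; right; rewrite lt_min !subr_gt0; exact: Bx.
    exists (Num.truncn (d i (x ord0 i))^-1).+1 => // k /= Hk.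
    apply: min_l; rewrite -ler_pdivrMr// div1r ltW//.
    by apply: lt_le_trans (truncnS_gt _) _; rewrite ler_nat.
  have : \forall k \near \oo, forall i, Num.min 1 (k%:R * d i (x ord0 i)) = 1.
    exact: filter_forall.
  by apply: filterS => k Hk; rewrite /F big1.
apply: L1_approx_lim => // e e0.
have [||k x|x|_ /(_ _ e0)[k _ Hk]] := @L1_dct _ _ _ (@lebm R n) F (\1_(obox a b))
  (\1_(obox a b)) => //.
- by move=> k; exact: continuous_measurable_rV.
- rewrite indicE; have [Bx|Bx] := boolP (x \in obox a b).
    by have /andP[? ?] := F1 k x; rewrite ger0_norm.
  by rewrite F0 ?normr0//; move: Bx; rewrite notin_setE.
have CF : Cc (F k).
  split => //; exists (Num.truncn r).+1 => x nQ; apply: F0 => Bx; apply: nQ.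
  apply: Q_mono (abr _ Bx); exact/ltW/truncnS_gt.
exists (F k); last first.
  by under eq_fun do rewrite distrC; exact: (Hk k (leqnn k)).
split; first exact: Cc_L1.
move=> e' e'0; exists (F k); split => //; first exact: Cc_L1.
by under eq_fun do rewrite subrr normr0; rewrite Int0 ltW.
Qed.

(** Dynkin's theorem on [oboxes]. Intersecting with a fixed cube keeps all indicators integrable, so
    that complements become differences. *)
Lemma L1_approx_setQ (k : nat) A : measurable A -> L1_approx (\1_(A `&` Q 0 k%:R)).
Proof.
have HQ : L1_approx (\1_(Q 0 k%:R)).
  by rewrite -obox_Q; apply: (@L1_approx_obox _ _ k%:R); rewrite obox_Q.
have LI (B : set X) : measurable B -> L1 leb (\1_(B `&` Q 0 k%:R) : X -> R).
  move=> mB; have mBQ : measurable (B `&` Q 0 k%:R).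
    by apply: measurableI => //; exact: measurable_Q.
  apply: L1_indic => //; apply: le_lt_trans (leb_Q 0 k%:R).
  by apply: le_measure; rewrite ?inE//; exact: measurable_Q.
move=> mA; have sA : <<s oboxes >> A by rewrite -measurable_oboxes.
apply: (@dynkin_induction _ X oboxes (fun A => L1_approx (\1_(A `&` Q 0 k%:R)))) sA.
- exact: measurable_oboxes.
- exact: oboxes_setI.
- by rewrite setTI.
- move=> B oB; have : oboxes (B `&` Q 0 k%:R).
    by apply: oboxes_setI => //; rewrite -obox_Q; eexists; eexists; reflexivity.
  move=> [a [b E]]; rewrite E; apply: (@L1_approx_obox _ _ k%:R); rewrite -E.
  exact: subIsetr.
- move=> B mB HB.
  rewrite (_ : \1_(_) = fun x => \1_(Q 0 k%:R) x + (-1) * \1_(B `&` Q 0 k%:R) x).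
    by apply: L1_approxD => //; exact: L1_approxZ.
  apply/funext => x; rewrite !indicE !in_setI in_setC.
  by case: (x \in B); case: (x \in Q 0 k%:R); rewrite /= ?mulr1 ?mulr0 ?subrr ?addr0.
- move=> F mF tF HF.
  pose S m (x : X) : R := \sum_(0 <= j < m) \1_(F j `&` Q 0 k%:R) x.
  have S0 m x : ~ (\bigcup_k F k `&` Q 0 k%:R) x -> S m x = 0.
    move=> nx; rewrite /S big1// => j _; rewrite indicE memNset//.
    by move=> [Fx Qx]; apply: nx; split => //; exists j.
  (* By disjointness only the term of index [i] survives at [x], so the partial sums stay below the
     indicator of the cube. *)
  have S1 m x i : F i x -> Q 0 k%:R x -> S m x = (i < m)%:R.
    move=> Fx Qx; rewrite /S.
    have E j : \1_(F j `&` Q 0 k%:R) x = (j == i)%:R :> R.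
      rewrite indicE; case: eqVneq => [->|ji]; first by rewrite mem_set.
      rewrite memNset// => -[Fj _]; move/trivIsetP : tF => /(_ j i Logic.I Logic.I ji).
      by move=> /seteqP[/(_ x) + _]; apply.
    under eq_bigr do rewrite E.
    elim: m => [|m IH]; first by rewrite big_nil.
    rewrite big_nat_recr//= IH ltnS [(i <= m)%N]leq_eqVlt [m == i]eq_sym.
    by case: (ltngtP i m) => //= _; rewrite ?addr0 ?add0r.
  have mU : measurable (\bigcup_k F k) by exact: bigcupT_measurable.
  have LS m : L1_approx (S m) by exact: L1_approx_sum.
  apply: L1_approx_lim; first exact: LI.
  move=> e e0.
  have [||m x|x|_ /(_ _ e0)[m _ Hm]] := @L1_dct _ _ _ (@lebm R n) S
    (\1_(\bigcup_k F k `&` Q 0 k%:R)) (\1_(Q 0 k%:R)) => //.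
  + by move=> m; case: (LS m) => /L1_meas.
  + by case: HQ.
  + have [[[i _ Fx] Qx]|nx] := pselect ((\bigcup_k F k `&` Q 0 k%:R) x); last first.
      by rewrite S0// normr0 indicE.
    by rewrite (S1 _ _ _ Fx Qx) indicE (mem_set Qx) ger0_norm// ler_nat; case: ltnP.
  + have [/[dup]Hx [[i _ Fx] Qx]|nx] := pselect ((\bigcup_k F k `&` Q 0 k%:R) x); last first.
      rewrite indicE memNset//; apply: cvg_near_cst; apply: nearW => m; exact: S0.
    rewrite indicE mem_set//; apply: cvg_near_cst; exists i.+1 => // m /= im.
    by rewrite (S1 _ _ _ Fx Qx) im.
  exists (S m) => //.
  by under eq_fun do rewrite distrC; exact: (Hm m (leqnn m)).
Qed.

Import HBSimple.

(** A level set of a simple function may have infinite measure, so simple functions are first cut to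
    cubes, where [L1_approx_setQ] applies, and two passages to the limit follow. *)
Lemma L1_approx_L1 f : L1 leb f -> L1_approx f.
Proof.
have H0 g k : L1 leb g -> (exists s : {sfun X >-> R}, g = (s : X -> R)) ->
    L1_approx (fun x => g x * \1_(Q 0 k%:R) x).
  move=> _ [s ->].
  rewrite (_ : (fun x => _) = fun x => \sum_(y <- finmap.enum_fset (fset_set (range s)))
      y * \1_(s @^-1` [set y] `&` Q 0 k%:R) x).
    apply: L1_approx_sum => y; apply: L1_approxZ; apply: L1_approx_setQ.
    exact: measurable_sfunP.
  apply/funext => x; rewrite (fimfunE s) fsbig_finite//= mulr_suml.
  by apply: eq_bigr => y _; rewrite -mulrA indicI.
have H1 g : L1 leb g -> (exists s : {sfun X >-> R}, g = (s : X -> R)) -> L1_approx g.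
  move=> Lg sg; apply: L1_approx_lim => // e e0.
  have [||k x|x|_ /(_ _ e0)[k _ Hk]] := @L1_dct _ _ _ (@lebm R n)
    (fun k x => g x * \1_(Q 0 k%:R) x) g (fun x => `|g x|) => //.
  + move=> k; apply: measurable_funM; first exact: L1_meas Lg.
    by apply: measurable_indic; exact: measurable_Q.
  + exact: L1_abs.
  + by rewrite indicE; case: (_ \in _); rewrite ?mulr1 ?mulr0 ?normr0.
  + have [k xk] := Q_cover x; apply: cvg_near_cst; exists k => // m /= km.
    rewrite indicE mem_set ?mulr1//; apply: Q_mono xk; by rewrite ler_nat.
  exists (fun x => g x * \1_(Q 0 k%:R) x); first exact: H0.
  by under eq_fun do rewrite distrC; exact: (Hk k (leqnn k)).
move=> Lf; apply: L1_approx_lim => // e e0.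
have [s [Ls _ /fine_cvgP[_ /cvgrPdist_le /(_ e e0)[k _ /(_ k (leqnn k))]]]] :=
  approximation_sfun_integrable measurableT Lf.
rewrite /= sub0r normrN => Hk.
exists (s k); first by apply: H1; [exact: Ls|exists (s k)].
by apply: le_trans Hk; rewrite ler_norm.
Qed.

(** For [Cc] functions, failure would yield a sequence of shifts tending to 0, against dominated
    convergence. Density and the invariance of [Int] under shifts extend this, with errors e/4, e/2
    and e/4. *)
Lemma L1_shift_cvg f e : L1 leb f -> 0 < e ->
  exists2 r, 0 < r & forall h : X, `|h| < r -> Int leb (fun x => `|f (x + h) - f x|) <= e.
Proof.
have HC g : Cc g -> 0 < e -> exists2 r, 0 < r & forall h : X, `|h| < r ->
    Int leb (fun x => `|g (x + h) - g x|) <= e / 2.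
  move=> Cg e0; have [M gM] := Cc_bounded Cg; have [cg [k gk]] := Cg.
  have e2 : 0 < e / 2 by rewrite divr_gt0.
  apply: contrapT => /forall2NP H.
  have /choice[h Hh] m : exists h : X, `|h| < m.+1%:R^-1 /\
      ~ Int leb (fun x => `|g (x + h) - g x|) <= e / 2.
    have [[]|] := H m.+1%:R^-1; first by rewrite invr_gt0 ltr0n.
    by move=> /existsNP[h /not_implyP[h1 h2]]; exists h.
  have hcvg : h m @[m --> \oo] --> (0 : X).
    apply/cvgrPdist_lt => d d0; near=> m; rewrite sub0r normrN.
    apply: lt_trans (Hh m).1 _; near: m; exact: (near_infty_natSinv_lt (PosNum d0)).
  have M0 : 0 <= M by apply: le_trans (gM 0).
  (* The shifts have norm at most 1, so every translate vanishes outside the cube of radius k +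
     1. *)
  have [|||x|_ /(_ _ e2)[m _ /(_ m (leqnn m)) Hm]] := @L1_dct _ _ _ (@lebm R n)
    (fun m x => g (x + h m)) g (fun x => M * \1_(Q 0 (k%:R + 1)) x).
  + move=> m; apply: measurableT_comp; last exact: measurable_shift.
    exact: continuous_measurable_rV.
  + by apply: L1Z; apply: L1_indic; [exact: measurable_Q|exact: leb_Q].
  + move=> m x; have [Qx|nQ] := pselect (Q 0 k%:R (x + h m)); last first.
      by rewrite gk// normr0 mulr_ge0.
    rewrite indicE mem_set ?mulr1// => i; have := Qx i; rewrite !mxE !subr0 => H1.
    rewrite -[x ord0 i](addrK (h m ord0 i)) (le_lt_trans (ler_normB _ _))//.
    rewrite ltr_leD// (le_trans (coord_norm _ _))// (le_trans (ltW (Hh m).1))//.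
    by rewrite invf_le1 ?ler1n ?ltr0n.
  + apply: (@cvg_comp _ _ _ (fun m => x + h m) g _ (nbhs x)); last exact: cg.
    have xh : x + h m @[m --> \oo] --> x + 0 by exact: (cvgD (cvg_cst x) hcvg).
    by rewrite addr0 in xh; exact: xh.
  by have [] := Hh m.
move=> Lf e0; have e4 : 0 < e / 4 by rewrite divr_gt0.
have [_ /(_ _ e4)[g [Cg Lg fg]]] := L1_approx_L1 Lf.
have [r r0 Hr] := HC g Cg e0; exists r => // h hr.
have Lfh := L1_shift h Lf; have Lgh := L1_shift h Lg.
apply: le_trans (L1_dist_trans Lfh Lgh Lf) _.
apply: le_trans (lerD (lexx _) (L1_dist_trans Lgh Lg Lf)) _.
rewrite (Int_shift h (f := fun x => `|f x - g x|)); last exact/L1_abs/L1B.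
rewrite (_ : e = e / 4 + (e / 2 + e / 4)); last by field.
rewrite lerD// lerD//; first exact: Hr.
by under eq_fun do rewrite distrC.
Unshelve. all: by end_near. Qed.

End density.

(** * Smooth bump functions *)

Section bump1.
Context {R : realType}.
Implicit Types (P : {poly R}) (x t : R).

(** The classical flat function exp(-1/t), times a polynomial in 1/t. The polynomial makes the class
    closed under differentiation, [flatD] being the effect on it, so that smoothness is an
    induction. *)
Definition flat P t : R := if 0 < t then P.[t^-1] * expR (- t^-1) else 0.

Definition flatD P : {poly R} := (P - P^`())%R * 'X^2.

(** With y = 1/t, the bound y^(i+3) <= (i+3)! exp(y) makes the i-th monomial at most (i+3)! t^3. The
    weaker t^2 already forces the derivative at 0 to vanish. *)
Lemma flat_near0 P : exists2 K, 0 <= K & forall t, 0 < t -> t <= 1 ->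
  `|flat P t| <= K * t ^+ 2.
Proof.
exists (\sum_(i < size P) `|P`_i| * (i.+3)`!%:R); first by apply: sumr_ge0 => i _; exact: mulr_ge0.
move=> t t0 t1; rewrite /flat t0 horner_coef mulr_suml mulr_suml.
apply: le_trans (ler_norm_sum _ _ _) _; apply: ler_sum => i _.
have y0 : 0 < t^-1 by rewrite invr_gt0.
have y1 : 1 <= t^-1 by rewrite invf_ge1.
rewrite !normrM -!mulrA ler_wpM2l// normrX (gtr0_norm y0) (gtr0_norm (expR_gt0 _)) expRN.
rewrite ler_pdivrMr ?expR_gt0//.
have F0 : 0 < (i.+3`!%:R : R) by rewrite ltr0n fact_gt0.
have H : t^-1 ^+ i.+3 <= i.+3`!%:R * expR t^-1.
  rewrite mulrC -ler_pdivrMr//; apply: le_trans (expR_ge1Dxn i.+2 (ltW y0)).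
  by rewrite lerDr.
rewrite mulrAC; apply: le_trans (ler_wpM2r (sqr_ge0 t) H).
rewrite exprSr exprSr -!mulrA (_ : t^-1 * (t^-1 * t ^+ 2) = 1); last by field; rewrite gt_eqF.
by rewrite mulr1 exprSr ler_peMr// exprn_ge0// ltW.
Qed.

Lemma flat_derive P t : is_derive t 1 (flat P) (flat (flatD P) t).
Proof.
have [t0|t0|->] := ltgtP t 0.
- rewrite {2}/flat ltNge (ltW t0) /=.
  apply: (@near_eq_is_derive _ _ _ (cst 0)) => //.
  by near=> s; rewrite /flat ltNge ltW//=; near: s; exact: lt_nbhsl.
- rewrite {2}/flat t0.
  have tn0 : t != 0 by rewrite gt_eqF.
  have dV : is_derive t 1 (fun s : R => s^-1) (- t ^- 2).
    by have := @is_deriveV _ id t 1 1 tn0 (is_derive_id _ _); rewrite [_ *: _]mulr1.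
  have dP : is_derive t 1 (fun s => P.[s^-1]) (P^`().[t^-1] * - t ^- 2).
    have dp : is_derive (t^-1) 1 (horner P) (P^`().[t^-1]).
      by apply: DeriveDef; [exact: derivable_horner|rewrite -derive1E derivE].
    by have := @is_derive1_comp _ (horner P) (fun s : R => s^-1) _ _ _ dp dV.
  have dE : is_derive t 1 (fun s => expR (- s^-1)) (expR (- t^-1) * t ^- 2).
    have de : is_derive (- t^-1) 1 expR (expR (- t^-1)) by exact: is_derive_expR.
    have dN : is_derive t 1 (fun s : R => - s^-1) (t ^- 2).
      by have := @is_deriveN _ _ _ _ _ _ _ dV; rewrite opprK.
    by have := @is_derive1_comp _ expR (fun s : R => - s^-1) _ _ _ de dN.
  have dM := is_deriveM dP dE.
  have nE : \forall s \near t, ((fun s : R => P.[s^-1]) * (fun s : R => expR (- s^-1))) s = flat P s.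
    by near=> s; rewrite /flat ifT//; near: s; exact: lt_nbhsr.
  have := near_eq_is_derive nE dM.
  rewrite /flatD hornerM hornerXn hornerD hornerN exprVn.
  set d := (X in is_derive _ _ _ X -> _); rewrite (_ : _ * _ = d)//.
  by rewrite /d /GRing.scale/=; ring.
- rewrite {2}/flat ltxx.
  have [K K0 HK] := flat_near0 P.
  (* At 0 the difference quotient is zero on the left and at most K h on the right. *)
  have H : h^-1 *: (flat P (h *: 1 + 0) - flat P 0) @[h --> 0^'] --> (0 : R).
    apply/cvgrPdist_le => e e0; near=> h.
    rewrite sub0r normrN [flat P 0]/flat ltxx subr0 addr0 [h *: 1]mulr1.
    have [h0|h0] := ltP 0 h; last by rewrite /flat ltNge h0 /= scaler0 normr0 ltW.
    rewrite normrM normfV (gtr0_norm h0) ler_pdivrMl//.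
    apply: (@le_trans _ _ (K * h ^+ 2)).
      apply: HK => //.
      apply: le_trans (ler_norm _) _; apply: ltW; near: h.
      by apply: dnbhs0_lt.
    rewrite expr2 mulrCA; apply: ler_wpM2l; first exact: ltW.
    have hK : h < e / (K + 1).
      apply: le_lt_trans (ler_norm _) _; near: h; apply: dnbhs0_lt.
      by rewrite divr_gt0// ltr_wpDl.
    have K1 : 0 < K + 1 by rewrite ltr_wpDl.
    apply: (@le_trans _ _ ((K + 1) * h)); first by rewrite ler_pM2r// lerDl.
    by rewrite mulrC -ler_pdivlMr// ltW.
  apply: DeriveDef; last exact: cvg_lim H.
  by apply/cvg_ex; exists 0.
Unshelve. all: by end_near. Qed.

Definition beta t : R := flat 1 (1 - t) * flat 1 (1 + t).

Lemma flat1_ge0 t : 0 <= flat 1 t.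
Proof. by rewrite /flat; case: ifP => // _; rewrite hornerC mul1r expR_ge0. Qed.

Lemma beta_ge0 t : 0 <= beta t.
Proof. by rewrite mulr_ge0// flat1_ge0. Qed.

Lemma beta_eq0 t : 1 <= `|t| -> beta t = 0.
Proof.
rewrite /beta /flat ler_normr => /orP[t1|t1].
  by rewrite ltNge subr_le0 t1 /= mul0r.
by rewrite [0 < 1 + t]ltNge -[t]opprK subr_le0 t1 /= mulr0.
Qed.

Lemma beta_half : exists2 c : R, 0 < c & forall t, `|t| <= 2^-1 -> c <= beta t.
Proof.
have H s : 2^-1 <= s -> expR (- 2) <= flat 1 s.
  move=> hs; have s0 : 0 < s by rewrite (lt_le_trans _ hs).
  rewrite /flat s0 hornerC mul1r ler_expR lerN2 -[leRHS]invrK lef_pV2// posrE//.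
exists (expR (- 2) * expR (- 2)); first by rewrite mulr_gt0 ?expR_gt0.
move=> t; rewrite ler_norml => /andP[t1 t2].
rewrite ler_pM ?expR_ge0//; apply: H; lra.
Qed.

End bump1.

(** * Smooth functions and bumps in several variables *)

Section smooth.
Context {R : realType} {n : nat}.
Local Notation X := 'rV[R]_n.
Implicit Types (c x y h : X) (r : R) (f g : X -> R) (i j : 'I_n).

Lemma C_k_cont k f : C_k k f -> continuous f.
Proof. by case: k => [|k] []. Qed.

Lemma C_kS k f : C_k k.+1 f -> C_k k f.
Proof.
elim: k f => [|k IH] f [cf Hf]; split => // i; have [df Cf] := Hf i; split => //.
exact: IH.
Qed.

Lemma partialD f g i : (forall x, derivable f x (unit_vector i)) ->
  (forall x, derivable g x (unit_vector i)) ->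
  partial i (fun x => f x + g x) = fun x => partial i f x + partial i g x.
Proof. by move=> df dg; apply/funext => x; rewrite /partial -deriveD. Qed.

Lemma partialM f g i : (forall x, derivable f x (unit_vector i)) ->
  (forall x, derivable g x (unit_vector i)) ->
  partial i (fun x => f x * g x) = fun x => f x * partial i g x + g x * partial i f x.
Proof. by move=> df dg; apply/funext => x; rewrite /partial -deriveM. Qed.

Lemma partial_cst a i : partial i (fun _ : X => a) = fun=> 0.
Proof. by apply/funext => x; rewrite /partial derive_cst. Qed.

Lemma C_k_cst k a : C_k k (fun _ : X => a).
Proof.
elim: k a => [|k IH] a; split; try exact: cst_continuous; first by [].
by move=> i; rewrite partial_cst; split => // x; exact: derivable_cst.
Qed.

Lemma C_kD k f g : C_k k f -> C_k k g -> C_k k (fun x => f x + g x).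
Proof.
elim: k f g => [|k IH] f g [cf Hf] [cg Hg]; split => //;
  try by move=> x; exact: (cvgD (cf x) (cg x)).
move=> i; have [df Cf] := Hf i; have [dg Cg] := Hg i.
split; first by move=> x; exact: (derivableD (df x) (dg x)).
by rewrite (partialD df dg); exact: IH.
Qed.

Lemma C_kM k f g : C_k k f -> C_k k g -> C_k k (fun x => f x * g x).
Proof.
elim: k f g => [|k IH] f g Cf Cg.
  have cf := C_k_cont Cf; have cg := C_k_cont Cg.
  by split => //; move=> x; exact: (cvgM (cf x) (cg x)).
have Sf := C_kS Cf; have Sg := C_kS Cg.
move: Cf Cg => [cf Hf] [cg Hg].
split; first by move=> x; exact: (cvgM (cf x) (cg x)).
move=> i; have [df Cf] := Hf i; have [dg Cg] := Hg i.
split; first by move=> x; exact: (derivableM (df x) (dg x)).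
by rewrite (partialM df dg); apply: C_kD; exact: IH.
Qed.

Lemma C_kZ k a f : C_k k f -> C_k k (fun x => a * f x).
Proof. by move=> Cf; exact: C_kM (C_k_cst _ _) Cf. Qed.

Lemma C_k_prod (J : Type) (s : seq J) (F : J -> X -> R) k :
  (forall a, C_k k (F a)) -> C_k k (fun x => \prod_(a <- s) F a x).
Proof.
move=> CF; elim: s => [|j s IH].
  by under eq_fun do rewrite big_nil; exact: C_k_cst.
by under eq_fun do rewrite big_cons; exact: C_kM.
Qed.

Lemma shift_diff f h i x :
  (fun t => t^-1 *: ((fun y => f (y + h)) (t *: unit_vector i + x) - f (x + h))) =
  (fun t => t^-1 *: (f (t *: unit_vector i + (x + h)) - f (x + h))).
Proof. by apply/funext => t; rewrite addrA. Qed.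

Lemma derivable_shift f h i x : derivable f (x + h) (unit_vector i) ->
  derivable (fun y => f (y + h)) x (unit_vector i).
Proof. by rewrite /derivable shift_diff. Qed.

Lemma partial_shift f h i :
  partial i (fun y => f (y + h)) = fun y => partial i f (y + h).
Proof. by apply/funext => x; rewrite /partial /derive shift_diff. Qed.

Lemma C_k_shift k f h : C_k k f -> C_k k (fun x => f (x + h)).
Proof.
have cs f' : continuous f' -> continuous (fun x => f' (x + h)).
  move=> cf x; apply: continuous_comp; last exact: cf.
  exact: (cvgD cvg_id (cvg_cst h)).
elim: k f => [|k IH] f [cf Hf]; split => //; try exact: cs.
move=> i; have [df Cf] := Hf i; split.
  by move=> x; exact: derivable_shift.
by rewrite partial_shift; exact: IH.
Qed.

(** Reduces a partial difference quotient to one on the line. In a direction other than [j] it is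
    written as the quotient of a constant function, so that [derivable_cst] and [derive_cst] apply
    to it. *)
Lemma coord_diff (B : R -> R) i j x :
  (fun t => t^-1 *: ((fun y : X => B (y ord0 j)) (t *: unit_vector i + x) - B (x ord0 j))) =
  if j == i then (fun t => t^-1 *: (B (t *: (1 : R^o) + x ord0 j) - B (x ord0 j)))
  else (fun t => t^-1 *: (cst (B (x ord0 j)) (t *: (1 : R^o) + 0) - cst (B (x ord0 j)) (0 : R^o))).
Proof.
case: eqVneq => [->|ji]; apply/funext => t; rewrite !mxE.
  by rewrite !eqxx.
by rewrite (negbTE ji) andbF mulr0 add0r.
Qed.

Lemma is_derive_coord (B : R -> R) i j x d : is_derive (x ord0 j) 1 B d ->
  is_derive x (unit_vector i) (fun y : X => B (y ord0 j)) (if j == i then d else 0).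
Proof.
move=> [dB <-]; apply: DeriveDef.
  rewrite /derivable coord_diff; case: eqVneq => _; first exact: dB.
  exact: (@derivable_cst R R^o R^o _ _ _).
rewrite /derive coord_diff; case: eqVneq => _; first by [].
exact: (@derive_cst R R^o R^o _ _ _).
Qed.

Lemma continuous_coord (B : R -> R) j : continuous B ->
  continuous (fun y : X => B (y ord0 j)).
Proof. by move=> cB x; apply: continuous_comp; [exact: coord_continuous|exact: cB]. Qed.

Lemma C_k_coord k (B b : R -> R) j : (forall t : R, is_derive t 1 B (b t)) ->
  C_k k (fun x : X => b (x ord0 j)) -> C_k k.+1 (fun x : X => B (x ord0 j)).
Proof.
move=> dB Cb; split.
  apply: continuous_coord => t; apply/differentiable_continuous/derivable1_diffP.
  by case: (dB t).
move=> i; have H x := is_derive_coord i (dB (x ord0 j)).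
split; first by move=> x; case: (H x).
rewrite (_ : partial i _ = fun x => (if j == i then 1 else 0) * b (x ord0 j)).
  exact: C_kZ.
apply/funext => x; rewrite /partial; case: (H x) => _ ->.
by case: ifP; rewrite ?mul1r ?mul0r.
Qed.

Lemma is_derive_affine (B : R -> R) (a c d t : R) : is_derive (a * t + c) 1 B d ->
  is_derive t 1 (fun s => B (a * s + c)) (d * a).
Proof.
move=> dB; have dA : is_derive t 1 (fun s => a * s + c) a.
  have := is_deriveD (is_deriveM (is_derive_cst a t 1) (is_derive_id t 1)) (is_derive_cst c t 1).
  by rewrite /= addr0 scaler0 addr0 [_ *: _]mulr1; apply.
exact: (@is_derive1_comp _ B (fun s => a * s + c)).
Qed.

(** Differentiating replaces [P] by [flatD P] and multiplies by [a], so the induction is over all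
    polynomials and all factors [l]. *)
Lemma C_k_flat k (P : {poly R}) (l a c : R) j :
  C_k k (fun x : X => l * flat P (a * x ord0 j + c)).
Proof.
elim: k P l => [|k IH] P l.
  split => //; apply: (@continuous_coord (fun t => l * flat P (a * t + c))) => t.
  apply/differentiable_continuous/derivable1_diffP.
  apply: derivableM; first exact: derivable_cst.
  by case: (is_derive_affine (flat_derive P (a * t + c))).
apply: (@C_k_coord k (fun t => l * flat P (a * t + c))
  (fun t => l * a * flat (flatD P) (a * t + c))); last exact: IH.
move=> t; have H := is_derive_affine (flat_derive P (a * t + c)).
have := is_deriveM (is_derive_cst l t 1) H.
by rewrite scaler0 addr0 /GRing.scale /= [flat _ _ * a]mulrC mulrA; apply.
Qed.

Definition bump c r x : R := \prod_(i < n) beta (r^-1 * x ord0 i + (- (r^-1 * c ord0 i))).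

Lemma C_k_beta k (a c : R) j : C_k k (fun x : X => beta (a * x ord0 j + c)).
Proof.
rewrite /beta; apply: C_kM.
  rewrite (_ : (fun _ => _) = fun x : X => 1 * flat 1 (- a * x ord0 j + (1 - c))).
    exact: C_k_flat.
  by apply/funext => x; rewrite mul1r; congr (flat 1 _); ring.
rewrite (_ : (fun _ => _) = fun x : X => 1 * flat 1 (a * x ord0 j + (1 + c))).
  exact: C_k_flat.
by apply/funext => x; rewrite mul1r; congr (flat 1 _); ring.
Qed.

Lemma C_k_bump k c r : C_k k (bump c r).
Proof. by apply: C_k_prod => j; exact: C_k_beta. Qed.

Lemma bump_ge0 c r x : 0 <= bump c r x.
Proof. by apply: prodr_ge0 => i _; exact: beta_ge0. Qed.

Lemma bump_eq0 c r x : 0 < r -> ~ Q c r x -> bump c r x = 0.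
Proof.
move=> r0 /existsNP[i /negP]; rewrite -leNgt => Hi.
rewrite /bump (bigD1 i)//= beta_eq0 ?mul0r//.
by rewrite -mulrBr normrM gtr0_norm ?invr_gt0// mulrC ler_pdivlMr ?mul1r.
Qed.

(** A positive lower bound on the half cube, uniform in the centre, does the work of a cutoff equal
    to 1 there; it only changes constants. *)
Lemma bump_half r : 0 < r -> exists2 d : R, 0 < d &
  forall c x, Q c (r / 2) x -> d <= bump c r x.
Proof.
move=> r0; have [d d0 Hd] := @beta_half R.
exists (\prod_(i < n) d); first exact: prodr_gt0.
move=> c x Qx; apply: ler_prod => i _; rewrite ltW//= Hd//.
rewrite -mulrBr normrM gtr0_norm ?invr_gt0// ler_pdivrMl//.
by apply: ltW; exact: Qx.
Qed.

Lemma bump_shift c r x h : bump c r (x + h) = bump (c - h) r x.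
Proof. by apply: eq_bigr => i _; congr beta; rewrite !mxE; ring. Qed.

End smooth.

(** * Mollification *)

Section mollify.
Context {R : realType} {n : nat}.
Local Notation X := 'rV[R]_n.
Local Notation leb := (@lebm R n).
Implicit Types (c x y h : X) (r : R) (f g rho phi : X -> R) (i j : 'I_n).

Definition Ccinf phi := (forall k, C_k k phi) /\ exists M, forall x, ~ Qc 0 M x -> phi x = 0.

Lemma partial_supp phi (K : set X) i : closed K -> (forall x, ~ K x -> phi x = 0) ->
  forall x, ~ K x -> partial i phi x = 0.
Proof.
move=> cK phi0 x Kx; rewrite /partial.
rewrite (@near_eq_derive _ _ _ phi (cst 0)); first exact: derive_cst.
have : nbhs x (~` K) by apply: open_nbhs_nbhs; split => //; exact: closed_openC.
by apply: filterS => y /= Ky; rewrite phi0.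
Qed.

Lemma C_k_partial phi i : (forall k, C_k k phi) -> forall k, C_k k (partial i phi).
Proof. by move=> Cphi k; have [_ /(_ i)[]] := Cphi k.+1. Qed.

Lemma Ccinf_partial phi i : Ccinf phi -> Ccinf (partial i phi).
Proof.
move=> [Cphi [M phi0]]; split; first exact: C_k_partial.
by exists M; apply: partial_supp => //; exact: closed_Qc.
Qed.

Lemma Ccinf_cont phi : Ccinf phi -> continuous phi.
Proof. by move=> [/(_ 0%N) /C_k_cont]. Qed.

Lemma Ccinf_Cc phi : Ccinf phi -> Cc phi.
Proof.
move=> Tphi; have [_ [M phi0]] := Tphi; split; first exact: Ccinf_cont.
exists (Num.truncn M).+1 => x nQ; apply: phi0 => Qx; apply: nQ.
by apply: Qc_Q Qx; exact: truncnS_gt.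
Qed.

Lemma Ccinf_L1 phi : Ccinf phi -> L1 leb phi.
Proof. by move/Ccinf_Cc/Cc_L1. Qed.

Lemma Ccinf_meas phi : Ccinf phi -> measurable_fun setT phi.
Proof. by move/Ccinf_L1/L1_meas. Qed.

Lemma Ccinf_bounded phi : Ccinf phi -> exists M, forall x, `|phi x| <= M.
Proof. by move/Ccinf_Cc/Cc_bounded. Qed.

Lemma Ccinf_shift phi h : Ccinf phi -> Ccinf (fun x => phi (x + h)).
Proof.
move=> [Cphi [M phi0]]; split; first by move=> k; exact: C_k_shift.
exists (M + `|h|) => x nQ; apply: phi0 => Qx; apply: nQ => i.
have := Qx i; rewrite !mxE !subr0 => H.
rewrite -[x ord0 i](addrK (h ord0 i)) (le_trans (ler_normB _ _))// lerD//.
exact: coord_norm.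
Qed.

Lemma Ccinf_mull phi eta : (forall k, C_k k eta) -> Ccinf phi -> Ccinf (fun x => eta x * phi x).
Proof.
move=> Ceta [Cphi [M phi0]]; split; first by move=> k; exact: C_kM.
by exists M => x /phi0 ->; rewrite mulr0.
Qed.

Lemma Ccinf_L1M phi f : Ccinf phi -> L1 leb f -> L1 leb (fun x => phi x * f x).
Proof.
move=> Tphi Lf; have [M HM] := Ccinf_bounded Tphi.
exact: L1_bound_mul (Ccinf_meas Tphi) HM Lf.
Qed.

(** A correlation rather than a convolution: the kernel at [x] is a translate of [rho], which can be
    used directly to test a weak derivative. The price is a sign at each differentiation. *)
Definition moll rho f x : R := Int leb (fun y => rho (y - x) * f y).

Lemma moll_L1 rho f x : Ccinf rho -> L1 leb f -> L1 leb (fun y => rho (y - x) * f y).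
Proof. by move=> Trho Lf; apply: Ccinf_L1M => //; exact: Ccinf_shift. Qed.

(** Dominated convergence is available along sequences, so continuity is reduced to sequences of
    increments. *)
Lemma cvg_of_seq (F : X -> R) :
  (forall x (h : nat -> X), h k @[k --> \oo] --> (0 : X) -> F (x + h k) @[k --> \oo] --> F x) ->
  continuous F.
Proof.
move=> H x; apply/(@cvgrPdist_lt _ _ _ (nbhs x) (nbhs_filter x) F (F x)) => e e0.
apply: contrapT => Hn.
have /choice[h Hh] k : exists h : X, `|h| < k.+1%:R^-1 /\ ~ (`|F x - F (x + h)| < e).
  apply: contrapT => Hk; apply: Hn; apply/nbhs_ballP; exists k.+1%:R^-1 => /=.
    by rewrite invr_gt0.
  move=> y; rewrite -ball_normE /= => Hy.
  apply: contrapT => Hf; apply: Hk; exists (y - x).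
  by rewrite [x + _]addrC subrK (distrC y x).
have hcvg : h k @[k --> \oo] --> (0 : X).
  apply/cvgrPdist_lt => d d0; near=> m; rewrite sub0r normrN.
  by apply: lt_trans (Hh m).1 _; near: m; exact: (near_infty_natSinv_lt (PosNum d0)).
have /cvgrPdist_lt /(_ e e0)[k _ /(_ k (leqnn k))] := H x h hcvg.
by have [_] := Hh k.
Unshelve. all: by end_near. Qed.

Lemma moll_continuous rho f : Ccinf rho -> L1 leb f -> continuous (moll rho f).
Proof.
move=> Trho Lf; apply: cvg_of_seq => x h h0; have [M HM] := Ccinf_bounded Trho.
have Lx k := moll_L1 (x + h k) Trho Lf.
have M0 : 0 <= M by apply: le_trans (HM 0).
have [||k y|y|Lfx H] := @L1_dct _ _ _ leb (fun k y => rho (y - (x + h k)) * f y)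
  (fun y => rho (y - x) * f y) (fun y => M * `|f y|).
- by move=> k; exact: L1_meas (Lx k).
- exact/L1Z/L1_abs.
- by rewrite normrM ler_wpM2r.
- apply: cvgM; last exact: cvg_cst.
  apply: (@cvg_comp _ _ _ (fun m => y - (x + h m)) rho _ (nbhs (y - x))).
    have xh : y - (x + h m) @[m --> \oo] --> y - (x + 0).
      by apply: cvgB; [exact: cvg_cst|apply: cvgD => //; exact: cvg_cst].
    by rewrite addr0 in xh; exact: xh.
  exact: Ccinf_cont.
apply/cvgrPdist_le => e e0; apply: filterS (H e e0) => k; apply: le_trans.
rewrite distrC /moll -IntB; [|exact: Lx|exact: Lfx].
by apply: Int_norm; apply: L1B; [exact: Lx|exact: Lfx].
Qed.

Lemma partial_diff (F : X -> R) i x :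
  (fun t => t^-1 *: (F (t *: unit_vector i + x) - F x)) =
  (fun t => t^-1 *: ((fun s => F (x + s *: unit_vector i)) (t + 0) -
      (fun s => F (x + s *: unit_vector i)) 0)).
Proof. by apply/funext => t; rewrite /= scale0r !addr0 [_ + x]addrC. Qed.

Lemma line_derive (F : X -> R) i x t : derivable F (x + t *: unit_vector i) (unit_vector i) ->
  is_derive t 1 (fun s => F (x + s *: unit_vector i)) (partial i F (x + t *: unit_vector i)).
Proof.
move=> dF; have E : (fun s => s^-1 *: (F (s *: unit_vector i + (x + t *: unit_vector i)) -
    F (x + t *: unit_vector i))) =
   (fun h : R => h^-1 *: ((fun s : R => F (x + s *: unit_vector i)) (h *: (1 : R^o) + t)
      - F (x + t *: unit_vector i))).
  by apply/funext => s; rewrite [s%:A]mulr1 scalerDl addrCA.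
apply: DeriveDef.
  by rewrite /derivable -E.
by rewrite /derive -E.
Qed.

(** Differentiation under the integral along the line through [x]; the integrand's derivative is
    dominated by M |f|, with [M] a bound for the derivative of [rho]. *)
Lemma moll_derive rho f i x : Ccinf rho -> L1 leb f ->
  t^-1 *: (moll rho f (t *: unit_vector i + x) - moll rho f x) @[t --> 0^'] -->
  - moll (partial i rho) f x.
Proof.
move=> Trho Lf; have Tp := Ccinf_partial i Trho; have [M HM] := Ccinf_bounded Tp.
have M0 : 0 <= M by apply: le_trans (HM 0).
pose F (t : R) y := rho (y - (x + t *: unit_vector i)) * f y.
have dF (t : R) y : is_derive t 1 (F^~ y)
    (- partial i rho (y - (x + t *: unit_vector i)) * f y).
  have dr : derivable rho (y - x + (- t) *: unit_vector i) (unit_vector i).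
    by have [C1 _] := Trho; have [_ /(_ i)[]] := C1 1%N.
  have d1 := line_derive dr.
  have d2 : is_derive t 1 (-%R : R -> R) (- 1) by exact: is_deriveNid.
  have d3 := @is_derive1_comp _ _ -%R t _ _ d1 d2.
  have E : F^~ y = ((fun s => rho (y - x + s *: unit_vector i)) \o -%R) * cst (f y).
    apply/funext => s; rewrite /F.
    transitivity (rho (y - x + (- s) *: unit_vector i) * f y); last by [].
    by rewrite opprD addrA scaleNr.
  rewrite E; have := is_deriveM d3 (is_derive_cst (f y) t 1).
  by rewrite scaler0 add0r scaleNr opprD addrA [cst _ _ *: _]mulrC mulrN1.
have := @cvg_differentiation_under_integral R _ _ leb F setT measurableT 0 (-1) 1.
rewrite partial_diff.
have -> : - moll (partial i rho) f x = \int[leb]_(y in setT) partial1of2 F 0 y.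
  rewrite /moll -IntN; last exact: moll_L1.
  congr Int; apply/funext => y; rewrite partial1of2E.
  by case: (dF 0 y) => _ ->; rewrite scale0r addr0 mulNr.
apply.
- by rewrite /= in_itv/= ltrN10 ltr01.
- by move=> t _; exact: moll_L1.
- by move=> t y _ _; case: (dF t y).
- by move=> y; exact: mulr_ge0 M0 (normr_ge0 (f y)).
- exact: L1Z (L1_abs Lf).
- move=> t y _ _; rewrite partial1of2E; case: (dF t y) => _ ->.
  by rewrite mulNr normrN normrM ler_wpM2r.
Qed.

Lemma partial_moll rho f i : Ccinf rho -> L1 leb f ->
  partial i (moll rho f) = fun x => (-1) * moll (partial i rho) f x.
Proof.
move=> Trho Lf; apply/funext => x; rewrite mulN1r.
apply: cvg_lim; [exact: Rhausdorff|exact: moll_derive].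
Qed.

Lemma C_k_moll k rho f : Ccinf rho -> L1 leb f -> C_k k (moll rho f).
Proof.
elim: k rho => [|k IH] rho Trho Lf; split => //; try exact: moll_continuous.
move=> i; split.
  by move=> x; apply/cvg_ex; eexists; exact: moll_derive.
by rewrite partial_moll//; apply: C_kZ; apply: IH => //; exact: Ccinf_partial.
Qed.

Lemma moll_supp rho f c r s : (forall x, ~ Qc 0 r x -> rho x = 0) ->
  (forall x, ~ Qc c s x -> f x = 0) ->
  forall x, ~ Qc c (s + r) x -> moll rho f x = 0.
Proof.
move=> rho0 f0 x nQ; rewrite /moll -[RHS](Int0 leb); congr Int; apply/funext => y.
have [Qy|/f0 ->] := pselect (Qc c s y); last by rewrite mulr0.
rewrite rho0 ?mul0r// => Qyx; apply: nQ => i.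
have := Qyx i; have := Qy i; rewrite !mxE subr0 => H1 H2.
rewrite -(subrKA (y ord0 i)) (le_trans (ler_normD _ _))// addrC lerD//.
by rewrite distrC.
Qed.

End mollify.

(** * Convergence of mollifications and the fundamental lemma *)

Section mollify_L1.
Context {R : realType} {n : nat}.
Local Notation X := 'rV[R]_n.
Local Notation leb := (@lebm R n).
Implicit Types (c x y h : X) (r : R) (f g rho phi : X -> R) (i j : 'I_n).

Lemma measurable_add2 : measurable_fun setT (fun u : X * X => u.1 + u.2).
Proof.
apply: measurable_fun_coorP => i; under eq_fun do rewrite mxE.
apply: measurable_funD; apply: (measurableT_comp (@measurable_coor _ _ n i)).
  exact: measurable_fst.
exact: measurable_snd.
Qed.

(** After a change of variables, [moll rho f x - f x] is the average of f(x + z) - f(x) for the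
    probability density [rho]. By Tonelli its L^1 norm is at most the average of the L^1 errors of
    the shifts. *)
Lemma moll_L1_le rho f r e : Ccinf rho -> (forall x, 0 <= rho x) -> Int leb rho = 1 ->
  (forall x, ~ Q 0 r x -> rho x = 0) -> L1 leb f ->
  (forall h, Q 0 r h -> Int leb (fun x => `|f (x + h) - f x|) <= e) ->
  L1 leb (moll rho f) /\ Int leb (fun x => `|moll rho f x - f x|) <= e.
Proof.
move=> Trho rho0 rho1 rhoQ Lf He.
have Lr := Ccinf_L1 Trho; have mf := L1_meas Lf; have mr := Ccinf_meas Trho.
have L2 x : L1 leb (fun z => rho z * (f (z + x) - f x)).
  rewrite (_ : (fun _ => _) = fun z => rho z * f (z + x) - f x * rho z); last first.
    by apply/funext => z; ring.
  by apply: L1B; [apply: Ccinf_L1M => //; exact: L1_shift|exact: L1Z].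
have E x : moll rho f x - f x = Int leb (fun z => rho z * (f (z + x) - f x)).
  rewrite /moll -(Int_shift x (moll_L1 x Trho Lf)).
  rewrite (_ : (fun _ => _) = fun z => rho z * f (z + x)); last first.
    by apply/funext => z; rewrite addrK.
  rewrite -[f x in LHS]mulr1 -{1}rho1 -IntZ// -IntB//; last 2 first.
  - by apply: Ccinf_L1M => //; exact: L1_shift.
  - exact: L1Z.
  by congr Int; apply/funext => z; ring.
pose K (u : X * X) : \bar R := (rho u.2 * `|f (u.1 + u.2) - f u.1|)%:E.
have mK : measurable_fun setT K.
  apply/measurable_EFinP; apply: measurable_funM.
    exact: (measurableT_comp mr measurable_snd).
  apply: measurableT_comp => //; apply: measurable_funB.
    exact: (measurableT_comp mf measurable_add2).
  exact: (measurableT_comp mf measurable_fst).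
have K0 u : (0 <= K u)%E by rewrite lee_fin mulr_ge0.
have mm : measurable_fun setT (moll rho f).
  by apply: continuous_measurable_rV; exact: moll_continuous.
have mD : measurable_fun setT (fun x => moll rho f x - f x) by exact: measurable_funB.
(* The sign of [e] comes from [He] at some point of the cube; the cube is nonempty, since otherwise
   [rho] would vanish. *)
have e0 : (0 <= e%:E)%E.
  have [H|H] := pselect (exists h, Q 0 r h); last first.
    exfalso; move: rho1; rewrite (_ : rho = fun=> 0) ?Int0; last first.
      by apply/funext => x; apply: rhoQ => Hx; apply: H; exists x.
    by move/eqP; rewrite eq_sym oner_eq0.
  have [h Hh] := H; rewrite lee_fin; apply: le_trans (He _ Hh).
  exact: Int_ge0.
have H : (\int[leb]_x (`|moll rho f x - f x|)%:E <= e%:E)%E.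
  apply: (@le_trans _ _ (\int[leb]_x \int[leb]_z K (x, z))%E).
    apply: ge0_le_integral => //.
    - by apply/measurable_EFinP; exact: measurableT_comp.
    - exact: (measurable_fun_fubini_tonelli_F K).
    - move=> x _; rewrite E.
      apply: (@le_trans _ _ (Int leb (fun z => `|rho z * (f (z + x) - f x)|))%:E).
        by rewrite lee_fin; exact: Int_norm.
      rewrite -L1_EFin; last exact: L1_abs.
      rewrite le_eqVlt; apply/orP; left; apply/eqP; apply: eq_integral => z _.
      by rewrite /K /= normrM (ger0_norm (rho0 z)) [z + x]addrC.
  rewrite (fubini_tonelli (m1 := leb) (m2 := leb) K mK K0).
  apply: (@le_trans _ _ (\int[leb]_z (e * rho z)%:E)%E); last first.
    by rewrite L1_EFin ?IntZ ?rho1 ?mulr1//; exact: L1Z.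
  apply: ge0_le_integral => //.
  - by move=> z _; apply: integral_ge0.
  - exact: (measurable_fun_fubini_tonelli_G K).
  - by apply/measurable_EFinP; exact: measurable_funM.
  - move=> z _; rewrite /K /=.
    have Lz : L1 leb (fun x => rho z * `|f (x + z) - f x|).
      by apply/L1Z/L1_abs/L1B => //; exact: L1_shift.
    rewrite L1_EFin// IntZ; last by apply/L1_abs/L1B => //; exact: L1_shift.
    rewrite lee_fin mulrC.
    have [Qz|nQz] := pselect (Q 0 r z); last by rewrite rhoQ// !mulr0.
    by rewrite ler_wpM2r// He.
have LD : L1 leb (fun x => `|moll rho f x - f x|).
  apply: L1_fin => //; first exact: measurableT_comp.
  exact: le_lt_trans H (ltry _).
split; last by rewrite L1_EFin in H.
apply: (@L1_le _ _ _ _ (fun x => `|moll rho f x - f x| + `|f x|)).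
- exact: mm.
- by apply: L1D => //; exact: L1_abs.
- by move=> x; rewrite -{1}(subrK (f x) (moll rho f x)) ler_normD.
Qed.

Lemma leb_Q_gt0 c r : 0 < r -> (0 < leb (Q c r))%E.
Proof.
move=> r0; rewrite Q_box leb_box; last by move=> i; exact: measurable_itv.
apply: (@big_ind _ (fun z => 0 < z)%E) => //.
- by move=> x y; exact: mule_gt0.
- move=> i _; rewrite /Q_itv lebesgue_measure_itv/= lte_fin.
  by rewrite ifT; [rewrite -EFinD lte_fin|]; lra.
Qed.

Lemma Ccinf_bump c r : 0 < r -> Ccinf (bump c r : X -> R).
Proof.
move=> r0; split; first by move=> k; exact: C_k_bump.
exists (r + `|c|) => x nQ; apply: bump_eq0 => // Qx; apply: nQ => i.
rewrite mxE subr0 -(subrK (c ord0 i) (x ord0 i)) (le_trans (ler_normD _ _))// lerD//.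
  by apply: ltW; exact: Qx.
exact: coord_norm.
Qed.

Lemma Int_bump_gt0 c r : 0 < r -> 0 < Int leb (bump c r).
Proof.
move=> r0; have [d d0 Hd] := @bump_half R n r r0.
have r2 : 0 < r / 2 by rewrite divr_gt0.
have LI : L1 leb (\1_(Q c (r / 2)) : X -> R).
  by apply: L1_indic; [exact: measurable_Q|exact: leb_Q].
apply: (@lt_le_trans _ _ (Int leb (fun x => d * \1_(Q c (r / 2)) x))).
  rewrite IntZ// mulr_gt0// /Int /Rintegral integral_indic//; last exact: measurable_Q.
  by rewrite setIT fine_gt0// leb_Q leb_Q_gt0.
apply: Int_le; [exact: L1Z|exact/Ccinf_L1/Ccinf_bump|move=> x].
rewrite indicE.
by case: (boolP (x \in _)) => //=; rewrite ?mulr1 ?mulr0 ?bump_ge0// inE => /Hd.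
Qed.

Definition mollifier r x : R := (Int leb (bump 0 r))^-1 * bump 0 r x.

Lemma mollifierP r : 0 < r -> [/\ Ccinf (mollifier r), forall x, 0 <= mollifier r x,
  Int leb (mollifier r) = 1 & forall x, ~ Q 0 r x -> mollifier r x = 0].
Proof.
move=> r0; have I0 := Int_bump_gt0 0 r0; have Tb := Ccinf_bump 0 r0; split.
- by apply: Ccinf_mull => // k; exact: C_k_cst.
- by move=> x; rewrite mulr_ge0 ?bump_ge0// invr_ge0 ltW.
- by rewrite /mollifier IntZ ?mulVf ?gt_eqF//; exact: Ccinf_L1.
- by move=> x nQ; rewrite /mollifier bump_eq0// mulr0.
Qed.

Lemma moll_cvg f e : L1 leb f -> 0 < e -> exists2 d, 0 < d & forall r, 0 < r -> r <= d ->
  L1 leb (moll (mollifier r) f) /\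
  Int leb (fun x => `|moll (mollifier r) f x - f x|) <= e.
Proof.
move=> Lf e0; have [d d0 Hd] := L1_shift_cvg Lf e0; exists d => // r r0 rd.
have [T1 T2 T3 T4] := mollifierP r0.
apply: (moll_L1_le T1 T2 T3 T4) => // h Qh; apply: Hd.
by apply: lt_le_trans rd; apply/Q_norm.
Qed.

Lemma L1_bumps_ae0 f c s s' : L1 leb f -> s < s' ->
  (forall (z : X) r, 0 < r -> (forall i, `|z ord0 i - c ord0 i| + r <= s') ->
     Int leb (fun x => bump z r x * f x) = 0) ->
  {ae leb, forall x, Q c s x -> f x = 0}.
Proof.
move=> Lf ss' Hphi.
have mI : measurable_fun setT (\1_(Q c s) : X -> R).
  by apply: measurable_indic; exact: measurable_Q.
have LI : L1 leb (fun x => \1_(Q c s) x * f x).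
  apply: (@L1_bound_mul _ _ _ _ 1) => // x.
  by rewrite indicE; case: (_ \in _); rewrite ?normr1 ?normr0.
suff H0 : Int leb (fun x => `|\1_(Q c s) x * f x|) <= 0.
  apply: filterS (Int_norm_eq0 LI H0) => x + Qx.
  by rewrite indicE mem_set// mul1r.
apply/ler_addgt0Pr => e e0; rewrite add0r.
have [d d0 Hd] := moll_cvg Lf e0.
pose r := Num.min d (s' - s).
have r0 : 0 < r by rewrite lt_min d0 subr_gt0.
have rd : r <= d by rewrite ge_min lexx.
have rs : r <= s' - s by rewrite ge_min lexx orbT.
have [Lm Hm] := Hd r r0 rd; apply: le_trans Hm.
apply: Int_le; [exact: L1_abs|by apply/L1_abs/L1B|move=> x].
have [Qx|nQx] := boolP (x \in Q c s); last first.
  by rewrite indicE (negbTE nQx) mul0r normr0.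
rewrite indicE Qx mul1r (_ : moll _ f x = 0) ?sub0r ?normrN//.
rewrite inE in Qx; rewrite /moll.
rewrite (_ : (fun y => _) = fun y => (Int leb (bump 0 r))^-1 * (bump x r y * f y)); last first.
  by apply/funext => y; rewrite /mollifier bump_shift sub0r opprK mulrA.
rewrite IntZ; last by apply: Ccinf_L1M => //; exact: Ccinf_bump.
by rewrite Hphi ?mulr0// => i; have := Qx i; lra.
Qed.

Lemma L1_tests_ae0 f c s s' : L1 leb f -> s < s' ->
  (forall phi, (forall k, C_k k phi) -> (forall x, ~ Qc c s' x -> phi x = 0) ->
     Int leb (fun x => phi x * f x) = 0) ->
  {ae leb, forall x, Q c s x -> f x = 0}.
Proof.
move=> Lf ss' H; apply: (L1_bumps_ae0 Lf ss') => z r r0 QQ; apply: H.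
  by move=> k; exact: C_k_bump.
move=> x nQ; apply: bump_eq0 => // Qx; apply: nQ => i.
rewrite -(subrKA (z ord0 i)) (le_trans (ler_normD _ _))//.
by have := QQ i; have := Qx i; lra.
Qed.

End mollify_L1.

(** * Weak derivatives *)

Section weak.
Context {R : realType} {n : nat}.
Local Notation X := 'rV[R]_n.
Local Notation leb := (@lebm R n).
Implicit Types (c x y h : X) (r s : R) (u v w f g phi : X -> R) (i j : 'I_n) (E Om : set X).

Lemma Lp_space1P E u : Lp_space 1 E u <-> L1 leb (u \_ E).
Proof. exact: Lfun1_integrable. Qed.

Lemma Lp_spaceP (p : R) E u : 1 <= p ->
  Lp_space p%:E E u <-> measurable_fun setT (u \_ E) /\ L1 leb (fun x => `|(u \_ E) x| `^ p).
Proof.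
move=> p1; split => [Lu|[mu Lu]].
  split; last exact: Lfun_integrable Lu.
  by move: Lu; rewrite /Lp_space inE => /andP[/[!inE]].
rewrite /Lp_space inE; apply/andP; split; rewrite inE//=.
rewrite /finite_norm unlock; apply: poweR_lty.
have /integrableP[_] := Lu; apply: le_lt_trans.
rewrite le_eqVlt; apply/orP; left; apply/eqP; apply: eq_integral => x _ /=.
by rewrite [in RHS]ger0_norm// powR_ge0.
Qed.

Lemma Rint_supp Om E (F : X -> R) : E `<=` Om -> (forall x, ~ E x -> F x = 0) ->
  \int[lebesgue_rV n]_(x in Om) F x = Int leb F.
Proof.
move=> EOm F0; rewrite Rintegral_mkcond /Int; congr (Rintegral _ _ _).
apply/funext => x; rewrite patchE; case: ifPn => //; rewrite notin_setE => nOm.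
by rewrite F0// => Ex; apply: nOm; exact: EOm.
Qed.

Lemma patch_supp E u phi : (forall x, ~ E x -> phi x = 0) ->
  (fun x => u x * phi x) = (fun x => phi x * (u \_ E) x).
Proof.
move=> phi0; apply/funext => x; rewrite patchE.
case: ifPn => [_|]; first exact: mulrC.
by rewrite notin_setE => /phi0 ->; rewrite mulr0 mul0r.
Qed.

Lemma test_function_Qc Om c s phi : (forall k, C_k k phi) ->
  (forall x, ~ Qc c s x -> phi x = 0) -> Qc c s `<=` Om -> test_function Om phi.
Proof.
move=> Cphi phi0 QOm.
have H : closure [set x | phi x != 0] `<=` Qc c s.
  rewrite ((closure_id (Qc c s)).1 (@closed_Qc _ _ c s)).
  apply: closure_subset => x /= /eqP; apply: contra_notP; exact: phi0.
split => //; last exact: subset_trans H QOm.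
by apply: (subclosed_compact _ (@compact_Qc _ _ c s) H); exact: closed_closure.
Qed.

Lemma test_function0 Om phi : test_function Om phi -> forall x, ~ Om x -> phi x = 0.
Proof.
move=> [_ _ sOm] x nOm; apply/eqP; apply: contrapT => /negP H; apply: nOm; apply: sOm.
exact: subset_closure.
Qed.

Lemma test_function_partial0 Om phi i : test_function Om phi ->
  forall x, ~ Om x -> partial i phi x = 0.
Proof.
move=> [_ _ sOm] x nOm; apply: (@partial_supp _ _ _ (closure [set x | phi x != 0])).
- exact: closed_closure.
- move=> y ny; apply/eqP; apply: contrapT => /negP H; apply: ny; exact: subset_closure.
- by move=> H; apply: nOm; exact: sOm.
Qed.

Lemma test_Ccinf Om phi : test_function Om phi -> Ccinf phi.
Proof.
move=> [Cphi cphi _]; split => //.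
have [M [_ HM]] := compact_bounded cphi.
exists (M + 1) => x nQ; apply/eqP; apply: contrapT => /negP H; apply: nQ => i.
rewrite mxE subr0 (le_trans (coord_norm _ _))// HM ?ltrDl//.
exact: subset_closure.
Qed.

Lemma test_functionS E Om phi : E `<=` Om -> test_function E phi -> test_function Om phi.
Proof. by move=> EOm [C1 C2 C3]; split => //; exact: subset_trans C3 EOm. Qed.

Lemma weak_restrict E Om i u w : E `<=` Om ->
  is_weak_partial Om i u w -> is_weak_partial E i u w.
Proof.
move=> EOm [Lu Lw H].
have cE E' : compactly_inside E' E -> compactly_inside E' Om.
  by move=> [? ? ?]; split => //; exact: subset_trans EOm.
split; [by move=> E' /cE; exact: Lu|by move=> E' /cE; exact: Lw|move=> phi tphi].
have := H phi (test_functionS EOm tphi).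
rewrite !(@Rint_supp _ E) ?(@Rint_supp E E)//.
- by move=> x nE; rewrite (test_function0 tphi) ?mulr0.
- by move=> x nE; rewrite (test_function_partial0 _ tphi) ?mulr0.
- by move=> x nE; rewrite (test_function0 tphi) ?mulr0.
- by move=> x nE; rewrite (test_function_partial0 _ tphi) ?mulr0.
Qed.

Lemma weak_unique Om i u w w' c s s' : is_weak_partial Om i u w ->
  is_weak_partial Om i u w' -> s < s' -> Qc c s' `<=` Om ->
  {ae leb, forall x, Q c s x -> w x = w' x}.
Proof.
move=> [_ Lw Hw] [_ Lw' Hw'] ss' QOm.
have cQ := compactly_inside_Q QOm.
have Q1 := (Lp_space1P _ _).1 (Lw _ cQ); have Q2 := (Lp_space1P _ _).1 (Lw' _ cQ).
have L := L1B Q1 Q2.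
(* The tests live in the cube of intermediate radius, strictly inside the one on which both
   derivatives are integrable. *)
have s1 : s < (s + s') / 2 by lra.
have s2 : (s + s') / 2 < s' by lra.
have : {ae leb, forall x, Q c s x -> (w \_ (Q c s')) x - (w' \_ (Q c s')) x = 0}.
  apply: (@L1_tests_ae0 _ _ _ c s ((s + s') / 2)) => // phi Cphi phi0.
  have phiQ x : ~ Q c s' x -> phi x = 0.
    by move=> nQ; apply: phi0 => Qx; apply: nQ; exact: Qc_Q Qx.
  have tphi : test_function Om phi.
    apply: (test_function_Qc Cphi phi0).
    by apply: subset_trans QOm; apply: subset_trans (@Q_Qc _ _ c s'); exact: Qc_Q.
  have Tphi := test_Ccinf tphi.
  rewrite (_ : (fun _ => _) = fun x => phi x * (w \_ (Q c s')) x - phi x * (w' \_ (Q c s')) x).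
    rewrite IntB; [|exact: Ccinf_L1M|exact: Ccinf_L1M].
    have QOm' := subset_trans (@Q_Qc _ _ c s') QOm.
    have z0 (v : X -> R) x : ~ Q c s' x -> v x * phi x = 0 by move=> /phiQ ->; rewrite mulr0.
    rewrite -!(patch_supp _ phiQ) -(Rint_supp QOm' (z0 w)) -(Rint_supp QOm' (z0 w')).
    have := Hw _ tphi; rewrite Hw'// => /oppr_inj ->.
    by rewrite subrr.
  by apply/funext => x; rewrite mulrBr.
apply: filterS => x + Qx => /(_ Qx).
have Qx' : Q c s' x by apply: Q_mono Qx; exact: ltW.
by rewrite !patchE mem_set// => /eqP; rewrite subr_eq0 => /eqP.
Qed.

(** A cube is a countable union of smaller concentric ones. This reaches the boundary of [Q c s],
    where local integrability gives no direct information. *)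
Lemma ae_Q c s (P : X -> Prop) :
  (forall s', s' < s -> {ae leb, forall x, Q c s' x -> P x}) ->
  {ae leb, forall x, Q c s x -> P x}.
Proof.
move=> H; have : {ae leb, forall x, forall k : nat, Q c (s - k.+1%:R^-1) x -> P x}.
  apply/ae_foralln => k; apply: H; by rewrite ltrBlDr ltrDl invr_gt0.
apply: filterS => x Hx Qx.
have : \forall k \near \oo, forall i, `|x ord0 i - c ord0 i| < s - k.+1%:R^-1.
  apply: filter_forall => i; have Qi := Qx i.
  have d0 : 0 < s - `|x ord0 i - c ord0 i| by rewrite subr_gt0.
  near=> k; rewrite ltrBrDr -ltrBrDl; near: k.
  exact: (near_infty_natSinv_lt (PosNum d0)).
by move=> [k _ /(_ k (leqnn k))]; exact: Hx.
Unshelve. all: by end_near. Qed.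

Lemma weak_unique_Q i u w w' c s : is_weak_partial (Q c s) i u w ->
  is_weak_partial (Q c s) i u w' -> {ae leb, forall x, Q c s x -> w x = w' x}.
Proof.
move=> Hw Hw'; apply: ae_Q => s' ss'.
have s1 : s' < (s + s') / 2 by lra.
have s2 : (s + s') / 2 < s by lra.
apply: (weak_unique Hw Hw' s1); exact: Qc_Q.
Qed.

Lemma wpartialP Om i u : weakly_differentiable Om u ->
  is_weak_partial Om i u (wpartial Om i u).
Proof. by move=> /(_ i); exact: xgetPex. Qed.

End weak.

(** * Weak derivatives on the whole space and the space W^{1,p}_0 *)

Section weak_pair.
Context {R : realType} {n : nat}.
Local Notation X := 'rV[R]_n.
Local Notation leb := (@lebm R n).
Implicit Types (c x y h : X) (r s : R) (u v w f g phi eta U V W : X -> R) (i j : 'I_n) (E Om : set X).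

(* [W] is the weak [i]-th derivative of [U] on the whole space *)
Definition weak_pair i U W := [/\ L1 leb U, L1 leb W & forall phi, Ccinf phi ->
  Int leb (fun x => partial i phi x * U x) = - Int leb (fun x => phi x * W x)].

Lemma weak_pair_shift i U W h : weak_pair i U W -> weak_pair i (fun x => U (x + h)) (fun x => W (x + h)).
Proof.
move=> [LU LW H]; split; [exact: L1_shift|exact: L1_shift|move=> phi Tphi].
have Tp := Ccinf_partial i Tphi.
rewrite -(Int_shift (- h)); last by apply: Ccinf_L1M => //; exact: L1_shift.
rewrite -[in RHS](Int_shift (- h)); last by apply: Ccinf_L1M => //; exact: L1_shift.
have := H _ (Ccinf_shift (- h) Tphi); rewrite partial_shift => E.
transitivity (Int leb (fun x => partial i phi (x - h) * U x)).
  by congr Int; apply/funext => x; rewrite subrK.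
by rewrite E; congr (- Int leb _); apply/funext => x; rewrite subrK.
Qed.

Lemma weak_pairB i U W V Z : weak_pair i U W -> weak_pair i V Z ->
  weak_pair i (fun x => U x - V x) (fun x => W x - Z x).
Proof.
move=> [LU LW H] [LV LZ K]; split; [exact: L1B|exact: L1B|move=> phi Tphi].
have Tp := Ccinf_partial i Tphi.
rewrite (_ : (fun _ => _) = fun x => partial i phi x * U x - partial i phi x * V x); last first.
  by apply/funext => x; rewrite mulrBr.
rewrite IntB; [|exact: Ccinf_L1M|exact: Ccinf_L1M].
rewrite (_ : (fun x => phi x * _) = fun x => phi x * W x - phi x * Z x); last first.
  by apply/funext => x; rewrite mulrBr.
rewrite IntB; [|exact: Ccinf_L1M|exact: Ccinf_L1M].
by rewrite H// K// opprB addrC opprK.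
Qed.

(** The product rule, obtained by testing with [eta * phi]. The cutoff turns a derivative known on
    [Om] into a global pair, to which shifts and mollification apply. *)
Lemma weak_pair_cutoff Om i u w c s s' eta : is_weak_partial Om i u w -> Qc c s `<=` Om ->
  (forall k, C_k k eta) -> (forall x, ~ Qc c s' x -> eta x = 0) -> s' < s ->
  weak_pair i (fun x => eta x * u x) (fun x => eta x * w x + partial i eta x * u x).
Proof.
move=> [Lu Lw Hw] QOm Ceta eta0 ss.
have cQ := compactly_inside_Q QOm.
have L1u := (Lp_space1P _ _).1 (Lu _ cQ); have L1w := (Lp_space1P _ _).1 (Lw _ cQ).
have QQ : Qc c s' `<=` Q c s by exact: Qc_Q.
have etaQ x : ~ Q c s x -> eta x = 0 by move=> nQ; apply: eta0 => Qx; apply: nQ; exact: QQ.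
have peta0 := partial_supp i (@closed_Qc _ _ c s') eta0.
have petaQ x : ~ Q c s x -> partial i eta x = 0.
  by move=> nQ; apply: peta0 => Qx; apply: nQ; exact: QQ.
have QOm' := subset_trans (@Q_Qc _ _ c s) QOm.
have teta : test_function Om eta.
  by apply: (test_function_Qc Ceta eta0); exact: subset_trans QQ QOm'.
have Teta := test_Ccinf teta; have Tp := Ccinf_partial i Teta.
have C (E v : X -> R) : (forall x, ~ Q c s x -> E x = 0) ->
    (fun x => E x * v x) = (fun x => E x * (v \_ (Q c s)) x).
  by move=> E0; rewrite -(patch_supp _ E0); apply/funext => x; rewrite mulrC.
have Leu : L1 leb (fun x => eta x * u x) by rewrite (C _ _ etaQ); exact: Ccinf_L1M.
have Lew : L1 leb (fun x => eta x * w x) by rewrite (C _ _ etaQ); exact: Ccinf_L1M.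
have Lpu : L1 leb (fun x => partial i eta x * u x) by rewrite (C _ _ petaQ); exact: Ccinf_L1M.
split => //; first exact: L1D.
move=> phi Tphi; have Tpphi := Ccinf_partial i Tphi.
pose ep x := eta x * phi x.
have [Cphi _] := Tphi.
have Tep : test_function Om ep.
  apply: (@test_function_Qc _ _ _ c s').
  - by move=> k; exact: C_kM.
  - by move=> x /eta0; rewrite /ep => ->; rewrite mul0r.
  - exact: subset_trans QQ QOm'.
have dpe x : derivable eta x (unit_vector i) by have [_ /(_ i)[]] := Ceta 1%N.
have dpp x : derivable phi x (unit_vector i) by have [_ /(_ i)[]] := Cphi 1%N.
have pep : partial i ep = fun x => eta x * partial i phi x + phi x * partial i eta x.
  exact: partialM.
have := Hw _ Tep.
rewrite (Rint_supp QOm'); last first.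
  by move=> x nQ; rewrite pep etaQ// petaQ// mul0r mulr0 addr0 mulr0.
rewrite (Rint_supp QOm'); last by move=> x nQ; rewrite /ep etaQ// mul0r mulr0.
have -> : (fun x => u x * partial i ep x) =
    fun x => partial i phi x * (eta x * u x) + phi x * (partial i eta x * u x).
  by apply/funext => x; rewrite pep; ring.
have -> : (fun x => w x * ep x) = fun x => phi x * (eta x * w x).
  by apply/funext => x; rewrite /ep; ring.
rewrite IntD; [|exact: Ccinf_L1M|exact: Ccinf_L1M] => /eqP.
rewrite -subr_eq0 opprK -addrA => /eqP H.
have -> : (fun x => phi x * (eta x * w x + partial i eta x * u x)) =
    fun x => phi x * (eta x * w x) + phi x * (partial i eta x * u x).
  by apply/funext => x; rewrite mulrDr.
rewrite IntD; [|exact: Ccinf_L1M|exact: Ccinf_L1M].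
by apply/eqP; rewrite -subr_eq0 opprK [X in _ + X]addrC H.
Qed.

(** The kernel of [moll] at [x] is itself an admissible test function for the pair. *)
Lemma moll_weak_pair i U W rho : Ccinf rho -> weak_pair i U W -> partial i (moll rho U) = moll rho W.
Proof.
move=> Trho [LU LW H]; rewrite partial_moll//; apply/funext => x.
have := H _ (Ccinf_shift (- x) Trho); rewrite partial_shift /moll => ->.
by rewrite mulN1r opprK.
Qed.

Lemma patch_indic E u : (fun x => (u \_ E) x) = fun x => \1_E x * u x.
Proof.
by apply/funext => x; rewrite patchE indicE; case: (_ \in _); rewrite ?mul1r ?mul0r.
Qed.

Lemma L1_patch E u : measurable E -> L1 leb u -> L1 leb (u \_ E).
Proof.
move=> mE Lu; have := patch_indic E u; rewrite -[X in X = _]/(u \_ E) => ->.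
apply: (@L1_bound_mul _ _ _ _ 1) => //.
by move=> x; rewrite indicE; case: (_ \in _); rewrite ?normr1 ?normr0.
Qed.

Lemma weak_pair_weak E i U W : weak_pair i U W -> is_weak_partial E i U W.
Proof.
move=> [LU LW H]; split.
- by move=> E' [oE' _ _]; apply/Lp_space1P; apply: L1_patch => //; exact: open_measurable_rV.
- by move=> E' [oE' _ _]; apply/Lp_space1P; apply: L1_patch => //; exact: open_measurable_rV.
- move=> phi tphi.
  rewrite (@Rint_supp _ _ E E)//; last first.
    by move=> x nE; rewrite (test_function_partial0 _ tphi)// mulr0.
  rewrite (@Rint_supp _ _ E E)//; last first.
    by move=> x nE; rewrite (test_function0 tphi)// mulr0.
  have := H _ (test_Ccinf tphi) => K.
  transitivity (Int leb (fun x => partial i phi x * U x)).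
    by congr Int; apply/funext => x; rewrite mulrC.
  by rewrite K; congr (- Int leb _); apply/funext => x; rewrite mulrC.
Qed.

(** [Lp_loc] speaks only of sets compactly inside the cube; measurability on the cube itself is a
    pointwise limit. *)
Lemma measurable_patch_Q c s w :
  (forall s', s' < s -> measurable_fun setT (w \_ (Q c s'))) ->
  measurable_fun setT (w \_ (Q c s)).
Proof.
move=> H; apply: (@measurable_fun_cvg _ _ _ _ (fun k : nat => w \_ (Q c (s - k.+1%:R^-1)))) => //.
  by move=> k; apply: H; rewrite ltrBlDr ltrDl invr_gt0.
move=> x _; have [Qx|nQx] := pselect (Q c s x); last first.
  rewrite patchE memNset//; apply: cvg_near_cst; apply: nearW => k.
  rewrite patchE memNset// => Qx; apply: nQx; apply: Q_mono Qx.
  by rewrite lerBlDr lerDl invr_ge0.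
rewrite patchE mem_set//; apply: cvg_near_cst.
have : \forall k \near \oo, forall i, `|x ord0 i - c ord0 i| < s - k.+1%:R^-1.
  apply: filter_forall => i; have Qi := Qx i.
  have d0 : 0 < s - `|x ord0 i - c ord0 i| by rewrite subr_gt0.
  near=> k; rewrite ltrBrDr -ltrBrDl; near: k.
  exact: (near_infty_natSinv_lt (PosNum d0)).
by apply: filterS => k Hk; rewrite patchE mem_set.
Unshelve. all: by end_near. Qed.

Lemma Lp_loc_measQ m c s w : Lp_loc m (Q c s) w -> measurable_fun setT (w \_ (Q c s)).
Proof.
move=> Lw; apply: measurable_patch_Q => s' ss'.
have := Lw (Q c s') (compactly_inside_Q (@Qc_Q _ _ c s' s ss')).
by rewrite /Lp_space inE => /andP[/[!inE]].
Qed.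

Lemma norm_on1_le E (F G : X -> R) : measurable_fun setT (F \_ E) -> L1 leb G ->
  {ae leb, forall x, E x -> F x = G x} ->
  (norm_on 1 E F <= (Int leb (fun x => `|G x|))%:E)%E.
Proof.
move=> mF LG FG; rewrite /norm_on Lnorm1 -L1_EFin; last exact: L1_abs.
apply: ae_ge0_le_integral => //.
- by apply/measurable_EFinP; exact: measurableT_comp.
- by apply/measurable_EFinP; exact: L1_meas (L1_abs LG).
apply: filterS FG => x FGx _; rewrite /= lee_fin patchE.
case: ifPn => [|_]; last by rewrite normr0.
by rewrite inE => /FGx ->.
Qed.

Lemma weak_pair_wpartial c s U i W : (forall i, exists W, weak_pair i U W) -> weak_pair i U W ->
  {ae leb, forall x, Q c s x -> wpartial (Q c s) i U x = W x}.
Proof.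
move=> HU HW; have dU : weakly_differentiable (Q c s) U.
  by move=> j; have [Z HZ] := HU j; exists Z; exact: weak_pair_weak.
exact: weak_unique_Q (wpartialP _ dU) (weak_pair_weak _ HW).
Qed.

(** Mollifying at a scale below [S - s] keeps the support inside the larger cube and commutes with
    weak derivatives, so it supplies the test functions that the closure asks for. *)
Lemma W1p_0_intro (p : 'I_n -> R) c s S U (W : 'I_n -> X -> R) : s < S ->
  (forall i, 1 <= p i) -> (forall i, weak_pair i U (W i)) ->
  (forall x, ~ Qc c s x -> U x = 0) ->
  (forall i, L1 leb (fun x => `|W i x| `^ p i)) ->
  L1 leb U ->
  W1p_0 p (Q c S) U.
Proof.
move=> sS p1 HW U0 LWp LU; set B := Q c S.
have mB : measurable B by exact: measurable_Q.
have HU i : exists W, weak_pair i U W by exists (W i).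
have dU : weakly_differentiable B U.
  by move=> j; exists (W j); exact: weak_pair_weak.
have aW i := weak_pair_wpartial c S HU (HW i).
have mW i : measurable_fun setT (wpartial B i U \_ B).
  by have [_ H _] := wpartialP i dU; exact: Lp_loc_measQ H.
have aeWB i : {ae leb, forall x, (W i \_ B) x = (wpartial B i U \_ B) x}.
  apply: filterS (aW i) => x Hx; rewrite !patchE; case: ifPn => //.
  by rewrite inE => /Hx ->.
have LW i : L1 leb (W i) by case: (HW i).
split; last first.
  move=> i; apply/Lp_spaceP => //; split => //.
  apply: (@L1_ae_eq _ _ _ _ ((fun x => `|W i x| `^ p i) \_ B)).
  - exact: L1_patch.
  - apply: (measurableT_comp (measurable_powR (p i))).
    exact: measurableT_comp.
  - apply: filterS (aeWB i) => x; rewrite !patchE; case: ifPn => [_ ->//|_ _].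
    by rewrite normr0 powR0// gt_eqF// (lt_le_trans ltr01).
split.
  split => //; first by apply/Lp_space1P; exact: L1_patch.
  move=> i; apply/Lp_space1P; apply: L1_ae_eq (aeWB i) => //; exact: L1_patch.
move=> e e0.
(* There are n + 1 norms, each at most [e'], and their sum must be strictly below [e]. *)
pose e' := e / (n.+2)%:R.
have e'0 : 0 < e' by rewrite divr_gt0.
have [d d0 Hd] := moll_cvg LU e'0.
have /choice[D HD] i : exists d, 0 < d /\ forall r, 0 < r -> r <= d ->
    L1 leb (moll (mollifier r) (W i)) /\
    Int leb (fun x => `|moll (mollifier r) (W i) x - W i x|) <= e'.
  by have [d' d'0 Hd'] := moll_cvg (LW i) e'0; exists d'.
have [r [r0 rd rD rS]] : exists r, [/\ 0 < r, r <= d, forall i, r <= D i & r < S - s].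
  near (0 : R)^'+ => r; exists r; split => //.
  - near: r; exact: nbhs_right_le.
  - near: r; apply: filter_forall => i; apply: nbhs_right_le; exact: (HD i).1.
  - near: r; apply: nbhs_right_lt; by rewrite subr_gt0.
have [LmU HmU] := Hd r r0 rd.
have [T1 T2 T3 T4] := @mollifierP R n r r0.
exists (moll (mollifier r) U).
  apply: (@test_function_Qc _ _ _ c (s + r)).
  - by move=> k; exact: C_k_moll.
  - apply: moll_supp U0 => x nQ; apply: T4 => Qx; apply: nQ; exact: Q_Qc.
  - by apply: Qc_Q; rewrite -ltrBrDl.
have distI (V Z : X -> R) : Int leb (fun x => `|V x - Z x|) = Int leb (fun x => `|Z x - V x|).
  by congr Int; apply/funext => x; rewrite distrC.
have N1 : (norm_on 1 B (U \- moll (mollifier r) U)%R <= e'%:E)%E.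
  apply: (@le_trans _ _ (Int leb (fun x => `|U x - moll (mollifier r) U x|))%:E).
    apply: (@norm_on1_le _ _ (fun x => U x - moll (mollifier r) U x)).
    - by apply: L1_meas; apply: L1_patch => //; exact: L1B.
    - exact: L1B.
    - exact: aeW.
  by rewrite lee_fin distI.
have N2 i : (norm_on 1 B (wpartial B i U \- partial i (moll (mollifier r) U))%R <= e'%:E)%E.
  have [LmW HmW] := (HD i).2 r r0 (rD i).
  rewrite (moll_weak_pair T1 (HW i)).
  apply: (@le_trans _ _ (Int leb (fun x => `|W i x - moll (mollifier r) (W i) x|))%:E).
    apply: norm_on1_le.
    - rewrite (_ : _ \_ _ = fun x => (wpartial B i U \_ B) x - (moll (mollifier r) (W i) \_ B) x).
        by apply: measurable_funB => //; apply: L1_meas (L1_patch mB LmW).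
      by apply/funext => x; rewrite !patchE; case: ifP => //; rewrite subr0.
    - exact: L1B.
    - by apply: filterS (aW i) => x Hx /Hx /= ->.
  by rewrite lee_fin distI.
apply: (@le_lt_trans _ _ (e'%:E + \sum_(i < n) e'%:E)%E).
  by apply: leeD => //; apply: lee_sum => i _; exact: N2.
rewrite sumEFin -EFinD lte_fin sumr_const card_ord -mulrS /e'.
by rewrite -[ltLHS]mulr_natr mulrAC ltr_pdivrMr ?ltr0n// ltr_pM2l// ltr_nat.
Unshelve. all: by end_near. Qed.

End weak_pair.

(** * Difference quotients *)

Section oprim.
Context {R : realType}.
Local Notation mu := (@lebesgue_measure R).
Implicit Types (f F : R -> R) (a b t : R).

(** The oriented primitive vanishing at 0, convertible with the one in [V_fun]. It serves both for V
    and for the primitive of the bump profile. *)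
Definition oprim f t := if 0 <= t then \int[mu]_(s in `[0, t]) f s
  else - \int[mu]_(s in `[t, 0]) f s.

Lemma continuous_itv_integrable f a b : continuous f ->
  mu.-integrable `[a, b] (EFin \o f).
Proof.
move=> cf; apply: continuous_compact_integrable; first exact: segment_compact.
exact: continuous_subspaceT.
Qed.

Lemma Rint_split f a b t : continuous f -> a <= b -> b <= t ->
  \int[mu]_(s in `[a, t]) f s = \int[mu]_(s in `[a, b]) f s + \int[mu]_(s in `[b, t]) f s.
Proof.
move=> cf ab bt.
have H := @Rintegral_itvB R f (BLeft a) (BRight t) b (continuous_itv_integrable a t cf).
have {}H := H _ _.
apply/eqP; rewrite addrC -subr_eq H ?bnd_simp//; apply/eqP.
apply: Rintegral_itv_obnd_cbnd; apply: integrableS (continuous_itv_integrable b t cf) => //.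
by apply: subset_itvr; rewrite bnd_simp.
Qed.

(** With [a] below both 0 and [t], both branches become an integral from [a] minus a constant near
    [t], and the fundamental theorem applies away from the endpoint. *)
Lemma oprim_derive f t : continuous f -> is_derive t 1 (oprim f) (f t).
Proof.
move=> cf; pose a := - `|t| - 1.
have a0 : a < 0 by rewrite /a -opprD oppr_lt0 ltr_wpDl.
have at_ : a < t.
  by rewrite /a ltrBlDr (le_lt_trans (_ : _ <= t))// ?ltrDl// lerNl -normrN ler_norm.
have H s : a < s -> oprim f s = \int[mu]_(x in `[a, s]) f x - \int[mu]_(x in `[a, 0]) f x.
  move=> as_; rewrite /oprim; case: leP => s0.
    by rewrite (Rint_split cf (ltW a0) s0) addrC addKr.
  by rewrite (Rint_split cf (ltW as_) (ltW s0)) opprD addrA subrr add0r.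
have t1 : t < t + 1 by rewrite ltrDl.
have [d1 d2] := continuous_FTC1_closed t1 (continuous_itv_integrable a (t + 1) cf) at_ (cf t).
have nE : \forall s \near t, ((fun s => \int[mu]_(x in `[a, s]) f x) -
    cst (\int[mu]_(x in `[a, 0]) f x)) s = oprim f s.
  by near=> s; rewrite H//; near: s; exact: lt_nbhsr.
rewrite derive1E in d2.
have dd : is_derive t 1 (fun s => \int[mu]_(x in `[a, s]) f x) (f t).
  by apply: DeriveDef => //.
have dc := is_derive_cst (\int[mu]_(x in `[a, 0]) f x) t 1.
have := near_eq_is_derive nE (is_deriveB dd dc).
by rewrite subr0.
Unshelve. all: by end_near. Qed.

Lemma derive_continuous F f : (forall t : R, is_derive t 1 F (f t)) -> continuous F.
Proof.
by move=> H t; apply/differentiable_continuous/derivable1_diffP; case: (H t).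
Qed.

Lemma oprim_diff f y h : continuous f ->
  oprim f y - oprim f (y - h) = h * \int[mu]_(t in `[0, 1]) f (y - t * h).
Proof.
move=> cf.
have dF (t : R) : is_derive t 1 (fun s => - oprim f ((- h) * s + y)) (h * f ((- h) * t + y)).
  have := is_deriveN (is_derive_affine (oprim_derive (- h * t + y) cf)).
  by rewrite mulrN opprK mulrC.
have cg : continuous (fun t => f (- h * t + y)).
  move=> t; apply: continuous_comp; last exact: cf.
  by apply: cvgD; [apply: cvgM; [exact: cvg_cst|exact: cvg_id]|exact: cvg_cst].
have chg : continuous (fun t => h * f (- h * t + y)).
  by move=> t; apply: cvgM; [exact: cvg_cst|exact: cg].
have cF := derive_continuous dF.
have := @continuous_FTC2 R (fun t => h * f (- h * t + y)) (fun s => - oprim f ((- h) * s + y)) 0 1 ltr01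
  (continuous_subspaceT chg) _ _.
rewrite /= mulr0 add0r mulr1 => H.
have {}H := H _ _.
transitivity (\int[mu]_(x in `[0, 1]) (h * f (- h * x + y))).
  rewrite /Rintegral H /=; first by rewrite opprK [- h + y]addrC addrC.
  - split => /=.
    + by move=> x _; case: (dF x).
    + by apply: cvg_at_right_filter; exact: cF.
    + by apply: cvg_at_left_filter; exact: cF.
  - by move=> x _ /=; rewrite derive1E; case: (dF x) => _ ->.
rewrite RintegralZl//; last exact: continuous_itv_integrable.
congr (h * _); congr Rintegral; apply/funext => t; congr f; ring.
Qed.

End oprim.

(** * Exchange of integrals for real-valued functions *)

Section fubini_L1.
Context d1 d2 (T1 : measurableType d1) (T2 : measurableType d2) (R : realType).
Variables (m1 : {sigma_finite_measure set T1 -> \bar R})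
  (m2 : {sigma_finite_measure set T2 -> \bar R}).

(** The integrable majorant [G] of the slice norms gives joint integrability by Tonelli. The slices
    in the other variable are then integrable only almost everywhere. *)
Lemma fubini_L1 (K : T1 * T2 -> R) (G : T2 -> R) : measurable_fun setT K ->
  (forall y, L1 m1 (fun x => K (x, y))) -> L1 m2 G ->
  (forall y, Int m1 (fun x => `|K (x, y)|) <= G y) ->
  [/\ {ae m1, forall x, L1 m2 (fun y => K (x, y))},
      L1 m1 (fun x => Int m2 (fun y => K (x, y))),
      L1 m2 (fun y => Int m1 (fun x => K (x, y))) &
      Int m1 (fun x => Int m2 (fun y => K (x, y))) =
      Int m2 (fun y => Int m1 (fun x => K (x, y)))].
Proof.
move=> mK LK LG KG.
have mK' : measurable_fun setT (EFin \o K) by exact/measurable_EFinP.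
have iK : (m1 \x m2)%E.-integrable setT (EFin \o K).
  apply/integrable21ltyP => //.
  apply: (@le_lt_trans _ _ (\int[m2]_y (G y)%:E)%E); last first.
    by rewrite L1_EFin// ltry.
  apply: ge0_le_integral => //.
  - by move=> y _; apply: integral_ge0.
  - apply: (@measurable_fun_fubini_tonelli_G _ _ _ _ _ m1 (fun u => `|(EFin \o K) u|)%E) => //.
    exact: measurableT_comp.
  - by apply/measurable_EFinP; exact: L1_meas LG.
  - move=> y _ /=; rewrite L1_EFin; last exact: L1_abs.
    by rewrite lee_fin.
have ae1 : {ae m1, forall x, L1 m2 (fun y => K (x, y))} := ae_integrable1 iK.
have iF := integrable_fubini_F iK.
have LF : L1 m1 (fun x => Int m2 (fun y => K (x, y))).
  apply: (le_integrable measurableT _ _ iF).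
    apply/measurable_EFinP.
    apply: (measurableT_comp (fine_measurable measurableT)).
    exact: measurable_int iF.
  have fz (z : \bar R) : (`|fine z|%:E <= `|z|)%E by case: z => [r| |] //=; rewrite normr0 leey.
  move=> x _; exact: fz.
have LG' : L1 m2 (fun y => Int m1 (fun x => K (x, y))).
  apply: L1_le LG _; last first.
    by move=> y; apply: le_trans (KG y); exact: Int_norm.
  apply: (measurableT_comp (fine_measurable measurableT)).
  exact: measurable_fubini_G iK.
split => //.
have E := Fubini iK.
rewrite /Int /Rintegral; congr fine.
transitivity (\int[m1]_x fubini_F m2 (EFin \o K) x)%E.
  apply: ae_eq_integral => //; first exact: measurable_int LF.
    exact: measurable_int iF.
  apply: filterS ae1 => x Lx _; rewrite /fubini_F fineK//.
  exact: (integrable_fin_num _ Lx).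
transitivity (\int[m2]_y \int[m1]_x (EFin \o K) (x, y))%E; first exact: E.
apply: eq_integral => y _; rewrite fineK//.
exact: (integrable_fin_num _ (LK y)).
Qed.

End fubini_L1.

(** * Averages along segments *)

Section diffquot.
Context {R : realType} {n : nat}.
Local Notation X := 'rV[R]_n.
Local Notation leb := (@lebm R n).
Local Notation mu := (@lebesgue_measure R).
Implicit Types (c x y z : X) (r s h t : R) (u v w f phi : X -> R) (i j : 'I_n) (Om : set X).

(** A weight on the whole line in place of an integral over [0, 1], so that the lemmas on [Int]
    apply. *)
Definition unit_ind : R -> R := \1_`[0, 1].

Lemma unit_ind01 t : 0 <= unit_ind t <= 1.
Proof. by rewrite /unit_ind indicE; case: (_ \in _); rewrite ler01 lexx. Qed.

Lemma measurable_unit_ind : measurable_fun setT (unit_ind : measurableTypeR R -> R).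
Proof. exact: measurable_indic. Qed.

Lemma mu01 : (@lebesgue_measure R `[0%R, 1%R]%classic = 1)%E.
Proof. by rewrite lebesgue_measure_itv/= lte_fin ltr01 -EFinD subr0. Qed.

Lemma L1_unit_ind : L1 mu unit_ind.
Proof.
rewrite /unit_ind; apply: L1_indic; first exact: measurable_itv.
have H : (@lebesgue_measure R `[0%R, 1%R]%classic < +oo)%E by rewrite mu01 ltry.
exact: H.
Qed.

Lemma Int_unit_ind : Int mu unit_ind = 1.
Proof.
by rewrite /Int /Rintegral integral_indic// setIT [X in fine X]mu01.
Qed.

Lemma measurable_line j h (sgn : R) :
  measurable_fun setT (fun a : X * measurableTypeR R => a.1 + (a.2 * h) *: (unit_vector j : X)).
Proof.
apply: measurable_fun_coorP => i; under eq_fun do rewrite !mxE.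
apply: measurable_funD.
  by apply: (measurableT_comp (@measurable_coor _ _ n i)); exact: measurable_fst.
apply: measurable_funM => //; apply: measurable_funM => //; exact: measurable_snd.
Qed.

Definition line_avg j h f x : R := Int mu (fun t => unit_ind t * f (x + (t * h) *: unit_vector j)).

Lemma measurable_lineK j h f : measurable_fun setT f -> measurable_fun setT
  (fun a : X * measurableTypeR R => unit_ind a.2 * f (a.1 + (a.2 * h) *: unit_vector j)).
Proof.
move=> mf; apply: measurable_funM.
  exact: (measurableT_comp measurable_unit_ind measurable_snd).
exact: (measurableT_comp mf (measurable_line j h 1)).
Qed.

Lemma line_avgP j h f : L1 leb f ->
  [/\ {ae leb, forall x, L1 mu (fun t => unit_ind t * f (x + (t * h) *: unit_vector j))},
   L1 leb (line_avg j h f) & Int leb (line_avg j h f) = Int leb f].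
Proof.
move=> Lf; pose K (a : X * measurableTypeR R) := unit_ind a.2 * f (a.1 + (a.2 * h) *: unit_vector j).
have mK : measurable_fun setT K by apply: measurable_lineK; exact: L1_meas Lf.
have [|||H1 H2 _ H4] := @fubini_L1 _ _ _ _ _ leb mu K (fun t => unit_ind t * Int leb (fun x => `|f x|)) mK.
- by move=> t; rewrite /K /=; apply: L1Z; exact: L1_shift.
- rewrite (_ : (fun _ => _) = fun t => Int leb (fun x => `|f x|) * unit_ind t).
    by apply: L1Z; exact: L1_unit_ind.
  by apply/funext => t; rewrite mulrC.
- move=> t; have /andP[t0 _] := unit_ind01 t.
  have -> : (fun x => `|K (x, t)|) = fun x => unit_ind t * `|f (x + (t * h) *: unit_vector j)|.
    by apply/funext => x; rewrite normrM (ger0_norm t0).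
  rewrite IntZ; last by apply: L1_abs; exact: L1_shift.
  by rewrite (Int_shift ((t * h) *: unit_vector j) (L1_abs Lf)).
split=> //; rewrite H4.
have -> : (fun t => Int leb (fun x => K (x, t))) = fun t => Int leb f * unit_ind t.
  apply/funext => t; rewrite /K /= IntZ; last exact: L1_shift.
  by rewrite Int_shift// mulrC.
by rewrite IntZ ?Int_unit_ind ?mulr1//; exact: L1_unit_ind.
Qed.

(** Averaging over the segment ahead of a point is adjoint to averaging over the segment behind it:
    exchange the integrals and shift [x] for each fixed [t]. *)
Lemma line_avg_duality j h f phi : L1 leb f -> Ccinf phi ->
  Int leb (fun x => phi x * line_avg j h f x) =
  Int leb (fun x => line_avg j (- h) phi x * f x).
Proof.
move=> Lf Tphi; have [M HM] := Ccinf_bounded Tphi; have mphi := Ccinf_meas Tphi.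
have M0 : 0 <= M by apply: le_trans (HM 0).
have [H1 H2 _] := line_avgP j h Lf.
pose K1 (a : X * measurableTypeR R) :=
  unit_ind a.2 * (phi a.1 * f (a.1 + (a.2 * h) *: unit_vector j)).
pose K2 (a : X * measurableTypeR R) :=
  unit_ind a.2 * (phi (a.1 + (a.2 * (- h)) *: unit_vector j) * f a.1).
pose G (t : measurableTypeR R) := (M * Int leb (fun x => `|f x|)) * unit_ind t.
have LG : L1 mu G by apply: L1Z; exact: L1_unit_ind.
have mK1 : measurable_fun setT K1.
  rewrite (_ : K1 = fun a => phi a.1 * (unit_ind a.2 * f (a.1 + (a.2 * h) *: unit_vector j))).
    apply: measurable_funM; first exact: (measurableT_comp mphi measurable_fst).
    by apply: measurable_lineK; exact: L1_meas Lf.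
  by apply/funext => a; rewrite /K1 mulrCA.
have mK2 : measurable_fun setT K2.
  rewrite (_ : K2 = fun a => f a.1 * (unit_ind a.2 * phi (a.1 + (a.2 * - h) *: unit_vector j))).
    apply: measurable_funM; first exact: (measurableT_comp (L1_meas Lf) measurable_fst).
    exact: measurable_lineK.
  by apply/funext => a; rewrite /K2; ring.
have Lsh t : L1 leb (fun x => phi x * f (x + (t * h) *: unit_vector j)).
  by apply: Ccinf_L1M => //; exact: L1_shift.
have Lsh2 t : L1 leb (fun x => phi (x + (t * - h) *: unit_vector j) * f x).
  by apply: Ccinf_L1M => //; exact: Ccinf_shift.
have bnd (F : X -> R) (a : R) (t : X) : L1 leb F -> (forall x, `|F x| <= a * `|f (x + t)|) ->
    Int leb (fun x => `|F x|) <= a * Int leb (fun x => `|f x|).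
  move=> LF Fa; rewrite -(Int_shift t (f := fun x => `|f x|)); last exact: L1_abs.
  rewrite -IntZ; last by apply: L1_abs; exact: L1_shift.
  by apply: Int_le => //; [exact: L1_abs|apply: L1Z; apply: L1_abs; exact: L1_shift].
have [|||_ LK1 _ E1] := @fubini_L1 _ _ _ _ _ leb mu K1 G mK1.
- by move=> t; rewrite /K1 /=; apply: L1Z.
- by [].
- move=> t; have /andP[t0 t1] := unit_ind01 t; rewrite /G mulrAC.
  apply: (@bnd _ (M * unit_ind t) ((t * h) *: unit_vector j)).
    by rewrite /K1 /=; exact: L1Z.
  move=> x; rewrite /K1 /= !normrM (ger0_norm t0) [M * _]mulrC -!mulrA ler_wpM2l//.
  by rewrite ler_wpM2r.
have [|||_ LK2 _ E2] := @fubini_L1 _ _ _ _ _ leb mu K2 G mK2.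
- by move=> t; rewrite /K2 /=; apply: L1Z.
- by [].
- move=> t; have /andP[t0 t1] := unit_ind01 t; rewrite /G mulrAC.
  apply: (@bnd _ (M * unit_ind t) 0).
    by rewrite /K2 /=; exact: L1Z.
  move=> x; rewrite addr0 /K2 /= !normrM (ger0_norm t0) [M * _]mulrC -!mulrA ler_wpM2l//.
  by rewrite ler_wpM2r.
transitivity (Int leb (fun x => Int mu (fun t => K1 (x, t)))).
  apply: Int_ae_eq.
  - by apply: measurable_funM => //; exact: L1_meas H2.
  - exact: L1_meas LK1.
  - apply: filterS H1 => x Lx; rewrite /line_avg -IntZ//.
    by congr Int; apply/funext => t; rewrite /K1 /= mulrCA.
rewrite E1.
transitivity (Int mu (fun t => Int leb (fun x => K2 (x, t)))).
  congr Int; apply/funext => t; rewrite /K1 /K2 /= !IntZ//; congr (_ * _).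
  rewrite -(Int_shift ((t * - h) *: unit_vector j) (Lsh t)).
  congr Int; apply/funext => x; congr (_ * f _).
  by rewrite -addrA -scalerDl mulrN addNr scale0r addr0.
rewrite -E2; congr Int; apply/funext => x; rewrite /line_avg [RHS]mulrC -IntZ.
  by congr Int; apply/funext => t; rewrite /K2 /=; ring.
apply: (@L1_le _ _ _ mu (fun t : measurableTypeR R => M * unit_ind t)).
- apply: measurable_funM; first exact: measurable_unit_ind.
  have := measurable_line j (- h) 1.
  move=> ml; apply: (measurableT_comp mphi).
  exact: (measurableT_comp ml (@measurable_pair1 _ _ X (measurableTypeR R) x)).
- by apply: L1Z; exact: L1_unit_ind.
- move=> t; have /andP[t0 t1] := unit_ind01 t.
  by rewrite normrM (ger0_norm t0) mulrC ler_wpM2r.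
Qed.

End diffquot.

(** * Difference quotients of weakly differentiable functions *)

Section diffquot2.
Context {R : realType} {n : nat}.
Local Notation X := 'rV[R]_n.
Local Notation leb := (@lebm R n).
Local Notation mu := (@lebesgue_measure R).
Implicit Types (c x y z : X) (r s h t : R) (u v w f phi : X -> R) (i j : 'I_n) (Om : set X).

Lemma partial_const (F : X -> R) j : (forall (t : R) x, F (t *: unit_vector j + x) = F x) ->
  partial j F = fun=> 0.
Proof.
move=> HF; apply/funext => x; rewrite /partial /derive.
rewrite (_ : (fun _ => _) = cst (0 : R)); first exact: lim_cst.
by apply/funext => t; rewrite /= HF subrr scaler0.
Qed.

Definition beta_at z r i t : R := beta (r^-1 * t + (- (r^-1 * z ord0 i))).

(** Read off from the smoothness of [beta] on rows of length 1. *)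
Lemma beta_at_continuous z r i : continuous (beta_at z r i).
Proof.
have H : continuous (fun x : 'rV[R]_1 => beta (r^-1 * x ord0 ord0 + (- (r^-1 * z ord0 i)))).
  exact: C_k_cont (@C_k_beta R 1 0 _ _ _).
have H2 : continuous (fun t : R => const_mx t : 'rV[R]_1).
  move=> t; apply/cvgrPdist_lt => e e0; near=> s.
  apply/(Q_norm _ e0) => k; rewrite !mxE subr0; near: s.
  exact: (@cvgr_dist_lt _ _ _ (nbhs t) _ id t cvg_id _ e0).
move=> t; rewrite (_ : beta_at z r i = (fun x : 'rV[R]_1 =>
  beta (r^-1 * x ord0 ord0 + (- (r^-1 * z ord0 i)))) \o (fun t => const_mx t)); last first.
  by apply/funext => s; rewrite /= mxE.
by apply: continuous_comp; [exact: H2|exact: H].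
Unshelve. all: by end_near. Qed.

Definition bump_rest z r j x : R := \prod_(i < n | i != j) beta_at z r i (x ord0 i).

Lemma bumpE z r j x : bump z r x = beta_at z r j (x ord0 j) * bump_rest z r j x.
Proof. by rewrite /bump (bigD1 j). Qed.

Lemma bump_rest_line z r j (t : R) x : bump_rest z r j (t *: unit_vector j + x) = bump_rest z r j x.
Proof.
apply: eq_bigr => i ij; congr beta_at; rewrite !mxE (negbTE ij) andbF mulr0 add0r//.
Qed.

Lemma C_k_bump_rest k z r j : C_k k (bump_rest z r j).
Proof.
rewrite /bump_rest; under eq_fun do rewrite big_mkcond.
apply: C_k_prod => i; case: (i != j); last exact: C_k_cst.
exact: C_k_beta.
Qed.

(* A compactly supported function whose [j]-th derivative is a difference of translated
   bumps; testing the weak derivative with it yields the difference quotient formula by duality. *)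
Definition bump_prim z r j h x : R :=
  bump_rest z r j x *
  (oprim (beta_at z r j) (x ord0 j) - oprim (beta_at z r j) (x ord0 j - h)).

(** The difference of primitives is an integral of the profile over a segment of length |h|. This
    form lets [line_avg_duality] move the average onto the weak derivative. *)
Lemma bump_primE z r j h x : bump_prim z r j h x = h * line_avg j (- h) (bump z r) x.
Proof.
rewrite /bump_prim oprim_diff; last exact: beta_at_continuous.
rewrite mulrCA; congr (h * _); rewrite /line_avg.
have -> : (fun t : measurableTypeR R => unit_ind t * bump z r (x + (t * - h) *: unit_vector j)) =
    fun t => bump_rest z r j x * ((fun t => beta_at z r j (x ord0 j - t * h)) \_ `[0, 1]) t.
  apply/funext => t; rewrite (bumpE _ _ j) [x + _]addrC bump_rest_line !mxE !eqxx mulr1.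
  rewrite mulrN [- _ + _]addrC patchE /unit_ind indicE.
  by case: (_ \in _); rewrite ?mul1r ?mul0r ?mulr0// mulrC.
rewrite IntZ; first by rewrite /Int -Rintegral_mkcond.
have cg : continuous (fun t => beta_at z r j (x ord0 j - t * h)).
  move=> t; apply: (@continuous_comp _ _ _ (fun t : R => x ord0 j - t * h) (beta_at z r j)); last exact: beta_at_continuous.
  by apply: cvgB; [exact: cvg_cst|apply: cvgM; [exact: cvg_id|exact: cvg_cst]].
have := continuous_itv_integrable 0 1 cg.
move=> H; rewrite /L1 -restrict_EFin; apply/integrable_restrict => //.
by rewrite setTI.
Qed.

Lemma oprim_shift_derive (b : R -> R) h t : continuous b ->
  is_derive t 1 (fun t => oprim b t - oprim b (t - h)) (b t - b (t - h)).
Proof.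
move=> cb; apply: is_deriveB; first exact: oprim_derive.
have := @is_derive_affine _ (oprim b) 1 (- h) (b (t - h)) t.
rewrite mul1r mulr1 => H.
rewrite (_ : (fun t0 => _) = fun s => oprim b (1 * s + - h)); last first.
  by apply/funext => s; rewrite mul1r.
by apply: H; exact: oprim_derive.
Qed.

Lemma C_k_bump_prim k z r j h : C_k k (bump_prim z r j h).
Proof.
(* [C_k_coord] concludes for an order of the form [k.+1], so one order more than needed is
   proved. *)
apply: C_kS; apply: C_kM; first exact: C_k_bump_rest.
apply: (@C_k_coord _ _ _ (fun t => oprim (beta_at z r j) t - oprim (beta_at z r j) (t - h))
  (fun t => beta_at z r j t - beta_at z r j (t - h))).
  by move=> t; apply: oprim_shift_derive; exact: beta_at_continuous.
rewrite (_ : (fun x : X => _) = fun x => beta (r^-1 * x ord0 j + (- (r^-1 * z ord0 j))) +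
   (-1) * beta (r^-1 * x ord0 j + (- (r^-1 * (z ord0 j + h))))).
  by apply: C_kD; [exact: C_k_beta|apply: C_kZ; exact: C_k_beta].
apply/funext => x; rewrite mulN1r; congr (_ - beta _); ring.
Qed.

Lemma partial_bump_prim z r j h x : partial j (bump_prim z r j h) x =
  bump z r x - bump z r (x - h *: unit_vector j).
Proof.
rewrite /bump_prim partialM; last 2 first.
- by move=> y; have [_ /(_ j)[]] := C_k_bump_rest 1 z r j.
- move=> y; have dd := oprim_shift_derive h (y ord0 j) (@beta_at_continuous z r j).
  by case: (is_derive_coord j dd).
rewrite (partial_const (bump_rest_line z r j)) mulr0 addr0.
have dd := oprim_shift_derive h (x ord0 j) (@beta_at_continuous z r j).
have [_] := is_derive_coord j dd; rewrite eqxx /partial => ->.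
rewrite mulrBr !(bumpE _ _ j) -(scaleNr h (unit_vector j)) [x + _]addrC bump_rest_line !mxE !eqxx mulr1.
by rewrite [- h + _]addrC ![bump_rest _ _ _ _ * _]mulrC.
Qed.

Lemma bump_prim_supp z r j h s : 0 < r -> r + `|h| <= s ->
  forall x, ~ Qc z s x -> bump_prim z r j h x = 0.
Proof.
move=> r0 rs x nQ; rewrite bump_primE /line_avg.
have -> : (fun t : measurableTypeR R => unit_ind t * bump z r (x + (t * - h) *: unit_vector j)) =
    fun=> 0.
  apply/funext => t; rewrite /unit_ind indicE.
  case: (boolP (t \in `[0, 1]%classic)) => [|_]; last by rewrite mul0r.
  rewrite inE /= in_itv/= => /andP[t0 t1].
  rewrite bump_eq0 ?mulr0// => Qx; apply: nQ => i; have := Qx i; rewrite !mxE => Hx.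
  have H2 : `|t * - h * ((i == j)%:R : R)| <= `|h|.
    rewrite eq_sym; case: (j == i); rewrite ?mulr1 ?mulr0 ?normr0// normrM normrN.
    by rewrite ger0_norm// ler_piMl.
  rewrite -(addrK (t * - h * (i == j)%:R) (x ord0 i)) addrAC.
  rewrite (le_trans (ler_normB _ _))//.
  move: Hx H2; rewrite eqxx andTb; lra.
by rewrite Int0 mulr0.
Qed.

(** The fundamental theorem of calculus for a weak derivative, by duality. Tested against a bump,
    the increment of [u] moves onto the bump and becomes minus the integral of [u] times the j-th
    derivative of [bump_prim]. The weak derivative turns this into [w] against [bump_prim], which is
    [h] times the adjoint average of the bump. *)
Lemma diff_formula Om j u w c s s' h : h != 0 -> is_weak_partial Om j u w ->
  Qc c s' `<=` Om -> s + `|h| < s' ->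
  {ae leb, forall x, Q c s x ->
    (u \_ (Q c s')) (x + h *: unit_vector j) - (u \_ (Q c s')) x =
    h * line_avg j h (w \_ (Q c s')) x}.
Proof.
move=> h0 [Lu Lw Hw] QOm shs.
have cQ := compactly_inside_Q QOm.
set U := u \_ _; set W := w \_ _.
have LU : L1 leb U by exact/Lp_space1P/Lu.
have LW : L1 leb W by exact/Lp_space1P/Lw.
have [_ LA _] := line_avgP j h LW.
pose e := h *: unit_vector j : X.
pose G x := (U (x + e) - U x) - h * line_avg j h W x.
have LD : L1 leb (fun x => U (x + e) - U x) by apply: L1B => //; exact: L1_shift.
have LG : L1 leb G by apply: L1B => //; exact: L1Z.
have H0 : s < s' - `|h| by lra.
(* [bump_prim] spreads the bump by |h|, so bumps inside radius [s1] keep it within [Q c s']. *)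
pose s1 := (s + (s' - `|h|)) / 2.
have s1P : s < s1 by rewrite /s1; lra.
have s1Q : s1 < s' - `|h| by rewrite /s1; lra.
suff : {ae leb, forall x, Q c s x -> G x = 0}.
  by apply: filterS => x + Qx => /(_ Qx) /eqP; rewrite subr_eq0 => /eqP.
apply: (@L1_bumps_ae0 _ _ _ c s s1) => // z r r0 zr.
have Tb := @Ccinf_bump R n z r r0.
have psi0 := @bump_prim_supp z r j h (r + `|h|) r0 (lexx _).
have QQ : Qc z (r + `|h|) `<=` Q c s'.
  move=> x Qx i; have := Qx i; have := zr i => H1 H2.
  rewrite -(subrKA (z ord0 i)) (le_lt_trans (ler_normD _ _))//; lra.
have QOm' := subset_trans (@Q_Qc _ _ c s') QOm.
have tpsi : test_function Om (bump_prim z r j h).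
  by apply: (test_function_Qc (fun k => @C_k_bump_prim k z r j h) psi0); exact: subset_trans QQ QOm'.
have psiQ x : ~ Q c s' x -> bump_prim z r j h x = 0.
  by move=> nQ; apply: psi0 => Qx; apply: nQ; exact: QQ.
have ppsiQ x : ~ Q c s' x -> partial j (bump_prim z r j h) x = 0.
  by move=> nQ; apply: (partial_supp j (@closed_Qc _ _ _ _) psi0) => Qx; apply: nQ; exact: QQ.
have := Hw _ tpsi.
rewrite (Rint_supp QOm'); last by move=> x /ppsiQ ->; rewrite mulr0.
rewrite (Rint_supp QOm'); last by move=> x /psiQ ->; rewrite mulr0.
rewrite (patch_supp _ ppsiQ) (patch_supp _ psiQ) -/U -/W => E.
have -> : (fun x => bump z r x * G x) =
    fun x => (bump z r x * U (x + e) - bump z r x * U x) - h * (bump z r x * line_avg j h W x).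
  by apply/funext => x; rewrite /G; ring.
have L1a : L1 leb (fun x => bump z r x * U (x + e)) by apply: Ccinf_L1M => //; exact: L1_shift.
have L1b : L1 leb (fun x => bump z r x * U x) by exact: Ccinf_L1M.
have L1c : L1 leb (fun x => bump z r x * line_avg j h W x) by exact: Ccinf_L1M.
have L1d : L1 leb (fun x => bump z r (x - e) * U x) by apply: Ccinf_L1M => //; exact: Ccinf_shift.
rewrite IntB; [|exact: L1B|exact: L1Z].
rewrite IntB// IntZ// line_avg_duality//.
have -> : h * Int leb (fun x => line_avg j (- h) (bump z r) x * W x) =
    Int leb (fun x => bump_prim z r j h x * W x).
  rewrite -IntZ; first by congr Int; apply/funext => x; rewrite bump_primE mulrA.
  rewrite (_ : (fun x => _) = fun x => h^-1 * (bump_prim z r j h x * W x)).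
    by apply: L1Z; apply: Ccinf_L1M => //; exact: test_Ccinf tpsi.
  by apply/funext => x; rewrite bump_primE !mulrA mulVf// mul1r.
rewrite -[Int leb (fun x => bump_prim z r j h x * W x)]opprK -E.
rewrite -(Int_shift (- e) L1a).
have -> : (fun x => bump z r (x - e) * U (x - e + e)) = fun x => bump z r (x - e) * U x.
  by apply/funext => x; rewrite subrK.
have -> : (fun x => partial j (bump_prim z r j h) x * U x) =
   fun x => bump z r x * U x - bump z r (x - e) * U x.
  by apply/funext => x; rewrite partial_bump_prim mulrBl.
by rewrite IntB//; ring.
Qed.

(** The graph of a^p lies above its tangent at [m]. Young's inequality for [a] and m^(p-1) gives it
    without derivatives of real powers. *)
Lemma powR_tangent (p a m : R) : 1 < p -> 0 <= a -> 0 <= m ->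
  p * m `^ (p - 1) * a <= a `^ p + (p - 1) * m `^ p.
Proof.
move=> p1 a0 m0; have p0 : 0 < p by lra.
have q0 : 0 < p / (p - 1) by rewrite divr_gt0//; lra.
have pq : p^-1 + (p / (p - 1))^-1 = 1 by field; lra.
have := conjugate_powR a0 (powR_ge0 m (p - 1)) p0 q0 pq.
rewrite -powRrM (_ : (p - 1) * (p / (p - 1)) = p); last by field; lra.
rewrite -(ler_pM2l p0) mulrDr => H.
rewrite (_ : p * (a `^ p / p) = a `^ p) in H; last by field; lra.
rewrite (_ : p * (m `^ p / (p / (p - 1))) = (p - 1) * m `^ p) in H; last by field; lra.
by rewrite -mulrA [_ * a]mulrC.
Qed.

(** Jensen's inequality: integrate the tangent inequality taken at the mean [m] of |w| over the
    segment. *)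
Lemma line_avg_powR (p : R) j h w x : 1 < p ->
  L1 mu (fun t => unit_ind t * w (x + (t * h) *: unit_vector j)) ->
  L1 mu (fun t => unit_ind t * (`|w (x + (t * h) *: unit_vector j)| `^ p)) ->
  `|line_avg j h w x| `^ p <= line_avg j h (fun y => `|w y| `^ p) x.
Proof.
move=> p1 L1w Lp.
pose m := Int mu (fun t => `|unit_ind t * w (x + (t * h) *: unit_vector j)|).
have m0 : 0 <= m by exact: Int_ge0.
have p0 : 0 < p by lra.
apply: (@le_trans _ _ (m `^ p)).
  by apply: ge0_ler_powR; rewrite ?nnegrE//; [exact: ltW|exact: Int_norm].
have H : p * m `^ (p - 1) * m <= line_avg j h (fun y => `|w y| `^ p) x + (p - 1) * m `^ p.
  have Lm : L1 mu (fun t => `|unit_ind t * w (x + (t * h) *: unit_vector j)|) by exact: L1_abs.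
  have -> : p * m `^ (p - 1) * m = Int mu (fun t => p * m `^ (p - 1) *
      `|unit_ind t * w (x + (t * h) *: unit_vector j)|) by rewrite IntZ.
  have -> : (p - 1) * m `^ p = Int mu (fun t => (p - 1) * m `^ p * unit_ind t).
    by rewrite IntZ ?Int_unit_ind ?mulr1//; exact: L1_unit_ind.
  rewrite /line_avg -IntD//; last by apply: L1Z; exact: L1_unit_ind.
  apply: Int_le.
  - exact: L1Z.
  - by apply: L1D => //; apply: L1Z; exact: L1_unit_ind.
  - move=> t; rewrite /unit_ind indicE; case: (_ \in _); rewrite ?mul1r ?mulr1 ?mul0r ?normr0 ?mulr0 ?addr0//.
    exact: powR_tangent.
have E : m `^ (p - 1) * m = m `^ p.
  have [->|mn0] := eqVneq m 0; first by rewrite mulr0 powR0// gt_eqF.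
  by rewrite -[X in _ * X]powRr1// -powRD ?subrK// mn0 implybT.
rewrite -mulrA E in H; lra.
Qed.

(** [P] varies with [h] but its integral does not; this is the source of uniformity in [h]. *)
Lemma diffquot_bound Om j u w c s s' h p : 1 < p -> h != 0 -> is_weak_partial Om j u w ->
  Qc c s' `<=` Om -> s + `|h| < s' -> L1 leb (fun x => `|(w \_ (Q c s')) x| `^ p) ->
  exists P : X -> R, [/\ L1 leb P, forall x, 0 <= P x,
    Int leb P = Int leb (fun x => `|(w \_ (Q c s')) x| `^ p) &
    {ae leb, forall x, Q c s x ->
      `|(u \_ (Q c s')) (x + h *: unit_vector j) - (u \_ (Q c s')) x| `^ p <=
      `|h| `^ p * P x}].
Proof.
move=> p1 h0 Hw QOm shs Lp.
have [_ Lw _] := Hw.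
have LW : L1 leb (w \_ (Q c s')) by exact/Lp_space1P/Lw/(compactly_inside_Q QOm).
have [A1 _ _] := line_avgP j h LW.
have [B1 B2 B3] := line_avgP j h Lp.
exists (line_avg j h (fun x => `|(w \_ (Q c s')) x| `^ p)); split => //.
  move=> x; apply: Int_ge0 => t; have /andP[t0 _] := unit_ind01 t.
  by rewrite mulr_ge0// powR_ge0.
have D := diff_formula h0 Hw QOm shs.
apply: filterS3 D A1 B1 => x Dx A1x B1x Qx.
rewrite Dx// normrM powRM// ler_wpM2l ?powR_ge0//.
exact: line_avg_powR.
Qed.

End diffquot2.

(** * The integrand and the function V *)

Section one_dim.
Context {R : realType}.
Implicit Types (a b t s d : R) (F f : R -> R).

Lemma derive_ge0_le F f a b : a <= b -> (forall t, is_derive t 1 F (f t)) ->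
  (forall t, a <= t <= b -> 0 <= f t) -> F a <= F b.
Proof.
move=> ab dF f0; rewrite -subr_ge0.
have [//|c cab ->] := @MVT_segment _ F f a b ab (fun x _ => dF x) _.
  exact/continuous_subspaceT/derive_continuous.
by rewrite mulr_ge0 ?subr_ge0//; apply: f0; move: cab; rewrite in_itv.
Qed.

Lemma is_derive_scale l F t d : is_derive t 1 F d -> is_derive t 1 (fun s => l * F s) (l * d).
Proof.
move=> dF; have := is_deriveM (is_derive_cst l t 1) dF.
by rewrite scaler0 addr0.
Qed.

Lemma norm_between a b t : a <= t <= b -> `|t| <= Num.max `|a| `|b|.
Proof.
move=> /andP[at_ tb]; rewrite le_max; have [t0|t0] := leP 0 t.
  by rewrite (ger0_norm t0) (le_trans tb (ler_norm b)) orbT.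
by rewrite (ltr0_norm t0) (@le_trans _ _ (- a)) ?lerN2// -normrN ler_norm.
Qed.

Lemma powRD2 a q : 0 <= q -> 0 <= a -> a `^ (q + 2) = a `^ q * a ^+ 2.
Proof.
move=> q0 a0; have [->|an0] := eqVneq a 0.
  by rewrite expr0n mulr0 powR0// gt_eqF// ltr_wpDl.
by rewrite powRD ?powR_mulrn// an0 implybT.
Qed.

Context (g : R -> R) (C q : R).
Hypotheses (gC2 : C2 g) (q0 : 0 <= q) (C0 : 0 <= C).
Hypothesis g20 : forall s, 0 <= derive1n 2 g s.
Hypothesis g2C : forall s, derive1n 2 g s <= C * (`|s| `^ q + 1).
Local Notation g1 := (derive1n 1 g).
Local Notation g2 := (derive1n 2 g).
Local Notation V := (V_fun g).
Local Notation p := (q + 2).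

Lemma dg t : is_derive t 1 g (g1 t).
Proof.
by case: gC2 => H _ _; apply: DeriveDef; [exact: H|rewrite derive1n1 derive1E].
Qed.

Lemma dg1 t : is_derive t 1 g1 (g2 t).
Proof.
by case: gC2 => _ H _; apply: DeriveDef; [exact: H|by rewrite -derive1E].
Qed.

Lemma cg2 : continuous g2.
Proof. by case: gC2. Qed.

Lemma dV t : is_derive t 1 V (Num.sqrt (g2 t)).
Proof.
apply: (@oprim_derive R (fun s => Num.sqrt (g2 s))) => s.
by apply: continuous_comp; [exact: cg2|exact: sqrt_continuous].
Qed.

Lemma g1_nd a b : a <= b -> g1 a <= g1 b.
Proof. by move=> ab; apply: (derive_ge0_le ab dg1) => t _; exact: g20. Qed.

Lemma V_nd a b : a <= b -> V a <= V b.
Proof. by move=> ab; apply: (derive_ge0_le ab dV) => t _; exact: sqrtr_ge0. Qed.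

Lemma g1_lip a b M : a <= b -> (forall t, a <= t <= b -> g2 t <= M) ->
  g1 b - g1 a <= M * (b - a).
Proof.
move=> ab H.
have dF (t : R) : is_derive t 1 (fun t => M * t - g1 t) (M * 1 - g2 t).
  exact: (is_deriveB (is_derive_scale M (is_derive_id _ _)) (dg1 t)).
have := derive_ge0_le ab dF; rewrite mulr1 => K.
have {}K : M * a - g1 a <= M * b - g1 b by apply: K => t /H; rewrite subr_ge0.
lra.
Qed.

(** Cauchy-Schwarz for the integral of sqrt(g''), in differential form: for the slope [l] of V, the
    function g' - 2 l V + l^2 t has the nonnegative derivative (sqrt(g'') - l)^2. *)
Lemma V_sq_le a b : (V b - V a) ^+ 2 <= (g1 b - g1 a) * (b - a).
Proof.
wlog ab : a b / a < b.
  move=> H; have [ab|ba|->] := ltgtP a b; first exact: H.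
    by have := H _ _ ba; rewrite -sqrrN opprB -mulrNN !opprB.
  by rewrite !subrr mulr0 expr0n.
pose l := (V b - V a) / (b - a).
have dF (t : R) : is_derive t 1 (fun t => g1 t - 2 * l * V t + l ^+ 2 * t)
   (g2 t - 2 * l * Num.sqrt (g2 t) + l ^+ 2 * 1).
  exact: (is_deriveD (is_deriveB (dg1 t) (is_derive_scale (2 * l) (dV t)))
    (is_derive_scale (l ^+ 2) (is_derive_id _ _))).
have H : g1 a - 2 * l * V a + l ^+ 2 * a <= g1 b - 2 * l * V b + l ^+ 2 * b.
  apply: (derive_ge0_le (ltW ab) dF) => t _.
  have := sqr_ge0 (Num.sqrt (g2 t) - l); rewrite sqrrB sqr_sqrtr ?g20//.
  by rewrite mulr1 -mulr_natr; lra.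
have bn0 : b - a != 0 by rewrite gt_eqF// subr_gt0.
have lE : l * (b - a) = V b - V a by rewrite /l mulfVK.
have ba : 0 < b - a by rewrite subr_gt0.
have K : 0 <= (g1 b - g1 a) - l * (V b - V a).
  have -> : g1 b - g1 a - l * (V b - V a) = g1 b - g1 a - 2 * l * (V b - V a) + l * (l * (b - a)).
    by rewrite lE; ring.
  lra.
have := mulr_ge0 K (ltW ba); rewrite mulrBl subr_ge0.
by rewrite mulrAC lE expr2.
Qed.

(** On the segment g'' <= M, so sqrt(M) V - g' has derivative sqrt(g'') (sqrt(M) - sqrt(g'')) >=
    0. *)
Lemma g1_sq_le a b M : (forall t, `|t| <= Num.max `|a| `|b| -> g2 t <= M) ->
  (g1 b - g1 a) ^+ 2 <= M * (V b - V a) ^+ 2.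
Proof.
wlog ab : a b / a <= b.
  move=> H; have [ab|/ltW ba] := leP a b; first exact: H.
  move=> K; have := H _ _ ba; rewrite maxC => /(_ K).
  by rewrite -sqrrN opprB -[X in _ * X]sqrrN opprB.
move=> H; have M0 : 0 <= M.
  by apply: le_trans (g20 a) (H a _); rewrite le_max lexx.
have HM t : a <= t <= b -> g2 t <= M.
  by move=> /norm_between; exact: H.
have dF (t : R) : is_derive t 1 (fun t => Num.sqrt M * V t - g1 t)
   (Num.sqrt M * Num.sqrt (g2 t) - g2 t).
  exact: (is_deriveB (is_derive_scale (Num.sqrt M) (dV t)) (dg1 t)).
have K : Num.sqrt M * V a - g1 a <= Num.sqrt M * V b - g1 b.
  apply: (derive_ge0_le ab dF) => t /HM tM.
  rewrite -{2}(sqr_sqrtr (g20 t)) expr2 -mulrBl mulr_ge0 ?sqrtr_ge0// subr_ge0.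
  exact: ler_wsqrtr.
have G0 := g1_nd ab; have V0 := V_nd ab.
rewrite -{1}(sqr_sqrtr M0) -exprMn ler_pXn2r// ?nnegrE.
- by rewrite mulrBr; lra.
- by rewrite subr_ge0.
- by rewrite mulr_ge0 ?sqrtr_ge0// subr_ge0.
Qed.

Lemma powR_abs_le a b : `|a| <= `|b| -> `|a| `^ q <= `|b| `^ q.
Proof. by move=> ab; apply: ge0_ler_powR. Qed.

(** Comparing |a| with |b| replaces Young's inequality and covers q = 0 as well. *)
Lemma powR_mul_le a b : `|a| `^ q * `|b| ^+ 2 <= `|a| `^ p + `|b| `^ p.
Proof.
have [ab|/ltW ba] := leP `|a| `|b|.
  rewrite [X in _ <= _ + X]powRD2// ler_wpDl ?powR_ge0// ler_wpM2r ?sqr_ge0//.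
  exact: powR_abs_le.
rewrite [X in _ <= X + _]powRD2// ler_wpDr ?powR_ge0// ler_wpM2l ?powR_ge0//.
by rewrite ler_pXn2r ?nnegrE.
Qed.

Lemma powRD2_norm a : `|a| `^ p = `|a| `^ q * a ^+ 2.
Proof. by rewrite powRD2// real_normK ?num_real. Qed.

Lemma sqr_le_powR a : a ^+ 2 <= 1 + `|a| `^ p.
Proof.
rewrite powRD2_norm -real_normK ?num_real//.
have [a1|/ltW a1] := leP `|a| 1.
  by rewrite ler_wpDr ?mulr_ge0 ?powR_ge0 ?sqr_ge0// expr_le1.
rewrite ler_wpDl// ler_peMl ?sqr_ge0//.
have -> : 1 = 1 `^ q :> R by rewrite powR1.
by rewrite ge0_ler_powR ?nnegrE.
Qed.

Lemma powR_mul_sqr_le a b : `|a| `^ q * b ^+ 2 <= `|a| `^ p + `|b| `^ p.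
Proof. by rewrite -[b ^+ 2]real_normK ?num_real// powR_mul_le. Qed.

Lemma g2_max a b t : `|t| <= Num.max `|a| `|b| ->
  g2 t <= C * (`|a| `^ q + `|b| `^ q + 1).
Proof.
move=> tab; apply: le_trans (g2C t) _; apply: ler_wpM2l => //.
rewrite lerD2r; move: tab; rewrite le_max => /orP[] H.
  by rewrite ler_wpDr ?powR_ge0// ge0_ler_powR.
by rewrite ler_wpDl ?powR_ge0// ge0_ler_powR.
Qed.

Lemma g1_mul_le a b M : (forall t, `|t| <= Num.max `|a| `|b| -> g2 t <= M) ->
  (g1 b - g1 a) * (b - a) <= M * (b - a) ^+ 2.
Proof.
wlog ab : a b / a <= b.
  move=> H; have [ab|/ltW ba] := leP a b; first exact: H.
  by rewrite maxC => K; have := H _ _ ba K; rewrite -mulrNN !opprB -sqrrN opprB.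
move=> H; rewrite expr2 mulrA ler_wpM2r ?subr_ge0//.
by apply: g1_lip => // t /norm_between; exact: H.
Qed.

(** The tangent at [b] lies below the graph since g' is nondecreasing. Placing the derivative at the
    far end [b] lets [g_taylor] compare it with the derivative at [a]. *)
Lemma g_convex a b : g b - g a <= g1 b * (b - a).
Proof.
have key a' b' (l : R) : a' <= b' -> (forall t, a' <= t <= b' -> g1 t <= l) ->
    g b' - g a' <= l * (b' - a').
  move=> ab H.
  have dF (t : R) : is_derive t 1 (fun t => l * t - g t) (l * 1 - g1 t).
    exact: (is_deriveB (is_derive_scale l (is_derive_id _ _)) (dg t)).
  have := derive_ge0_le ab dF; rewrite mulr1 => K.
  have {}K : l * a' - g a' <= l * b' - g b' by apply: K => t /H; rewrite subr_ge0.
  lra.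
have key2 a' b' (l : R) : a' <= b' -> (forall t, a' <= t <= b' -> l <= g1 t) ->
    l * (b' - a') <= g b' - g a'.
  move=> ab H.
  have dF (t : R) : is_derive t 1 (fun t => g t - l * t) (g1 t - l * 1).
    exact: (is_deriveB (dg t) (is_derive_scale l (is_derive_id _ _))).
  have := derive_ge0_le ab dF; rewrite mulr1 => K.
  have {}K : g a' - l * a' <= g b' - l * b' by apply: K => t /H; rewrite subr_ge0.
  lra.
have [ab|/ltW ba] := leP a b.
  by apply: key => // t /andP[_ tb]; exact: g1_nd.
have := @key2 b a (g1 b) ba; rewrite -[b - a]opprB mulrN lerNr opprB; apply.
by move=> t /andP[bt _]; exact: g1_nd.
Qed.

Lemma powR_sum_le a b r : 0 <= r ->
  `|a + b| `^ r <= 2 `^ r * (`|a| `^ r + `|b| `^ r).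
Proof.
move=> r0; wlog ab : a b / `|a| <= `|b|.
  move=> H; have [|/ltW] := leP `|a| `|b|; first exact: H.
  by move=> /H; rewrite addrC [X in _ * X]addrC.
rewrite (@le_trans _ _ ((2 * `|b|) `^ r))//.
  rewrite ge0_ler_powR ?nnegrE ?mulr_ge0//.
  by rewrite (le_trans (ler_normD _ _))// mulr_natl mulr2n lerD2r.
by rewrite powRM// ler_wpM2l ?powR_ge0// ler_wpDl ?powR_ge0.
Qed.

Lemma g1_growth a : `|g1 a| <= `|g1 0| + C * (`|a| `^ q + 1) * `|a|.
Proof.
have := @g1_mul_le 0 a (C * (`|a| `^ q + 1)).
rewrite !subr0 normr0 => H.
have {}H : (g1 a - g1 0) * a <= C * (`|a| `^ q + 1) * a ^+ 2.
  apply: H => t; rewrite (max_idPr (normr_ge0 a)) => ta.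
  apply: le_trans (g2C t) _; rewrite ler_wpM2l// lerD2r.
  by rewrite ge0_ler_powR.
rewrite -lerBlDl (le_trans (lerB_dist _ _))//.
have [->|a0] := eqVneq a 0; first by rewrite subrr !normr0 mulr0.
have na : 0 < `|a| by rewrite normr_gt0.
rewrite -(ler_pM2r na) -normrM -[X in _ <= X]mulrA -expr2 real_normK ?num_real//.
rewrite ger0_norm//.
have [a0'|/ltW a0'] := leP 0 a.
  by rewrite mulr_ge0 ?subr_ge0 ?g1_nd.
by rewrite mulr_le0 ?subr_le0 ?g1_nd.
Qed.

Lemma g1M_growth : exists2 K, 0 <= K &
  forall a b, `|g1 a * b| <= K * (1 + `|a| `^ p + `|b| `^ p).
Proof.
(* With A = |a|^p and B = |b|^p, one has |b| <= 2 + B and |a|^q |a b| + |a b| <= 2 + 3 A + 2 B. *)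
exists (2 * `|g1 0| + 5 * C); first by rewrite addr_ge0 ?mulr_ge0.
move=> a b; rewrite normrM.
have A0 := powR_ge0 `|a| p; have B0 := powR_ge0 `|b| p.
have a2 := sqr_le_powR a; have b2 := sqr_le_powR b.
have b1 : `|b| <= 1 + b ^+ 2.
  rewrite -real_normK ?num_real//; have := sqr_ge0 (`|b| - 1); rewrite sqrrB1.
  by rewrite -mulr_natr; have := normr_ge0 b; lra.
have ab1 : `|a| * `|b| <= a ^+ 2 + b ^+ 2.
  rewrite -(@real_normK _ a) ?num_real// -(@real_normK _ b) ?num_real//.
  have := sqr_ge0 (`|a| - `|b|); rewrite sqrrB -mulr_natr.
  by have := mulr_ge0 (normr_ge0 a) (normr_ge0 b); lra.
have abq : `|a| `^ q * (`|a| * `|b|) <= 2 * `|a| `^ p + `|b| `^ p.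
  apply: (le_trans (ler_wpM2l (powR_ge0 _ _) ab1)); rewrite mulrDr -powRD2_norm.
  by have := powR_mul_sqr_le a b; lra.
have H := ler_wpM2r (normr_ge0 b) (g1_growth a).
apply: (le_trans H); rewrite mulrDl.
have -> : C * (`|a| `^ q + 1) * `|a| * `|b| =
   C * (`|a| `^ q * (`|a| * `|b|) + `|a| * `|b|) by ring.
rewrite [X in _ <= X]mulrDl lerD//.
  rewrite -mulrA mulrCA ler_wpM2l//; lra.
rewrite [5 * C]mulrC -[X in _ <= X]mulrA ler_wpM2l//; lra.
Qed.

Lemma g_growth : (forall s, 0 <= g s) -> exists2 K, 0 <= K &
  forall a, `|g a| <= K * (1 + `|a| `^ p).
Proof.
move=> g0; have [K K0 H] := g1M_growth.
exists (g 0 + 2 * K); first by rewrite addr_ge0 ?mulr_ge0.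
move=> a; rewrite ger0_norm//; have := g_convex 0 a; rewrite subr0 lerBlDl.
move=> /le_trans; apply; rewrite mulrDl lerD//.
  by rewrite ler_peMr// lerDl powR_ge0.
apply: le_trans (ler_norm _) (le_trans (H a a) _).
rewrite [2 * K]mulrC -[X in _ <= X]mulrA ler_wpM2l//.
by have := powR_ge0 `|a| p; lra.
Qed.

Lemma V0 : V 0 = 0.
Proof. by rewrite /V_fun lexx set_itv1 Rintegral_set1. Qed.

Lemma V_growth : exists2 K, 0 <= K & forall a, V a ^+ 2 <= K * (1 + `|a| `^ p).
Proof.
have [K K0 H] := g1M_growth.
exists (3 * K); first by rewrite mulr_ge0.
move=> a; have := V_sq_le 0 a; rewrite V0 !subr0 => /le_trans; apply.
rewrite mulrBl; apply: le_trans (ler_norm _) (le_trans (ler_normB _ _) _).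
apply: (le_trans (lerD (H a a) (H 0 a))).
rewrite normr0 powR0 ?gt_eqF ?ltr_wpDl//.
have := mulr_ge0 K0 (powR_ge0 `|a| p); lra.
Qed.

(** An upper expansion is enough for the first variation: convexity bounds the increment by the
    slope at the far end, and the bound on g'' returns to the slope at [a]. *)
Lemma g_taylor : exists2 K, 0 <= K & forall a b e, 0 <= e <= 1 ->
  g (a + e * b) - g a <= e * (g1 a * b) + e ^+ 2 * (K * (1 + `|a| `^ p + `|b| `^ p)).
Proof.
have p0 : 0 <= p by rewrite addr_ge0.
pose k : R := 2 `^ p; have k0 : 0 <= k by exact: powR_ge0.
(* The factor [k] comes from |a + b|^p, the 3 from one copy of |b|^p in each of the three terms of
   the bound on g''. *)
exists (C * (k + 3)); first by rewrite mulr_ge0 ?addr_ge0.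
move=> a b e /andP[e0 e1].
apply: (le_trans (g_convex a (a + e * b))).
have -> : a + e * b - a = e * b by ring.
rewrite -(subrK (g1 a) (g1 (a + e * b))) mulrDl addrC.
rewrite [e * (g1 a * b)]mulrCA lerD//.
(* The point a + e b lies between a and a + b, so this bound on g'' does not depend on [e]. *)
pose M := C * (`|a| `^ q + `|a + b| `^ q + 1).
have := @g1_mul_le a (a + e * b) M.
have -> : a + e * b - a = e * b by ring.
move=> H; apply: (le_trans (H _)) => [t tab|].
  apply: g2_max; apply: (le_trans tab); rewrite ge_max le_max lexx/=.
  have -> : a + e * b = (1 - e) * a + e * (a + b) by ring.
  rewrite (le_trans (ler_normD _ _))// !normrM.
  rewrite (ger0_norm e0) [`|1 - e|]ger0_norm ?subr_ge0//.
  have m1 : `|a| <= Num.max `|a| `|a + b| by rewrite le_max lexx.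
  have m2 : `|a + b| <= Num.max `|a| `|a + b| by rewrite le_max lexx orbT.
  set m := Num.max _ _ in m1 m2 *.
  have e1' : 0 <= 1 - e by rewrite subr_ge0.
  have := ler_wpM2l e1' m1; have := ler_wpM2l e0 m2; lra.
rewrite exprMn mulrCA ler_wpM2l ?sqr_ge0// /M -!mulrA ler_wpM2l//.
rewrite !mulrDl !mul1r.
have h1 := powR_mul_sqr_le a b; have h2 := powR_mul_sqr_le (a + b) b.
have h3 := sqr_le_powR b; have h4 := @powR_sum_le a b p p0.
rewrite -/k mulrDr in h4.
have := powR_ge0 `|a| p; have := powR_ge0 `|b| p.
lra.
Qed.

(** The pointwise Caccioppoli inequality, with [z] the cutoff, [zi] its derivative and [d] the
    increment of u. The diagonal part is at least z^2 (V b - V a)^2; half of it absorbs the cross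
    term through 2 X Y <= X^2 / 2 + 2 Y^2, with X = |z (V b - V a)| and Y = sqrt(S) |zi d|. *)
Lemma key_pointwise a b z zi d :
  2^-1 * z ^+ 2 * (V b - V a) ^+ 2 - 2 * zi ^+ 2 * d ^+ 2 * (C * (`|a| `^ q + `|b| `^ q + 1))
    <= (g1 b - g1 a) * (z ^+ 2 * (b - a) + 2 * z * zi * d).
Proof.
set S := C * _; have h1 := V_sq_le a b.
have h2 : (g1 b - g1 a) ^+ 2 <= S * (V b - V a) ^+ 2.
  by apply: g1_sq_le => t; exact: g2_max.
have S0 : 0 <= S by rewrite mulr_ge0// !addr_ge0 ?powR_ge0.
set G := g1 b - g1 a in h1 h2 *; set D := V b - V a in h1 h2 *.
have z2 := sqr_ge0 z.
have := ler_wpM2l z2 h1.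
suff : - (2^-1 * z ^+ 2 * D ^+ 2 + 2 * zi ^+ 2 * d ^+ 2 * S) <= 2 * z * zi * d * G.
  by lra.
pose s := Num.sqrt S; have sS : s ^+ 2 = S by rewrite sqr_sqrtr.
have Gs : `|G| <= s * `|D|.
  rewrite -(ler_pXn2r (_ : (0 < 2)%N)) ?nnegrE ?mulr_ge0 ?sqrtr_ge0//.
  by rewrite exprMn sS !real_normK ?num_real.
have : `|2 * z * zi * d * G| <= 2 * `|z * D| * (s * `|zi * d|).
  rewrite !normrM (ger0_norm (_ : 0 <= (2 : R)))//.
  apply: (le_trans (ler_wpM2l _ Gs)); first by rewrite !mulr_ge0.
  by rewrite le_eqVlt; apply/orP; left; apply/eqP; ring.
move=> /ler_normlP[+ _]; rewrite lerNl; apply: le_trans; rewrite lerN2.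
rewrite -sS; have := sqr_ge0 (`|z * D| - 2 * (s * `|zi * d|)).
have -> : 2^-1 * z ^+ 2 * D ^+ 2 = 2^-1 * `|z * D| ^+ 2.
  by rewrite real_normK ?num_real//; ring.
have -> : 2 * zi ^+ 2 * d ^+ 2 * s ^+ 2 = 2 * (s * `|zi * d|) ^+ 2.
  by rewrite exprMn real_normK ?num_real//; ring.
set X := `|z * D|; set Y := s * _; rewrite sqrrB -mulr_natr [(2 * Y) ^+ 2]exprMn.
lra.
Qed.

(** Used with [t * e] equal to |D u| and [t] = |h|^(t_j), so that the whole power of |h| stands in
    front. Each of the three terms on the left yields one copy of |e|^p. *)
Lemma young_scaled a b e t :
  (t * e) ^+ 2 * (C * (`|a| `^ q + `|b| `^ q + 1)) <=
  t ^+ 2 * (C * (1 + `|a| `^ p + `|b| `^ p + 3 * `|e| `^ p)).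
Proof.
rewrite exprMn -mulrA ler_wpM2l ?sqr_ge0// mulrCA ler_wpM2l// mulrC !mulrDl mul1r.
have h1 := powR_mul_sqr_le a e; have h2 := powR_mul_sqr_le b e.
have h3 := sqr_le_powR e; lra.
Qed.

End one_dim.

(** * The Euler-Lagrange inequality *)

Section EL.
Context {R : realType} {n : nat}.
Local Notation X := 'rV[R]_n.
Local Notation leb := (@lebm R n).
Implicit Types (c x y h : X) (r s S e : R) (u v w f phi U W : X -> R) (i j : 'I_n) (E Om : set X).

(** Truncating [f] between -|g| and |g| gives a function bounded everywhere and equal to [f] almost
    everywhere. *)
Lemma L1_le_ae (g f : X -> R) : measurable_fun setT f -> L1 leb g ->
  {ae leb, forall x, `|f x| <= g x} -> L1 leb f.
Proof.
move=> mf Lg fg; have mg := L1_meas Lg.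
apply: (@L1_ae_eq _ _ _ _ (fun x => Num.max (- `|g x|) (Num.min (f x) `|g x|))) => //.
  apply: (@L1_le _ _ _ _ (fun x => `|g x|)); last 1 first.
  - move=> x; rewrite ler_norml le_max lexx/= ge_max ge_min lexx orbT andbT.
    by rewrite (@le_trans _ _ 0) ?oppr_le0.
  - apply: measurable_maxr; last by apply: measurable_minr => //; exact: measurableT_comp.
    by apply: measurableT_comp => //; exact: measurableT_comp.
  - exact: L1_abs.
apply: filterS fg => x fg; have := le_trans fg (ler_norm _).
by rewrite ler_norml => /andP[? ?]; rewrite (min_idPl _)// (max_idPr _).
Qed.

Lemma int_patch E (h k : X -> R) : measurable E -> measurable_fun setT (h \_ E) -> L1 leb (k \_ E) ->
  {ae leb, forall x, E x -> h x = k x :> R} ->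
  (\int[lebesgue_rV n]_(x in E) (h x)%:E = (Int leb (k \_ E))%:E)%E.
Proof.
move=> mE mh Lk hk; rewrite -L1_EFin//.
have pE (l : X -> R) : (EFin \o l) \_ E = EFin \o (l \_ E).
  by apply/funext => x; rewrite /patch/=; case: ifP.
rewrite [LHS]integral_mkcond -[fun x => (h x)%:E]/(EFin \o h) pE; apply: (@ae_eq_integral _ _ _ leb) => //.
- exact/measurable_EFinP.
- by apply/measurable_EFinP; exact: L1_meas Lk.
- apply: filterS hk => x hk _ /=; rewrite /patch; case: ifPn => // xE.
  by rewrite hk//; move: xE; rewrite inE.
Qed.

Lemma measurable_comp_patch (g : R -> R) E w : measurable E -> continuous g ->
  measurable_fun setT (w \_ E) -> measurable_fun setT ((fun x => g (w x)) \_ E).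
Proof.
move=> mE cg mw.
have -> : ((fun x => g (w x)) \_ E) = fun x => \1_E x * g ((w \_ E) x).
  apply/funext => x; rewrite /patch indicE; case: ifP; by rewrite ?mul1r ?mul0r.
apply: measurable_funM; first exact: measurable_indic.
by apply: measurableT_comp => //; exact: continuous_measurable_fun.
Qed.

Lemma patchD E u v : (fun x => u x + v x) \_ E = fun x => (u \_ E) x + (v \_ E) x.
Proof. by apply/funext => x; rewrite /patch; case: ifP; rewrite ?addr0. Qed.

Lemma weakD Om c S i u w U W : is_weak_partial Om i u w -> Qc c S `<=` Om -> weak_pair i U W ->
  is_weak_partial (Q c S) i (fun x => u x + U x) (fun x => w x + W x).
Proof.
move=> Hu QOm HU; have [LU LW IU] := HU.
have Hu' : is_weak_partial (Q c S) i u w.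
  by apply: weak_restrict Hu; apply: subset_trans QOm; exact: Q_Qc.
have [lu lw Iu] := Hu; have [lu' lw' Iu'] := Hu'.
have mE E' : compactly_inside E' (Q c S) -> measurable E'.
  by move=> [oE _ _]; exact: open_measurable_rV.
have Q1 := (Lp_space1P _ _).1 (lu _ (compactly_inside_Q QOm)).
have Q2 := (Lp_space1P _ _).1 (lw _ (compactly_inside_Q QOm)).
split.
- move=> E' cE'; apply/Lp_space1P; rewrite patchD; apply: L1D.
    exact/Lp_space1P/lu'.
  by apply: L1_patch => //; exact: mE.
- move=> E' cE'; apply/Lp_space1P; rewrite patchD; apply: L1D.
    exact/Lp_space1P/lw'.
  by apply: L1_patch => //; exact: mE.
move=> phi tphi; have Tp := test_Ccinf tphi.
have p0 := test_function0 tphi; have dp0 := test_function_partial0 i tphi.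
have := Iu' _ tphi.
rewrite !(@Rint_supp _ _ (Q c S) (Q c S))//.
- rewrite (patch_supp _ p0) (patch_supp _ dp0) => Iu0.
  have -> : (fun x => (u x + U x) * partial i phi x) =
     fun x => partial i phi x * (u \_ (Q c S)) x + partial i phi x * U x.
    apply/funext => x; rewrite -(congr1 (@^~ x) (patch_supp u dp0))/=; ring.
  have -> : (fun x => (w x + W x) * phi x) =
     fun x => phi x * (w \_ (Q c S)) x + phi x * W x.
    apply/funext => x; rewrite -(congr1 (@^~ x) (patch_supp w p0))/=; ring.
  rewrite !IntD ?Iu0 ?IU ?opprD//; apply: Ccinf_L1M => //; exact: Ccinf_partial.
- by move=> x /p0 ->; rewrite mulr0.
- by move=> x /dp0 ->; rewrite mulr0.
- by move=> x /p0 ->; rewrite mulr0.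
- by move=> x /dp0 ->; rewrite mulr0.
Qed.

Lemma weak_pairZ i a U W : weak_pair i U W -> weak_pair i (fun x => a * U x) (fun x => a * W x).
Proof.
move=> [LU LW H]; split; [exact: L1Z|exact: L1Z|] => phi Tp.
have -> : (fun x => partial i phi x * (a * U x)) = fun x => a * (partial i phi x * U x).
  by apply/funext => x; rewrite mulrCA.
have -> : (fun x => phi x * (a * W x)) = fun x => a * (phi x * W x).
  by apply/funext => x; rewrite mulrCA.
rewrite !IntZ ?H ?mulrN//; first exact: Ccinf_L1M.
by apply: Ccinf_L1M => //; exact: Ccinf_partial.
Qed.

Lemma quad_ge0 (a b : R) : (forall e, 0 < e <= 1 -> 0 <= e * a + e ^+ 2 * b) -> 0 <= a.
Proof.
move=> H; rewrite leNgt; apply/negP => a0.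
have b0 : 0 < `|b| + 1 by rewrite ltr_wpDl.
(* This choice makes [e * b] at most half of [- a], so the sum would be negative. *)
pose e := Num.min 1 (- a / (2 * (`|b| + 1))).
have e0 : 0 < e by rewrite lt_min ltr01 divr_gt0 ?oppr_gt0// mulr_gt0.
have e1 : e <= 1 by rewrite ge_min lexx.
have := H e; rewrite e0 e1 => /(_ isT).
have e2 : e * (2 * (`|b| + 1)) <= - a.
  by rewrite -ler_pdivlMr ?mulr_gt0// ge_min lexx orbT.
rewrite expr2 -mulrA -mulrDr pmulr_rge0//.
have : e * b <= e * (`|b| + 1).
  by rewrite ler_wpM2l ?(ltW e0)// (le_trans (ler_norm _))// lerDl.
have : 0 < e * (`|b| + 1) by rewrite mulr_gt0.
lra.
Qed.

Lemma L1_powD (p : R) (f h : X -> R) : 0 <= p -> measurable_fun setT f -> measurable_fun setT h ->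
  L1 leb (fun x => `|f x| `^ p) -> L1 leb (fun x => `|h x| `^ p) ->
  L1 leb (fun x => `|f x + h x| `^ p).
Proof.
move=> p0 mf mh Lf Lh.
apply: (@L1_le _ _ _ _ (fun x => 2 `^ p * (`|f x| `^ p + `|h x| `^ p))); last 1 first.
- by move=> x; rewrite ger0_norm ?powR_ge0// powR_sum_le.
- apply: (measurableT_comp (measurable_powR p)).
  apply: measurableT_comp => //; exact: measurable_funD.
- by apply: L1Z; exact: L1D.
Qed.

Section growth.
Context (g : R -> R) (C q : R).
Hypotheses (gC2 : C2 g) (q0 : 0 <= q) (C0 : 0 <= C).
Hypothesis g20 : forall s, 0 <= derive1n 2 g s.
Hypothesis g2C : forall s, derive1n 2 g s <= C * (`|s| `^ q + 1).
Local Notation g1 := (derive1n 1 g).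
Local Notation p := (q + 2).

Lemma cont_g : continuous g.
Proof. exact/derive_continuous/(dg gC2). Qed.

Lemma cont_g1 : continuous g1.
Proof. exact/derive_continuous/(dg1 gC2). Qed.

Lemma L1_growth E (f h : X -> R) : measurable E -> (leb E < +oo)%E ->
  L1 leb (fun x => `|f x| `^ p) -> L1 leb (fun x => `|h x| `^ p) ->
  L1 leb (fun x => \1_E x + `|f x| `^ p + `|h x| `^ p).
Proof. by move=> mE fE Lf Lh; apply: L1D => //; apply: L1D => //; exact: L1_indic. Qed.

Lemma L1_g1M E (f h : X -> R) : measurable E -> (leb E < +oo)%E ->
  measurable_fun setT f -> measurable_fun setT h -> (forall x, ~ E x -> h x = 0) ->
  L1 leb (fun x => `|f x| `^ p) -> L1 leb (fun x => `|h x| `^ p) ->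
  L1 leb (fun x => g1 (f x) * h x).
Proof.
move=> mE fE mf mh h0 Lf Lh; have [K K0 HK] := g1M_growth gC2 q0 C0 g20 g2C.
apply: (L1_le _ (L1Z K (L1_growth mE fE Lf Lh))).
  apply: measurable_funM => //; apply: measurableT_comp => //.
  apply: continuous_measurable_fun; exact: cont_g1.
move=> x; rewrite indicE; case: (boolP (x \in E)) => [_|]; first exact: HK.
by rewrite notin_setE => /h0 ->; rewrite mulr0 normr0 mulr_ge0// !addr_ge0 ?powR_ge0.
Qed.

Lemma L1_g_patch E f : (forall s, 0 <= g s) -> measurable E -> (leb E < +oo)%E ->
  measurable_fun setT f -> L1 leb (fun x => `|f x| `^ p) ->
  L1 leb ((fun x => g (f x)) \_ E).
Proof.
move=> g0 mE fE mf Lf; have [K K0 HK] := g_growth gC2 q0 C0 g20 g2C g0.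
apply: (L1_le _ (L1Z K (L1D (L1_indic mE fE) Lf))).
  apply: measurable_comp_patch => //; first exact: cont_g.
  by apply/measurable_restrict => //; rewrite setTI; exact: measurable_funS mf.
move=> x; rewrite indicE /patch; case: (boolP (x \in E)) => _; first exact: HK.
by rewrite normr0 mulr_ge0// add0r powR_ge0.
Qed.

(** The remainder constant [B] is fixed before [e], as the passage to the limit in [quad_ge0]
    requires. *)
Lemma Int_taylor E (f h : X -> R) : (forall s, 0 <= g s) -> measurable E -> (leb E < +oo)%E ->
  measurable_fun setT f -> measurable_fun setT h -> (forall x, ~ E x -> h x = 0) ->
  L1 leb (fun x => `|f x| `^ p) -> L1 leb (fun x => `|h x| `^ p) ->
  exists B, forall e, 0 < e <= 1 ->
    L1 leb ((fun x => g (f x + e * h x)) \_ E) /\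
    Int leb ((fun x => g (f x + e * h x)) \_ E) - Int leb ((fun x => g (f x)) \_ E) <=
    e * Int leb (fun x => g1 (f x) * h x) + e ^+ 2 * B.
Proof.
move=> g0 mE fE mf mh h0 Lf Lh; have [K K0 HK] := g_taylor gC2 q0 C0 g20 g2C.
have p0 : 0 <= p by rewrite addr_ge0.
have LG := L1Z K (L1_growth mE fE Lf Lh).
exists (Int leb (fun x => K * (\1_E x + `|f x| `^ p + `|h x| `^ p))) => e /andP[e0 e1].
have meh : measurable_fun setT (fun x => e * h x) by exact: measurable_funM.
have Lgh : L1 leb ((fun x => g (f x + e * h x)) \_ E).
  apply: L1_g_patch => //; first exact: measurable_funD.
  apply: L1_powD => //; apply: (L1_le _ Lh) => [|x].
    apply: (measurableT_comp (measurable_powR p)); exact: measurableT_comp.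
  rewrite ger0_norm ?powR_ge0// ge0_ler_powR ?nnegrE// normrM ler_piMl//.
  by rewrite ger0_norm// ltW.
split => //.
have Lg := L1_g_patch g0 mE fE mf Lf.
have Lgm := L1_g1M mE fE mf mh h0 Lf Lh.
rewrite -IntB// -!IntZ// -IntD; [|exact: L1Z|exact: L1Z].
apply: Int_le; [exact: L1B|by apply: L1D; apply: L1Z|move=> x].
rewrite /patch indicE; case: (boolP (x \in E)) => [_|].
  by apply: HK; rewrite ltW.
rewrite notin_setE => nE; rewrite h0// subr0 !mulr0 add0r.
by apply: mulr_ge0; [exact: sqr_ge0|rewrite mulr_ge0// !addr_ge0 ?powR_ge0].
Qed.

End growth.

Lemma patchM E u v : (fun x => u x * v x) \_ E = fun x => (u \_ E) x * (v \_ E) x.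
Proof. by apply/funext => x; rewrite /patch; case: ifP => //; rewrite mul0r. Qed.

Lemma L1_mul_ae_bounded (f h : X -> R) (B : R) : L1 leb f -> measurable_fun setT h ->
  {ae leb, forall x, `|h x| <= B} -> L1 leb (fun x => f x * h x).
Proof.
move=> Lf mh hB; apply: (@L1_le_ae (fun x => B * `|f x|)).
- apply: measurable_funM => //; exact: L1_meas Lf.
- by apply: L1Z; exact: L1_abs.
- by apply: filterS hB => x hB; rewrite normrM mulrC ler_wpM2r.
Qed.

Section euler_lagrange.
Context (p : 'I_n -> R) (g : 'I_n -> R -> R) (C : R).
Hypotheses (p2 : forall i, 2 <= p i) (g0 : forall i s, 0 <= g i s).
Hypotheses (gC2 : forall i, C2 (g i)) (C0 : 0 <= C).
Hypothesis g20 : forall i s, 0 <= derive1n 2 (g i) s.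
Hypothesis g2C : forall i s, derive1n 2 (g i) s <= C * (`|s| `^ (p i - 2) + 1).

(** Compare [u] with u + e phi: the gain is at most e times the first variation plus O(e^2).
    Boundedness of [phi] makes [f * phi] integrable, [f] entering only through its L^1 norm. *)
Lemma EL_ineq f Om u c s S phi (W : 'I_n -> X -> R) (B M : R) :
  s < S -> Qc c S `<=` Om -> local_minimizer p g f Om u -> L1 leb (f \_ (Q c S)) ->
  L1 leb (u \_ (Q c S)) -> L1 leb phi ->
  {ae leb, forall x, `|(u \_ (Q c S)) x| <= M} ->
  (forall i, weak_pair i phi (W i)) -> (forall x, ~ Qc c s x -> phi x = 0) ->
  (forall i x, ~ Qc c s x -> W i x = 0) -> {ae leb, forall x, `|phi x| <= B} ->
  (forall i, L1 leb (fun x => `|W i x| `^ p i)) ->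
  0 <= \sum_(i < n) Int leb (fun x => derive1n 1 (g i) ((wpartial Om i u \_ (Q c S)) x) * W i x) +
    Int leb (fun x => (f \_ (Q c S)) x * phi x).
Proof.
move=> sS QOm [[wdu Lpw] umin] Lf Lu Lphi uM wphi phi0 W0 phiB LW.
set E := Q c S; have mE : measurable E by exact: measurable_Q.
have fE : (leb E < +oo)%E by exact: leb_Q.
have cE : compactly_inside E Om by exact: compactly_inside_Q.
have q0 i : 0 <= p i - 2 by rewrite subr_ge0.
have pE i : p i - 2 + 2 = p i by rewrite subrK.
have nE x : ~ E x -> ~ Qc c s x by move=> nE Qx; apply: nE; exact: Qc_Q Qx.
pose w i := wpartial Om i u \_ E.
have [mw Lw] : (forall i, measurable_fun setT (w i)) /\
    forall i, L1 leb (fun x => `|w i x| `^ p i).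
  by split => i; have /Lp_spaceP[|//] := Lpw i _ cE; apply: le_trans (p2 i); rewrite ler1n.
have mW i : measurable_fun setT (W i) by have [_ /L1_meas] := wphi i.
have WE i x : ~ E x -> W i x = 0 by move=> /nE; exact: W0.
have /choice[BT HT] i : exists BT, forall e, 0 < e <= 1 ->
    L1 leb ((fun x => g i (w i x + e * W i x)) \_ E) /\
    Int leb ((fun x => g i (w i x + e * W i x)) \_ E) - Int leb ((fun x => g i (w i x)) \_ E) <=
    e * Int leb (fun x => derive1n 1 (g i) (w i x) * W i x) + e ^+ 2 * BT.
  apply: (@Int_taylor (g i) C (p i - 2)) => //; rewrite ?pE//; exact: WE.
apply: (@quad_ge0 _ (\sum_i BT i)) => e e01; have [e0 e1] := andP e01.
pose v x := u x + e * phi x.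
have ve : v \- u = fun x => e * phi x by apply/funext => x /=; rewrite /v addrAC subrr add0r.
have H : (functional g f u E <= functional g f v E)%E.
  apply: umin => //; rewrite ve; apply: (@W1p_0_intro _ _ p c s S _ (fun i x => e * W i x)) => //.
  - by move=> i; rewrite (le_trans _ (p2 i))// ler1n.
  - by move=> i; exact: weak_pairZ.
  - by move=> x /phi0 ->; rewrite mulr0.
  - move=> i; apply: (L1_le _ (LW i)) => [|x].
      apply: (measurableT_comp (measurable_powR (p i))); apply: measurableT_comp => //.
      exact: measurable_funM.
    rewrite ger0_norm ?powR_ge0// ge0_ler_powR ?nnegrE ?(le_trans _ (p2 i))//.
    by rewrite normrM ger0_norm ?(ltW e0)// ler_piMl.
  - exact: L1Z.
(* [wpartial] is chosen separately for each set and each function; uniqueness of weak derivatives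
   relates the choices on the cube only almost everywhere. *)
have wE i : {ae leb, forall x, E x -> wpartial E i u x = w i x}.
  have Hu := wpartialP i wdu.
  have Hu' : is_weak_partial E i u (wpartial Om i u).
    by apply: weak_restrict Hu; apply: subset_trans QOm; exact: Q_Qc.
  have := weak_unique_Q (xgetPex (cst 0) (ex_intro _ _ Hu')) Hu'.
  apply: filterS => x + Ex => /(_ Ex); rewrite -/(wpartial E i u) => ->.
  by rewrite /w patchE mem_set.
have Hv i : is_weak_partial E i v (fun x => wpartial Om i u x + e * W i x).
  exact: (weakD (wpartialP i wdu) QOm (weak_pairZ e (wphi i))).
have Hv' i : is_weak_partial E i v (wpartial E i v).
  exact: (xgetPex (cst 0) (ex_intro _ _ (Hv i))).
have vE i : {ae leb, forall x, E x -> wpartial E i v x = w i x + e * W i x}.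
  have := weak_unique_Q (Hv' i) (Hv i); apply: filterS => x + Ex => /(_ Ex) ->.
  by rewrite /w patchE mem_set.
have Hu' i : is_weak_partial E i u (wpartial E i u).
  apply: (xgetPex (cst 0) (ex_intro _ (wpartial Om i u) _)).
  apply: weak_restrict (wpartialP i wdu); apply: subset_trans QOm; exact: Q_Qc.
have mg i (z : X -> R) : is_weak_partial E i z (wpartial E i z) ->
    measurable_fun setT ((fun x => g i (wpartial E i z x)) \_ E).
  move=> [_ Lz _]; apply: measurable_comp_patch => //; first exact: cont_g.
  exact: Lp_loc_measQ Lz.
have Lg i : L1 leb ((fun x => g i (w i x)) \_ E).
  by apply: (@L1_g_patch (g i) C (p i - 2)) => //; rewrite pE.
have Iu i : (\int[lebesgue_rV n]_(x in E) (g i (wpartial E i u x))%:E =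
    (Int leb ((fun x => g i (w i x)) \_ E))%:E)%E.
  apply: int_patch => //; first exact: mg.
  by apply: filterS (wE i) => x + Ex => /(_ Ex) ->.
have Iv i : (\int[lebesgue_rV n]_(x in E) (g i (wpartial E i v x))%:E =
    (Int leb ((fun x => g i (w i x + e * W i x)) \_ E))%:E)%E.
  apply: int_patch => //; [exact: mg|exact: (HT i e e01).1|].
  by apply: filterS (vE i) => x + Ex => /(_ Ex) ->.
have mu : measurable_fun setT (u \_ E) by exact: L1_meas Lu.
have Lfu : L1 leb ((fun x => f x * u x) \_ E).
  by rewrite patchM; exact: L1_mul_ae_bounded uM.
have Lfp : L1 leb (fun x => (f \_ E) x * phi x).
  apply: L1_mul_ae_bounded phiB => //; exact: L1_meas Lphi.
have fv : (fun x => f x * v x) \_ E =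
    fun x => ((fun x => f x * u x) \_ E) x + e * ((f \_ E) x * phi x).
  apply/funext => x; rewrite /patch /v; case: ifPn => _; first by ring.
  by rewrite mul0r mulr0 addr0.
have Lfv : L1 leb ((fun x => f x * v x) \_ E).
  by rewrite fv; apply: L1D => //; exact: L1Z.
have If (z : X -> R) : L1 leb ((fun x => f x * z x) \_ E) ->
    (\int[lebesgue_rV n]_(x in E) (f x * z x)%:E =
    (Int leb ((fun x => f x * z x) \_ E))%:E)%E.
  by move=> Lz; apply: int_patch => //; [exact: L1_meas Lz|exact: aeW].
move: H; rewrite /functional !If//.
rewrite (eq_bigr _ (fun i _ => Iu i)) (eq_bigr _ (fun i _ => Iv i)).
rewrite !sumEFin -!EFinD lee_fin fv IntD//; last exact: L1Z.
rewrite IntZ// => H.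
have {}HT : \sum_i Int leb ((fun x => g i (w i x + e * W i x)) \_ E) <=
   \sum_i Int leb ((fun x => g i (w i x)) \_ E) +
   (e * \sum_i Int leb (fun x => derive1n 1 (g i) (w i x) * W i x) + e ^+ 2 * \sum_i BT i).
  rewrite !mulr_sumr -!big_split/=; apply: ler_sum => i _.
  by have := (HT i e e01).2; rewrite lerBlDl.
by rewrite mulrDr; lra.
Qed.
End euler_lagrange.
End EL.

(** * Stability of L^p under the operations used *)

Section lp.
Context {R : realType} {n : nat}.
Local Notation X := 'rV[R]_n.
Local Notation leb := (@lebm R n).
Implicit Types (a c x y : X) (r s S p : R) (b g u v w f phi U W : X -> R) (i j : 'I_n) (E Om : set X).

Lemma ae_shift a (P : X -> Prop) : {ae leb, forall x, P x} -> {ae leb, forall x, P (x + a)}.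
Proof.
move=> [A [mA A0 sA]]; exists ((fun x => x + a) @^-1` A); split.
- by rewrite -[X in measurable X]setTI; exact: measurable_shift.
- by rewrite leb_shift.
- by move=> x /= nP; apply: sA.
Qed.

Definition Lp p f := measurable_fun setT f /\ L1 leb (fun x => `|f x| `^ p).

Lemma LpD p f g : 0 <= p -> Lp p f -> Lp p g -> Lp p (fun x => f x + g x).
Proof.
move=> p0 [mf Lf] [mg Lg]; split; first exact: measurable_funD.
exact: L1_powD.
Qed.

Lemma measurable_norm_powR p f : measurable_fun setT f ->
  measurable_fun setT (fun x => `|f x| `^ p).
Proof.
move=> mf; apply: (measurableT_comp (measurable_powR p)); exact: measurableT_comp.
Qed.

Lemma LpN p f : Lp p f -> Lp p (fun x => - f x).
Proof.
move=> [mf Lf]; split; first exact: measurableT_comp.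
by under [fun x => _]eq_fun do rewrite normrN.
Qed.

Lemma LpB p f g : 0 <= p -> Lp p f -> Lp p g -> Lp p (fun x => f x - g x).
Proof. by move=> p0 Lf /LpN; exact: LpD. Qed.

Lemma Lp_bmul p (k : R) b f : 0 <= p -> measurable_fun setT b -> (forall x, `|b x| <= k) ->
  Lp p f -> Lp p (fun x => b x * f x).
Proof.
move=> p0 mb bk [mf Lf]; split; first exact: measurable_funM.
apply: (L1_le _ (L1Z (`|k| `^ p) Lf)) => [|x].
  apply: measurable_norm_powR; exact: measurable_funM.
rewrite ger0_norm ?powR_ge0// normrM powRM//; apply: ler_wpM2r; first exact: powR_ge0.
by rewrite ge0_ler_powR ?nnegrE// (le_trans (bk x))// ler_norm.
Qed.

Lemma Lp_shift p f a : Lp p f -> Lp p (fun x => f (x + a)).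
Proof.
move=> [mf Lf]; split; last exact: (L1_shift a Lf).
by apply: measurableT_comp => //; exact: measurable_shift.
Qed.

Lemma Lp_bounded p E f M : 0 < p -> measurable E -> (leb E < +oo)%E -> measurable_fun setT f ->
  (forall x, ~ E x -> f x = 0) -> {ae leb, forall x, `|f x| <= M} -> Lp p f.
Proof.
move=> p0 mE fE mf f0 fM; split => //.
apply: (L1_le_ae _ (L1Z (`|M| `^ p) (L1_indic mE fE))).
  exact: measurable_norm_powR.
apply: filterS fM => x fM; rewrite ger0_norm ?powR_ge0// indicE.
case: (boolP (x \in E)) => [_|].
  rewrite mulr1 ge0_ler_powR ?nnegrE ?(ltW p0)//; exact: le_trans (ler_norm _).
by rewrite notin_setE => /f0 ->; rewrite normr0 powR0 ?gt_eqF// mulr0.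
Qed.

End lp.

(** * Scaling inequalities for increments *)

Section scaled.
Context {R : realType}.

(* Exchanging the exponents [pj] and [pN] in [d `^ pN <= M `^ (pN - pj) * d `^ pj] costs only
   the bound [M] for [d]; this lowers the order of smoothness from [1] to [t = pj / pN]. *)
Lemma scaled_bound (d h pi pj pN t M P : R) : 0 < h -> h <= 1 -> 0 <= d -> d <= M -> 1 <= M ->
  0 <= pi -> pi <= pN -> 0 <= pj -> pj <= pN -> t * pN = pj ->
  0 <= P -> d `^ pj <= h `^ pj * P -> (d / h `^ t) `^ pi <= M `^ pN * (1 + P).
Proof.
move=> h0 h1 d0 dM M1 pi0 piN pj0 pjN tpN P0 dP.
have ht : 0 < h `^ t by rewrite powR_gt0.
have y0 : 0 <= d / h `^ t by rewrite divr_ge0 ?powR_ge0.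
have M0 : 0 <= M by rewrite (le_trans _ M1).
have pN0 : 0 <= pN by exact: le_trans pjN.
have MN : 1 <= M `^ pN.
  have -> : 1 = 1 `^ pN :> R by rewrite powR1.
  by rewrite ge0_ler_powR ?nnegrE.
have [y1|y1] := leP (d / h `^ t) 1.
  rewrite (@le_trans _ _ 1)//.
    have -> : 1 = 1 `^ pi :> R by rewrite powR1.
    by rewrite ge0_ler_powR ?nnegrE// powR1.
  by rewrite mulr_ege1// lerDl.
rewrite (@le_trans _ _ ((d / h `^ t) `^ pN))//.
  by apply: ler_powR => //; exact: ltW.
rewrite (@le_trans _ _ (M `^ pN * P))//; last first.
  by rewrite ler_wpM2l ?powR_ge0// lerDr.
have hj : 0 < h `^ pj by rewrite powR_gt0.
rewrite -(ler_pM2r hj) -{1}tpN powRrM -powRM ?powR_ge0// divfK ?gt_eqF//.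
have d00 : 0 < d.
  rewrite lt_neqAle d0 eq_sym andbT; apply/eqP => dz.
  by move: y1; rewrite dz mul0r ltNge ler01.
rewrite -{1}(subrK pj pN) powRD; last by rewrite (gt_eqF d00) implybT.
rewrite -mulrA; apply: ler_pM; rewrite ?powR_ge0//; last by rewrite mulrC.
rewrite (@le_trans _ _ (M `^ (pN - pj)))//.
  by rewrite ge0_ler_powR ?nnegrE// subr_ge0.
by apply: ler_powR => //; rewrite gerBl.
Qed.

(** Young's inequality for the quotients a/h and b/h; the weights 1/q and 1/p are at most 1 and are
    dropped. *)
Lemma young_quotient (a b h P Q p q : R) : 0 < h -> 1 < p -> q = p / (p - 1) ->
  0 <= a -> 0 <= b -> a `^ q <= h `^ q * P -> b `^ p <= h `^ p * Q ->
  a * b <= h ^+ 2 * (P + Q).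
Proof.
move=> h0 p1 qE a0 b0 aP bQ.
have p0 : 0 < p by exact: lt_trans p1.
have q0 : 0 < q by rewrite qE divr_gt0// subr_gt0.
have h0' : 0 <= h by exact: ltW.
have pq : q^-1 + p^-1 = 1.
  rewrite qE invf_div; field; rewrite gt_eqF//.
have quo (x P' r : R) : 0 <= x -> x `^ r <= h `^ r * P' -> (x / h) `^ r <= P'.
  move=> x0 xP; rewrite -(ler_pM2r (powR_gt0 r h0)) -powRM ?divr_ge0//.
  by rewrite divfK ?gt_eqF// mulrC.
have A := quo _ _ _ a0 aP; have B := quo _ _ _ b0 bQ.
have := conjugate_powR (divr_ge0 a0 h0') (divr_ge0 b0 h0') q0 p0 pq.
have inv1 (r : R) : 1 <= r -> r^-1 <= 1 by move=> r1; rewrite invf_le1// (lt_le_trans _ r1).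
have q1 : 1 <= q by rewrite qE ler_pdivlMr ?subr_gt0// mul1r gerBl.
have A' : (a / h) `^ q / q <= P.
  by apply: le_trans A; rewrite ler_piMr ?powR_ge0 ?inv1.
have B' : (b / h) `^ p / p <= Q.
  by apply: le_trans B; rewrite ler_piMr ?powR_ge0 ?inv1// ltW.
move=> H; have {}H : a / h * (b / h) <= P + Q by apply: (le_trans H); exact: lerD.
have := ler_wpM2l (sqr_ge0 h) H.
suff -> : h ^+ 2 * (a / h * (b / h)) = a * b by [].
field; rewrite gt_eqF//.
Qed.

(** Puts the source term, which is of order h^2, on the scale |h|^(2t) of the others. *)
Lemma sqr_le_powR_scale (h t : R) : 0 < h -> h <= 1 -> t <= 1 -> h ^+ 2 <= (h `^ t) ^+ 2.
Proof.
move=> h0 h1 t1; rewrite ler_pXn2r ?nnegrE ?powR_ge0 ?(ltW h0)//.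
rewrite -[X in X <= _](powRr1 (ltW h0)); by apply: ger_powR; rewrite ?h0.
Qed.
End scaled.

(** * The main estimate *)

Section main.
Context {R : realType} {n : nat}.
Local Notation X := 'rV[R]_n.
Local Notation leb := (@lebm R n).
Implicit Types (a c x y : X) (r s S d : R) (u v w f phi eta U W : X -> R) (i j : 'I_n) (E Om : set X).

Lemma Qc_shift c s d a x : (forall k, `|a ord0 k| <= d) -> Qc c s (x + a) -> Qc c (s + d) x.
Proof.
move=> ad Qx k; have := Qx k; have := ad k; rewrite mxE !ler_norml.
by move=> /andP[? ?] /andP[? ?]; apply/andP; split; lra.
Qed.

Lemma Qc_shiftN c s d a x : (forall k, `|a ord0 k| <= d) -> Qc c s x -> Qc c (s + d) (x + a).
Proof.
move=> ad Qx; apply: (@Qc_shift _ _ _ (- a)) => [k|]; first by rewrite mxE normrN.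
by rewrite addrK.
Qed.

Lemma partial_supp_Qc c s eta i x : (forall x, ~ Qc c s x -> eta x = 0) ->
  ~ Qc c s x -> partial i eta x = 0.
Proof. by move=> eta0; apply: partial_supp => //; exact: closed_Qc. Qed.

(** The product eta(x) u(x + a) is a shift of eta(. - a) u, whose cutoff is still supported inside
    the large cube. Both halves of the increment thus come from [weak_pair_cutoff]. *)
Lemma weak_pair_increment Om i u w c s d S eta a : is_weak_partial Om i u w -> Qc c S `<=` Om ->
  (forall k, C_k k eta) -> (forall x, ~ Qc c s x -> eta x = 0) ->
  0 <= d -> (forall k, `|a ord0 k| <= d) -> s + d < S ->
  weak_pair i (fun x => eta x * increment a (u \_ (Q c S)) x)
    (fun x => eta x * increment a (w \_ (Q c S)) x + partial i eta x * increment a (u \_ (Q c S)) x).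
Proof.
move=> Hu QOm Ceta eta0 d0 ad sdS.
have sS : s < S by lra.
have Ceta' k : C_k k (fun x => eta (x - a)) by exact: C_k_shift.
have eta0' x : ~ Qc c (s + d) x -> eta (x - a) = 0.
  move=> nQ; apply: eta0 => Qx; apply: nQ.
  by apply: (@Qc_shift _ _ _ (- a)) Qx => k; rewrite mxE normrN.
have H1 := weak_pair_cutoff Hu QOm Ceta eta0 sS.
have H2 := weak_pair_shift a (weak_pair_cutoff Hu QOm Ceta' eta0' sdS).
have deta0 x : ~ Qc c s x -> partial i eta x = 0 by exact: partial_supp_Qc.
have QE x : Qc c s x -> Q c S x /\ Q c S (x + a).
  move=> Qx; split; first exact: Qc_Q Qx.
  by apply: (Qc_Q sdS); exact: Qc_shiftN.
have := weak_pairB H2 H1; rewrite partial_shift.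
have -> : (fun x => eta (x + a - a) * u (x + a) - eta x * u x) =
    (fun x => eta x * increment a (u \_ (Q c S)) x).
  apply/funext => x; rewrite addrK /increment.
  have [/QE[Q1 Q2]|/eta0 ->] := pselect (Qc c s x); last by rewrite !mul0r subrr.
  by rewrite !patchE !mem_set// mulrBr.
set F := (F in weak_pair i _ F); set G := (G in _ -> weak_pair i _ G).
suff -> : F = G by [].
apply/funext => x; rewrite /F /G addrK /increment.
have [/QE[Q1 Q2]|nQ] := pselect (Qc c s x).
  by rewrite !patchE !mem_set//; ring.
by rewrite (eta0 _ nQ) (deta0 _ nQ) !mul0r subrr addr0.
Qed.

Context (p : 'I_n -> R) (g : 'I_n -> R -> R) (C : R).
Hypotheses (p2 : forall i, 2 <= p i) (g0 : forall i s, 0 <= g i s).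
Hypotheses (gC2 : forall i, C2 (g i)) (C0 : 0 <= C).
Hypothesis g20 : forall i s, 0 <= derive1n 2 (g i) s.
Hypothesis g2C : forall i s, derive1n 2 (g i) s <= C * (`|s| `^ (p i - 2) + 1).

Context (Om : set X) (f u : X -> R) (c : X) (S M : R).
Hypotheses (QOm : Qc c S `<=` Om) (umin : local_minimizer p g f Om u).
Let E := Q c S.
Let u0 := u \_ E.
Let f0 := f \_ E.
Let w i := wpartial Om i u \_ E.
Hypotheses (Lf : L1 leb f0) (Lu : L1 leb u0) (uM : {ae leb, forall x, `|u0 x| <= M}).
Hypothesis Lw : forall i, Lp (p i) (w i).

Let mE : measurable E. Proof. exact: measurable_Q. Qed.
Let fE : (leb E < +oo)%E. Proof. exact: leb_Q. Qed.
Let p0 i : 0 < p i. Proof. by rewrite (lt_le_trans _ (p2 i)). Qed.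
Let p0' i : 0 <= p i. Proof. exact: ltW. Qed.

Lemma increment_u_bound a : {ae leb, forall x, `|increment a u0 x| <= 2 * M}.
Proof.
have := ae_shift a uM; move: uM; apply: filterS2 => x H1 H2.
by rewrite /increment (le_trans (ler_normB _ _))//; lra.
Qed.

Lemma measurable_increment a v : measurable_fun setT v -> measurable_fun setT (increment a v).
Proof.
move=> mv; apply: measurable_funB => //.
by apply: measurableT_comp => //; exact: measurable_shift.
Qed.

Context (eta : X -> R) (s d : R) (a : X).
Hypotheses (Ceta : forall k, C_k k eta) (eta0 : forall x, ~ Qc c s x -> eta x = 0).
Hypotheses (d0 : 0 <= d) (ad : forall k, `|a ord0 k| <= d) (sdS : s + d < S).
Let phi x := eta x * increment a u0 x.
Let W i x := eta x * increment a (w i) x + partial i eta x * increment a u0 x.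

Let sS : s < S. Proof. by rewrite (le_lt_trans _ sdS)// lerDl. Qed.

Let deta0 i x : ~ Qc c s x -> partial i eta x = 0.
Proof. exact: partial_supp_Qc. Qed.

Let Teta : Ccinf eta.
Proof.
apply: test_Ccinf; apply: (test_function_Qc (Om := setT) Ceta eta0) => //.
Qed.

(** The term carrying the derivative of [eta] lies in L^(p_i) for every [i] because [u0] is bounded
    and the cutoff has bounded support. *)
Lemma Lp_W i : Lp (p i) (W i).
Proof.
have [B HB] := Ccinf_bounded Teta; have [B' HB'] := Ccinf_bounded (Ccinf_partial i Teta).
apply: LpD => //.
  apply: (Lp_bmul _ (Ccinf_meas Teta) HB) => //.
  by apply: LpB => //; exact: Lp_shift.
have mi : measurable_fun setT (increment a u0).
  by apply: measurable_increment; exact: L1_meas Lu.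
apply: (@Lp_bounded _ _ _ E _ (B' * (2 * M))) => //.
- by apply: measurable_funM => //; apply: Ccinf_meas; exact: Ccinf_partial.
- move=> x nE; rewrite deta0 ?mul0r// => Qx; apply: nE; exact: (Qc_Q sS).
- apply: filterS (increment_u_bound a) => x H; rewrite normrM.
  exact: ler_pM.
Qed.

Lemma phi_bound : exists B, {ae leb, forall x, `|phi x| <= B}.
Proof.
have [B HB] := Ccinf_bounded Teta; exists (B * (2 * M)).
by apply: filterS (increment_u_bound a) => x H; rewrite normrM; exact: ler_pM.
Qed.

Let q0 i : 0 <= p i - 2. Proof. by rewrite subr_ge0. Qed.
Let pE i : p i - 2 + 2 = p i. Proof. by rewrite subrK. Qed.

Lemma W_supp i x : ~ Qc c s x -> W i x = 0.
Proof. by move=> nQ; rewrite /W eta0// deta0// !mul0r addr0. Qed.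

Lemma L1_gW i v z : Lp (p i) v -> Lp (p i) z -> (forall x, ~ E x -> z x = 0) ->
  L1 leb (fun x => derive1n 1 (g i) (v x) * z x).
Proof.
move=> [mv Lv] [mz Lz] z0.
by apply: (L1_g1M (gC2 i) (q0 i) C0 (g20 i) (g2C i) mE) => //; rewrite pE.
Qed.

Lemma EL_increment :
  [/\ forall i, L1 leb (fun x => increment a (derive1n 1 (g i) \o w i) x * W i x),
   L1 leb (fun x => increment a f0 x * phi x) &
   \sum_(i < n) Int leb (fun x => increment a (derive1n 1 (g i) \o w i) x * W i x) +
   Int leb (fun x => increment a f0 x * phi x) <= 0].
Proof.
have QE x : ~ E x -> ~ Qc c (s + d) x.
  by move=> nE Qx; apply: nE; exact: (Qc_Q sdS).
have QE' x : ~ Qc c (s + d) x -> ~ Qc c s x.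
  by move=> nQ Qx; apply: nQ => k; rewrite (le_trans (Qx k))// lerDl.
have wu i := wpartialP i umin.1.1.
have Hphi i : weak_pair i phi (W i) by exact: (weak_pair_increment (wu i) QOm Ceta eta0 d0 ad sdS).
have LW := Lp_W; have [B HB] := phi_bound.
have Lphi : L1 leb phi.
  by apply: Ccinf_L1M => //; apply: L1B => //; exact: L1_shift.
have mphi := L1_meas Lphi.
pose W' i x := W i x - W i (x - a).
pose phi' x := phi x - phi (x - a).
have LWa i : Lp (p i) (fun x => W i (x - a)) by exact: Lp_shift.
have W0' i x : ~ Qc c (s + d) x -> W i (x - a) = 0.
  move=> nQ; apply: W_supp => Qx; apply: nQ.
  by apply: (@Qc_shift _ _ _ (- a)) Qx => k; rewrite mxE normrN.
have phi0' x : ~ Qc c (s + d) x -> phi (x - a) = 0.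
  move=> nQ; rewrite /phi eta0 ?mul0r// => Qx; apply: nQ.
  by apply: (@Qc_shift _ _ _ (- a)) Qx => k; rewrite mxE normrN.
have H : 0 <= \sum_(i < n) Int leb (fun x => derive1n 1 (g i) (w i x) * W' i x) +
    Int leb (fun x => f0 x * phi' x).
  apply: (@EL_ineq _ _ p g C p2 g0 gC2 C0 g20 g2C f Om u c (s + d) S phi' W' (B + B) M) => //.
  - by apply: L1B => //; exact: L1_shift.
  - by move=> i; apply: weak_pairB => //; exact: (weak_pair_shift (- a) (Hphi i)).
  - by move=> x nQ; rewrite /phi' phi0'// /phi eta0 ?mul0r ?subrr//; exact: QE'.
  - by move=> i x nQ; rewrite /W' W0'// W_supp ?subrr//; exact: QE'.
  - have := ae_shift (- a) HB; move: HB; apply: filterS2 => x H1 H2.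
    by rewrite (le_trans (ler_normB _ _))// lerD.
  - move=> i; have [] : Lp (p i) (W' i) by apply: LpB.
    by [].
have WE i x : ~ E x -> W i x = 0 by move=> /QE/QE'; exact: W_supp.
have Ls i : L1 leb (fun x => derive1n 1 (g i) (w i (x + a)) * W i x).
  exact: (L1_gW (Lp_shift a (Lw i)) (LW i) (WE i)).
have L0 i : L1 leb (fun x => derive1n 1 (g i) (w i x) * W i x) by exact: (L1_gW (Lw i) (LW i) (WE i)).
have La i : L1 leb (fun x => derive1n 1 (g i) (w i x) * W i (x - a)).
  by apply: (L1_gW (Lw i) (LWa i)) => x /QE; exact: W0'.
have Lf1 : L1 leb (fun x => f0 x * phi x).
  by apply: L1_mul_ae_bounded HB.
have Lf2 : L1 leb (fun x => f0 (x + a) * phi x).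
  by apply: L1_mul_ae_bounded HB => //; exact: L1_shift.
have Lf3 : L1 leb (fun x => f0 x * phi (x - a)).
  apply: (L1_mul_ae_bounded _ _ (ae_shift (- a) HB)) => //.
  by apply: measurableT_comp => //; exact: measurable_shift.
have iE i : (fun x => increment a (derive1n 1 (g i) \o w i) x * W i x) =
    fun x => derive1n 1 (g i) (w i (x + a)) * W i x - derive1n 1 (g i) (w i x) * W i x.
  by apply/funext => x; rewrite /increment/= mulrBl.
have fE1 : (fun x => increment a f0 x * phi x) = fun x => f0 (x + a) * phi x - f0 x * phi x.
  by apply/funext => x; rewrite /increment mulrBl.
split.
- by move=> i; rewrite iE; exact: L1B.
- by rewrite fE1; exact: L1B.
rewrite -oppr_ge0 opprD; apply: (le_trans H); rewrite -sumrN.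
rewrite le_eqVlt; apply/orP; left; apply/eqP; congr (_ + _).
  apply: eq_bigr => i _; rewrite iE IntB// opprB.
  have -> : (fun x => derive1n 1 (g i) (w i x) * W' i x) =
    fun x => derive1n 1 (g i) (w i x) * W i x - derive1n 1 (g i) (w i x) * W i (x - a).
    by apply/funext => x; rewrite /W' mulrBr.
  rewrite IntB//; congr (_ - _); rewrite -(Int_shift a (La i)).
  by congr (Int _ _); apply/funext => x; rewrite addrK.
rewrite fE1 IntB// opprB.
have -> : (fun x => f0 x * phi' x) = fun x => f0 x * phi x - f0 x * phi (x - a).
  by apply/funext => x; rewrite /phi' mulrBr.
rewrite IntB//; congr (_ - _); rewrite -(Int_shift a Lf3).
by congr (Int _ _); apply/funext => x; rewrite addrK.
Qed.

End main.

(** * The Caccioppoli estimate for increments of V *)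

Section estimate.
Context {R : realType} {n : nat}.
Local Notation X := 'rV[R]_n.
Local Notation leb := (@lebm R n).
Implicit Types (a c x y : X) (r s d h : R) (v zeta : X -> R) (i j : 'I_n) (E : set X).

Context (p : 'I_n -> R) (g : 'I_n -> R -> R) (C pN : R).
Hypotheses (p2 : forall i, 2 <= p i) (pN_max : forall i, p i <= pN).
Hypothesis g0 : forall i s, 0 <= g i s.
Hypotheses (gC2 : forall i, C2 (g i)) (C0 : 0 <= C).
Hypothesis g20 : forall i s, 0 <= derive1n 2 (g i) s.
Hypothesis g2C : forall i s, derive1n 2 (g i) s <= C * (`|s| `^ (p i - 2) + 1).

Let p0 i : 0 < p i. Proof. by rewrite (lt_le_trans _ (p2 i)). Qed.
Let p0' i : 0 <= p i. Proof. exact: ltW. Qed.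
Let q0 i : 0 <= p i - 2. Proof. by rewrite subr_ge0. Qed.
Let pE i : p i - 2 + 2 = p i. Proof. by rewrite subrK. Qed.
Let p1 i : 1 < p i. Proof. by rewrite (lt_le_trans _ (p2 i))// ltr1n. Qed.

Lemma cont_V i : continuous (V_fun (g i)).
Proof. by apply: derive_continuous; exact: dV. Qed.

Lemma L1_increment_V E zeta (B : R) i v a : measurable E -> (leb E < +oo)%E ->
  measurable_fun setT zeta -> (forall x, `|zeta x| <= B) -> (forall x, ~ E x -> zeta x = 0) ->
  Lp (p i) v -> L1 leb (fun x => zeta x ^+ 2 * increment a (V_fun (g i) \o v) x ^+ 2).
Proof.
move=> mE fE mz zB z0 [mv Lv].
have [K K0 HK] := V_growth (gC2 i) (q0 i) C0 (g20 i) (g2C i).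
have cV := @cont_V i.
have mV : measurable_fun setT (V_fun (g i) \o v).
  by apply: measurableT_comp => //; exact: continuous_measurable_fun.
have LG := L1Z (B ^+ 2 * (2 * K)) (L1D (L1Z 2 (L1_indic mE fE)) (L1D Lv (L1_shift a Lv))).
apply: (L1_le _ LG).
  apply: measurable_funM; apply: measurable_funX => //.
  exact: measurable_increment.
move=> x; rewrite /= indicE normrM !normrX.
have B0 : 0 <= B by apply: le_trans (zB x).
have V2 : `|increment a (V_fun (g i) \o v) x| ^+ 2 <=
    2 * K * (2 + (`|v x| `^ p i + `|v (x + a)| `^ p i)).
  rewrite real_normK ?num_real// /increment/=.
  have := HK (v x); have := HK (v (x + a)); rewrite pE => H1 H2.
  have := sqr_ge0 (V_fun (g i) (v (x + a)) + V_fun (g i) (v x)).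
  rewrite sqrrB sqrrD -mulr_natr.
  lra.
case: (boolP (x \in E)) => [_|].
  rewrite mulr1 -mulrA; apply: ler_pM; rewrite ?sqr_ge0 ?exprn_ge0//.
  by rewrite ler_pXn2r ?nnegrE.
rewrite notin_setE => /z0 ->; rewrite normr0 expr0n mul0r mulr0 add0r.
by rewrite !mulr_ge0 ?sqr_ge0 ?addr_ge0 ?powR_ge0.
Qed.

Context (Om : set X) (f u : X -> R) (c : X) (r M : R).
Hypotheses (r0 : 0 < r) (QOm : Qc c (6 * r) `<=` Om) (umin : local_minimizer p g f Om u).
Let E := Q c (6 * r).
Let u0 := u \_ E.
Let f0 := f \_ E.
Let w i := wpartial Om i u \_ E.
Hypotheses (Lf : L1 leb f0) (Lu : L1 leb u0) (uM : {ae leb, forall x, `|u0 x| <= M}).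
Hypothesis Lw : forall i, Lp (p i) (w i).
Context (j : 'I_n) (fj : X -> R).
Hypotheses (wf : is_weak_partial Om j f fj).
Hypothesis Lfj : L1 leb (fun x => `|(fj \_ E) x| `^ (p j / (p j - 1))).

Let mE : measurable E. Proof. exact: measurable_Q. Qed.
Let fE : (leb E < +oo)%E. Proof. exact: leb_Q. Qed.

(** The Euler-Lagrange inequality bounds the sum over all components at once; each summand is
    nonnegative, so every component inherits the bound. [K] is fixed before [h]. *)
Lemma main_estimate : exists2 K, 0 <= K & forall h i, 0 < `|h| -> `|h| < r -> `|h| <= 1 ->
  let dV x := increment (h *: unit_vector j) (V_fun (g i) \o w i) x ^+ 2 in
  L1 leb (fun x => \1_(Q c r) x * dV x) /\
  Int leb (fun x => \1_(Q c r) x * dV x) <= K * (`|h| `^ (p j / pN)) ^+ 2.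
Proof.
have pN0 : 0 < pN by exact: lt_le_trans (pN_max j).
have t1 : p j / pN <= 1 by rewrite ler_pdivrMr// mul1r.
(* Radii: [zeta] is bounded below on radius r and supported in radius 2r, the difference quotients
   are controlled on 4r, and 6r leaves room for the shift. *)
pose zeta := bump c (2 * r).
have r2 : 0 < 2 * r by rewrite mulr_gt0.
have Tz : Ccinf zeta by exact: Ccinf_bump.
have Cz k : C_k k zeta by exact: C_k_bump.
have z0 x : ~ Qc c (2 * r) x -> zeta x = 0.
  by move=> nQ; apply: bump_eq0 => // Qx; apply: nQ; exact: Q_Qc.
have [B HB] := Ccinf_bounded Tz.
have /choice[D HD] i : exists D, forall x, `|partial i zeta x| <= D.
  exact: Ccinf_bounded (Ccinf_partial i Tz).
have [dl dl0 Hdl] := @bump_half R n (2 * r) r2.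
have zr x : Q c r x -> dl <= zeta x.
  move=> Qx; apply: Hdl; suff -> : 2 * r / 2 = r by [].
  by field.
(* A square, so that its gradient keeps a factor [zeta] for the absorption in [key_pointwise]. *)
pose eta x := zeta x * zeta x.
have Ceta k : C_k k eta by exact: C_kM.
have eta0 x : ~ Qc c (2 * r) x -> eta x = 0 by move=> nQ; rewrite /eta z0// mul0r.
have deta i x : partial i eta x = 2 * zeta x * partial i zeta x.
  have dz y : derivable zeta y (unit_vector i) by exact: ((Cz 1%N).2 i).1.
  by rewrite /eta partialM//; ring.
(* Bounds the increments of [u0] and is at least 1, as [scaled_bound] asks. *)
pose M' := 1 + 2 * `|M|.
have M'1 : 1 <= M' by rewrite lerDl mulr_ge0.
pose IE := Int leb (\1_E : X -> R).
pose Iw i := Int leb (fun x => `|w i x| `^ p i).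
pose If := Int leb (fun x => `|(fj \_ E) x| `^ (p j / (p j - 1))).
(* The integral of the error density [G i] below; [Iw i] occurs twice, for the derivative and for
   its translate. *)
pose GK i := 2 * D i ^+ 2 * C * (IE + Iw i + Iw i + 3 * M' `^ pN * (IE + Iw j)).
pose K0 := \sum_i GK i + B ^+ 2 * (If + Iw j).
have IE0 : 0 <= IE by apply: Int_ge0 => x; rewrite indicE.
have Iw0 i : 0 <= Iw i by apply: Int_ge0 => x; exact: powR_ge0.
have If0 : 0 <= If by apply: Int_ge0 => x; exact: powR_ge0.
have cD0 i (z : R) : 0 <= z -> 0 <= 2 * D i ^+ 2 * C * z.
  by move=> zz; rewrite mulr_ge0// mulr_ge0// mulr_ge0// sqr_ge0.
have K00 : 0 <= K0.
  apply: addr_ge0; last by rewrite mulr_ge0 ?sqr_ge0 ?addr_ge0.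
  apply: sumr_ge0 => i _; apply: cD0.
  by rewrite !addr_ge0// mulr_ge0 ?addr_ge0// mulr_ge0 ?powR_ge0.
(* The 2 undoes the half kept in [key_pointwise], and [dl ^+ 2] is a lower bound for [zeta ^+ 2] on
   [Q c r]. *)
exists (2 * K0 / dl ^+ 2); first by rewrite divr_ge0 ?sqr_ge0// mulr_ge0.
move=> h i0 h0 hr h1; pose a := h *: @unit_vector R n j; pose t := p j / pN.
pose tau := `|h| `^ t.
have tau0 : 0 < tau by rewrite powR_gt0.
have hn0 : h != 0 by rewrite -normr_gt0.
have ad k : `|a ord0 k| <= r.
  rewrite /a !mxE eqxx/=; case: (k == j); rewrite ?mulr1 ?mulr0 ?normr0 ltW//.
have sdS : 2 * r + r < 6 * r by lra.
have [LdW Ldf EL] := EL_increment p2 g0 gC2 C0 g20 g2C QOm umin Lf Lu uM Lw Ceta eta0 (ltW r0) ad sdS.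
have s4 : 4 * r + `|h| < 6 * r by lra.
have conj1 : 1 < p j / (p j - 1).
  by rewrite ltr_pdivlMr ?subr_gt0// mul1r gtrBl.
have [Pu [LPu Pu0 IPu HPu]] :=
  diffquot_bound (p1 j) hn0 (wpartialP j umin.1.1) QOm s4 (Lw j).2.
have [Pf [LPf Pf0 IPf HPf]] := diffquot_bound conj1 hn0 wf QOm s4 Lfj.
rewrite -/(Iw j) in IPu; rewrite -/If in IPf.
have Q4 x : Qc c (2 * r) x -> Q c (4 * r) x by apply: Qc_Q; lra.
have Q6 x : Qc c (2 * r) x -> E x by apply: Qc_Q; lra.
pose G i x := 2 * D i ^+ 2 * C * (\1_E x + `|w i x| `^ p i + `|w i (x + a)| `^ p i +
  3 * M' `^ pN * (\1_E x + Pu x)).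
have LE : L1 leb (\1_E : X -> R) by exact: L1_indic.
have Lwi i : L1 leb (fun x => `|w i x| `^ p i) := (Lw i).2.
have Lwa i : L1 leb (fun x => `|w i (x + a)| `^ p i) by exact: (L1_shift a (Lwi i)).
have LEw i : L1 leb (fun x => \1_E x + `|w i x| `^ p i) by exact: L1D.
have LEww i : L1 leb (fun x => \1_E x + `|w i x| `^ p i + `|w i (x + a)| `^ p i) by exact: L1D.
have LEP : L1 leb (fun x => \1_E x + Pu x) by exact: L1D.
have LEPZ : L1 leb (fun x => 3 * M' `^ pN * (\1_E x + Pu x)) by exact: L1Z.
have LG i : L1 leb (G i) by apply: L1Z; exact: L1D.
have IG i : Int leb (G i) = GK i.
  rewrite /G IntZ ?IntD ?IntZ ?IntD//; try exact: L1D.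
  by rewrite IPu (Int_shift a (Lwi i)).
pose dV i x := increment a (V_fun (g i) \o w i) x.
have LdV i : L1 leb (fun x => zeta x ^+ 2 * dV i x ^+ 2).
  apply: (L1_increment_V a mE fE (Ccinf_meas Tz) HB _ (Lw i)) => x nE.
  by apply: z0 => /Q6.
have key i : {ae leb, forall x, 2^-1 * (zeta x ^+ 2 * dV i x ^+ 2) <=
   increment a (derive1n 1 (g i) \o w i) x *
    (eta x * increment a (w i) x + partial i eta x * increment a u0 x) + tau ^+ 2 * G i x}.
  have := increment_u_bound uM a; move: HPu; apply: filterS2 => x Hx ux.
  have := key_pointwise (gC2 i) (q0 i) C0 (g20 i) (g2C i) (w i x) (w i (x + a)) (zeta x)
    (partial i zeta x) (increment a u0 x).
  rewrite /increment/= deta /eta => H.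
  set T := 2 * partial i zeta x ^+ 2 * _ * _ in H.
  suff HT : T <= tau ^+ 2 * G i x.
    rewrite /dV /increment/= mulrA.
    have -> : zeta x * zeta x = zeta x ^+ 2 by [].
    lra.
  have E0 : 0 <= \1_E x :> R by rewrite indicE.
  have [Qx|nQ] := pselect (Qc c (2 * r) x); last first.
    rewrite /T (partial_supp_Qc _ z0 nQ) expr0n/= mulr0 !mul0r.
    apply: mulr_ge0; first exact: sqr_ge0.
    by apply: cD0; rewrite !addr_ge0 ?powR_ge0// mulr_ge0 ?addr_ge0// mulr_ge0 ?powR_ge0.
  have Ex : \1_E x = 1 :> R by rewrite indicE mem_set//; exact: Q6.
  (* The increment measured in units of |h|^(t_j); [scaled_bound] bounds its p_i-th power by an
     integrable function whose integral does not depend on [h]. *)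
  pose e := `|increment a u0 x| / tau.
  have te : (tau * e) ^+ 2 = increment a u0 x ^+ 2.
    by rewrite /e mulrC divfK ?gt_eqF// real_normK ?num_real.
  have e0 : 0 <= e by rewrite divr_ge0// ltW.
  have eb : e `^ p i <= M' `^ pN * (1 + Pu x).
    apply: (@scaled_bound R _ _ _ (p j) _ t) => //.
    - rewrite (le_trans ux)// /M'; have := ler_norm M; lra.
    - by rewrite /t divfK ?gt_eqF.
    - exact: Hx (Q4 _ Qx).
  have := young_scaled (q0 i) C0 (w i x) (w i (x + a)) e tau.
  rewrite te pE (ger0_norm e0) => Y.
  have D2 : partial i zeta x ^+ 2 <= D i ^+ 2.
    rewrite -real_normK ?num_real// ler_pXn2r ?nnegrE//.
    by apply: le_trans (HD i x).
  rewrite /T /G Ex -[X in X <= _]mulrA.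
  set Z := (1 + _ + _ + _).
  have -> : tau ^+ 2 * (2 * D i ^+ 2 * C * Z) = 2 * D i ^+ 2 * (tau ^+ 2 * (C * Z)) by ring.
  apply: ler_pM.
  - by rewrite mulr_ge0 ?sqr_ge0.
  - rewrite mulr_ge0 ?sqr_ge0// mulr_ge0// !addr_ge0 ?powR_ge0//.
  - by rewrite ler_wpM2l.
  - apply: (le_trans Y); rewrite ler_wpM2l ?sqr_ge0// ler_wpM2l// /Z; lra.
have keyf : {ae leb, forall x, - (increment a f0 x * (eta x * increment a u0 x)) <=
    tau ^+ 2 * (B ^+ 2 * (Pf x + Pu x))}.
  move: HPu HPf; apply: filterS2 => x Hu Hf.
  have [Qx|nQ] := pselect (Qc c (2 * r) x); last first.
    by rewrite eta0// mul0r mulr0 oppr0 mulr_ge0 ?sqr_ge0// mulr_ge0 ?sqr_ge0// addr_ge0.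
  have Y := young_quotient h0 (p1 j) erefl (normr_ge0 _) (normr_ge0 _)
    (Hf (Q4 _ Qx)) (Hu (Q4 _ Qx)).
  apply: (le_trans (ler_norm _)); rewrite normrN !normrM.
  rewrite -/(increment a (f \_ E) x) -/(increment a (u \_ E) x) in Y.
  have -> : `|increment a f0 x| * (`|zeta x| * `|zeta x| * `|increment a u0 x|) =
    `|zeta x| ^+ 2 * (`|increment a f0 x| * `|increment a u0 x|) by ring.
  rewrite [X in _ <= X]mulrCA; apply: ler_pM; rewrite ?exprn_ge0 ?mulr_ge0//.
    by rewrite ler_pXn2r ?nnegrE// (le_trans _ (HB x)).
  apply: (le_trans Y); rewrite ler_wpM2r ?addr_ge0//.
  exact: sqr_le_powR_scale.
have sumV : \sum_i 2^-1 * Int leb (fun x => zeta x ^+ 2 * dV i x ^+ 2) <= tau ^+ 2 * K0.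
  have H i : 2^-1 * Int leb (fun x => zeta x ^+ 2 * dV i x ^+ 2) <=
    Int leb (fun x => increment a (derive1n 1 (g i) \o w i) x *
    (eta x * increment a (w i) x + partial i eta x * increment a u0 x)) + tau ^+ 2 * GK i.
    rewrite -IG -!IntZ// -IntD//; last exact: L1Z.
    by apply: Int_le_ae => //; [exact: L1Z|apply: L1D => //; exact: L1Z].
  have Hf : - Int leb (fun x => increment a f0 x * (eta x * increment a u0 x)) <=
     tau ^+ 2 * (B ^+ 2 * (If + Iw j)).
    have LP : L1 leb (fun x => B ^+ 2 * (Pf x + Pu x)) by apply: L1Z; exact: L1D.
    rewrite -IntN// -IPu -IPf -IntD// -!IntZ//; last exact: L1D.
    by apply: Int_le_ae => //; [exact: L1N|exact: L1Z].
  apply: (le_trans (ler_sum _ (fun i _ => H i))).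
  rewrite big_split/= -mulr_sumr /K0 mulrDr; lra.
have Vi0 : 2^-1 * Int leb (fun x => zeta x ^+ 2 * dV i0 x ^+ 2) <= tau ^+ 2 * K0.
  apply: le_trans sumV; rewrite (bigD1 i0)//= lerDl sumr_ge0// => i _.
  by rewrite mulr_ge0// Int_ge0// => x; rewrite mulr_ge0 ?sqr_ge0.
have mdV : measurable_fun setT (dV i0).
  apply: measurable_increment; apply: measurableT_comp (Lw i0).1.
  exact: continuous_measurable_fun (@cont_V i0).
have bound x : \1_(Q c r) x * dV i0 x ^+ 2 <= (dl ^+ 2)^-1 * (zeta x ^+ 2 * dV i0 x ^+ 2).
  rewrite [X in _ <= X]mulrA ler_wpM2r ?sqr_ge0// indicE [X in _ <= X]mulrC ler_pdivlMr ?exprn_gt0//.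
  case: (boolP (x \in Q c r)) => [|_]; last by rewrite mul0r sqr_ge0.
  by rewrite inE mul1r => /zr ?; rewrite ler_pXn2r ?nnegrE ?(ltW dl0)// (le_trans (ltW dl0)).
have LQ : L1 leb (fun x => \1_(Q c r) x * dV i0 x ^+ 2).
  apply: (L1_le _ (L1Z (dl ^+ 2)^-1 (LdV i0))) => [|x].
    apply: measurable_funM; last exact: measurable_funX.
    by apply: measurable_indic; exact: measurable_Q.
  by rewrite ger0_norm// mulr_ge0 ?sqr_ge0// indicE.
split => //.
apply: (le_trans (Int_le LQ (L1Z (dl ^+ 2)^-1 (LdV i0)) bound)).
rewrite IntZ// mulrAC [X in _ <= X]mulrC ler_wpM2l ?invr_ge0 ?sqr_ge0//.
by rewrite -/t -/tau; lra.
Qed.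
End estimate.

(** * Besov-Nikolskii seminorms *)

(** The integral of a nonnegative function is a supremum over the simple functions below it, so
    monotonicity does not involve measurability. *)
Lemma ge0_le_integral_nomeas d (T : measurableType d) (R : realType)
  (mu : {measure set T -> \bar R}) (f g : T -> \bar R) :
  (forall x, 0 <= f x)%E -> (forall x, f x <= g x)%E -> (\int[mu]_x f x <= \int[mu]_x g x)%E.
Proof.
move=> f0 fg; have g0 x : (0 <= g x)%E by exact: le_trans (fg x).
rewrite !ge0_integralTE//; apply: ge_ereal_sup => _ [l hl <-].
by apply: ereal_sup_ubound; exists l => // x; exact: le_trans (hl x) _.
Qed.

Section besov.
Context {R : realType} {n : nat}.
Local Notation X := 'rV[R]_n.
Local Notation leb := (@lebm R n).
Implicit Types (a c x y : X) (r s d h t : R) (F G v psi : X -> R) (i j : 'I_n) (E D Om : set X).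

(* Only the majorant has to be measurable, which spares the measurability of [shift_domain]. *)
Lemma norm_on2_le D F G (K : R) : L1 leb G -> Int leb G <= K ->
  (forall x, 0 <= G x) -> (forall x, D x -> F x ^+ 2 <= G x) ->
  (norm_on 2%:E D F <= (K `^ 2^-1)%:E)%E.
Proof.
move=> LG GK G0 FG; rewrite /norm_on unlock -poweR_EFin.
have I0 : (0 <= \int[lebesgue_rV n]_x `|(EFin \o (F \_ D)) x| `^ 2)%E.
  by apply: integral_ge0 => x _; exact: poweR_ge0.
have K0 : 0 <= K by apply: le_trans GK; exact: Int_ge0.
apply: gt0_ler_poweR; rewrite ?in_itv/= ?I0 ?leey ?lee_fin ?invr_ge0 ?K0//.
have -> : K%:E = ((K - Int leb G)%:E + \int[leb]_x (G x)%:E)%E.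
  by rewrite L1_EFin// -EFinD subrK.
rewrite -[leLHS]add0e; apply: leeD; first by rewrite lee_fin subr_ge0.
apply: (@ge0_le_integral_nomeas _ X R leb) => [x|x]; first by rewrite lee_fin powR_ge0.
rewrite /= lee_fin /patch; case: ifPn => [|_].
  by rewrite inE => /FG; rewrite powR_mulrn// real_normK ?num_real.
by rewrite normr0 powR0.
Qed.

Lemma shift_domain_left E a x : shift_domain E a x -> E x.
Proof. by case. Qed.

Lemma shift_domain_right E a x : shift_domain E a x -> E (x + a).
Proof. by move=> [_ /(_ 1)]; rewrite scale1r ler01 lexx; exact. Qed.

Lemma finite_radius (T : eqType) (rho : T -> R) (s : seq T) : (forall k, k \in s -> 0 < rho k) ->
  exists2 r, 0 < r & forall k, k \in s -> r <= rho k.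
Proof.
elim: s => [|k s IH] H; first by exists 1.
have [l ls|r r0 Hr] := IH; first by apply: H; rewrite in_cons ls orbT.
exists (Num.min r (rho k)); first by rewrite lt_min r0 H// mem_head.
move=> l; rewrite in_cons => /orP[/eqP ->|ls]; rewrite ge_min ?lexx ?orbT//.
by rewrite Hr.
Qed.

(** For |h| < r the estimates on the finite cover are summed. For |h| >= r, |h|^(-t) is at most
    r^(-t) and the L^2 norm of [psi] on [E] suffices. *)
Lemma seminorm_lty E psi j t : L1 leb (fun x => (psi \_ E) x ^+ 2) ->
  (exists (T : choiceType) (s : seq T) (Z : T -> set X) (r : R) (K : T -> R),
   [/\ 0 < r, forall x, E x -> exists2 k, k \in s & Z k x &
    forall k h, k \in s -> 0 < `|h| -> `|h| < r ->
     let G x := \1_(Z k) x * increment (h *: unit_vector j) psi x ^+ 2 in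
     L1 leb G /\ Int leb G <= K k * (`|h| `^ t) ^+ 2]) -> 0 <= t ->
  (nikolskii_seminorm t 2 j E psi < +oo)%E.
Proof.
move=> Lpsi [T [s [Z [r [K [r0 cov HK]]]]]] t0.
pose I2 := Int leb (fun x => (psi \_ E) x ^+ 2).
pose B1 := \sum_(k <- s) K k; pose B2 := (r `^ (- t)) ^+ 2 * (4 * I2).
pose B := Num.max B1 B2.
suff H : (nikolskii_seminorm t 2 j E psi <= (B `^ 2^-1)%:E)%E.
  by apply: le_lt_trans H _; rewrite ltry.
apply: ge_ereal_sup => _ [h /= h0 <-].
pose a := h *: @unit_vector R n j.
have [hr|rh] := ltP `|h| r.
  (* [L1_sum] asks for integrability at every index of the type, whereas [HK] covers only those in
     [s]; the others get the empty set. *)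
  pose G x := \sum_(k <- s) (`|h| `^ (- t)) ^+ 2 * (\1_(if k \in s then Z k else set0) x * increment a psi x ^+ 2).
  have hE : (`|h| `^ (- t)) ^+ 2 * (`|h| `^ t) ^+ 2 = 1.
    by rewrite -exprMn -powRD ?addNr ?powRr0 ?expr1n// (gt_eqF h0) implybT.
  have GE : G = fun x => (`|h| `^ (- t)) ^+ 2 * \sum_(k <- s) (\1_(if k \in s then Z k else set0) x * increment a psi x ^+ 2).
    by apply/funext => x; rewrite mulr_sumr.
  have LZ k : L1 leb (fun x => \1_(if k \in s then Z k else set0) x * increment a psi x ^+ 2).
    case: (boolP (k \in s)) => ks; first exact: (HK k h ks h0 hr).1.
    have -> : (fun x => \1_(set0 : set X) x * increment a psi x ^+ 2) = fun=> 0.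
      by apply/funext => x; rewrite indic0 mul0r.
    exact: L10.
  apply: (@norm_on2_le _ _ G).
  - by apply: L1_sum => k; exact: L1Z.
  - rewrite GE IntZ ?Int_sum//; last exact: L1_sum.
    rewrite (@le_trans _ _ B1) ?le_max ?lexx// mulr_sumr /B1 big_seq [X in _ <= X]big_seq.
    apply: ler_sum => k ks; rewrite ks.
    have [_ /(ler_wpM2l (sqr_ge0 (`|h| `^ (- t)))) /le_trans] := HK k h ks h0 hr; apply.
    by rewrite mulrCA hE mulr1.
  - by move=> x; apply: sumr_ge0 => k _; rewrite mulr_ge0 ?sqr_ge0// mulr_ge0 ?sqr_ge0 ?indicE.
  - move=> x /shift_domain_left /cov[k ks Zx].
    rewrite exprMn /G (big_rem k ks)/= ks indicE mem_set// mul1r lerDl.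
    by apply: sumr_ge0 => l _; rewrite mulr_ge0 ?sqr_ge0// mulr_ge0 ?sqr_ge0 ?indicE.
pose psi0 := psi \_ E.
have La : L1 leb (fun x => psi0 (x + a) ^+ 2) by exact: (L1_shift a Lpsi).
(* On the shift domain both endpoints lie in [E], so [psi] may be replaced by its extension by zero,
   whose shift has the same norm. *)
apply: (@norm_on2_le _ _ (fun x => (r `^ (- t)) ^+ 2 * (2 * (psi0 x ^+ 2 + psi0 (x + a) ^+ 2)))).
- by apply: L1Z; apply: L1Z; exact: L1D.
- rewrite IntZ ?IntZ ?IntD//; [|exact: L1D|by apply: L1Z; exact: L1D].
  rewrite (Int_shift a Lpsi) -/I2 (@le_trans _ _ B2) ?le_max ?lexx ?orbT//.
  by rewrite /B2 ler_wpM2l ?sqr_ge0//; lra.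
- by move=> x; rewrite mulr_ge0 ?sqr_ge0// mulr_ge0// addr_ge0 ?sqr_ge0.
move=> x Dx; rewrite exprMn; apply: ler_pM; rewrite ?sqr_ge0//.
  rewrite ler_pXn2r ?nnegrE ?powR_ge0//.
  rewrite !powRN lef_pV2 ?posrE ?powR_gt0 ?(lt_le_trans r0)//.
  by rewrite ge0_ler_powR ?nnegrE ?(ltW r0).
have -> : increment a psi x = psi0 (x + a) - psi0 x.
  rewrite /psi0 !patchE !mem_set//; first exact: shift_domain_left Dx.
  exact: shift_domain_right Dx.
have := sqr_ge0 (psi0 (x + a) + psi0 x); rewrite sqrrB sqrrD -mulr_natr.
lra.
Qed.

Lemma compactly_inside_finite E Om : compactly_inside E Om ->
  measurable E /\ (leb E < +oo)%E.
Proof.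
move=> [oE cE _]; have mE : measurable E by exact: open_measurable_rV.
split => //; have [M [_ HM]] := compact_bounded cE.
apply: le_lt_trans (leb_Q 0 (M + 2)); apply: le_measure; rewrite ?inE//; first exact: measurable_Q.
move=> x Ex i; rewrite mxE subr0 (le_lt_trans (coord_norm _ _))//.
rewrite (@le_lt_trans _ _ (M + 1))//; last by rewrite ltrD2l ltr1n.
by apply: HM; [rewrite ltrDl|exact: subset_closure].
Qed.

Lemma Lp_space_oo_bound E v : Lp_space +oo E v -> exists M, {ae leb, forall x, `|(v \_ E) x| <= M}.
Proof.
rewrite /Lp_space inE => /andP[_]; rewrite inE/= /finite_norm unlock.
(* The L^infinity norm is the essential supremum only if the whole space has positive measure. *)
have -> : (0 < lebesgue_rV n [set: X])%E.
  apply: (@lt_le_trans _ _ (leb (Q 0 1))); first exact: leb_Q_gt0.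
  by apply: le_measure; rewrite ?inE//; exact: measurable_Q.
set e := ess_sup _ _ => e_oo; exists (fine e).
have H : \forall x \ae leb, (`|(v \_ E) x|%:E <= e)%E by exact: ess_sup_ge.
apply: filterS H => x H; have e0 : (0 <= e)%E by apply: le_trans H; rewrite lee_fin.
by rewrite -lee_fin fineK// ge0_fin_numE.
Qed.
End besov.

(** * From the local estimate to the Besov space *)

Section local.
Context {R : realType} {n : nat}.
Local Notation X := 'rV[R]_n.+1.
Local Notation leb := (@lebm R n.+1).
Implicit Types (a c x y : X) (r s d h : R) (i j : 'I_n.+1) (E : set X).

Context (p : 'I_n.+1 -> R) (g : 'I_n.+1 -> R -> R) (C pN : R).
Hypotheses (p2 : forall i, 2 <= p i) (pN_max : forall i, p i <= pN).
Hypothesis g0 : forall i s, 0 <= g i s.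
Hypotheses (gC2 : forall i, C2 (g i)) (C0 : 0 <= C).
Hypothesis g20 : forall i s, 0 <= derive1n 2 (g i) s.
Hypothesis g2C : forall i s, derive1n 2 (g i) s <= C * (`|s| `^ (p i - 2) + 1).
Context (Om : set X) (f u : X -> R).
Hypotheses (oOm : open Om) (Wf : W1p_loc (conjugate_exponents p) Om f).
Hypotheses (umin : local_minimizer p g f Om u) (ubd : Lp_loc +oo%E Om u).
Let V i x := V_fun (g i) (wpartial Om i u x).

Let p0 i : 0 < p i. Proof. by rewrite (lt_le_trans _ (p2 i)). Qed.
Let p1 i : 1 < p i. Proof. by rewrite (lt_le_trans _ (p2 i))// ltr1n. Qed.

Lemma Lp_wpartial E i : compactly_inside E Om -> Lp (p i) (wpartial Om i u \_ E).
Proof. by move=> cE; have /Lp_spaceP[|//] := umin.1.2 i _ cE; exact: ltW. Qed.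

Lemma Lp_loc_V i : Lp_loc 2%:E Om (V i).
Proof.
move=> E cE; have [mE fE] := compactly_inside_finite cE.
have [mw Lw] := Lp_wpartial i cE.
have q0 : 0 <= p i - 2 by rewrite subr_ge0.
have [K K0 HK] := V_growth (gC2 i) q0 C0 (g20 i) (g2C i).
have mV : measurable_fun setT (V i \_ E).
  apply: measurable_comp_patch => //; apply: derive_continuous; exact: dV.
apply/Lp_spaceP; first by rewrite ler1n.
split => //; apply: (L1_le _ (L1Z K (L1D (L1_indic mE fE) Lw))).
  exact: measurable_norm_powR.
move=> x; rewrite ger0_norm ?powR_ge0// powR_mulrn// real_normK ?num_real//.
rewrite indicE /patch; case: (boolP (x \in E)) => _.
  by have := HK (wpartial Om i u x); rewrite subrK.
by rewrite expr0n/= add0r mulr_ge0 ?powR_ge0.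
Qed.

Lemma local_estimate c : Om c -> exists rK : R * R, 0 < rK.1 /\
  forall h i j, 0 < `|h| -> `|h| < rK.1 ->
    let G x := \1_(Q c rK.1) x * increment (h *: unit_vector j) (V i) x ^+ 2 in
    L1 leb G /\ Int leb G <= rK.2 * (`|h| `^ (p j / pN)) ^+ 2.
Proof.
move=> Omc; have [s s0 sOm] := open_Qc oOm Omc.
(* The cube of radius 6r must fit in [Om], and |h| < r must imply |h| <= 1. *)
pose r := Num.min (s / 6) 1.
have r0 : 0 < r by rewrite lt_min ltr01 divr_gt0.
have r6 : 6 * r <= s.
  by rewrite -ler_pdivlMl// mulrC ge_min lexx.
have QOm : Qc c (6 * r) `<=` Om.
  by apply: subset_trans sOm => x Qx k; exact: le_trans (Qx k) _.
have cE := compactly_inside_Q QOm.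
have [M uM] := Lp_space_oo_bound (ubd cE).
have [/(_ _ cE)/Lp_space1P Lu _ _] := wpartialP ord0 umin.1.1.
have [/(_ _ cE)/Lp_space1P Lf _ _] := wpartialP ord0 Wf.1.
have Lw i := Lp_wpartial i cE.
have cj j : 1 <= conjugate_exponents p j.
  by rewrite /conjugate_exponents ler_pdivlMr ?subr_gt0// mul1r gerBl.
have Lfj j := ((Lp_spaceP _ _ (cj j)).1 (Wf.2 j _ cE)).2.
have K j := cid2 (main_estimate p2 pN_max g0 gC2 C0 g20 g2C r0 QOm umin Lf Lu uM Lw
  (wpartialP j Wf.1) (Lfj j)).
(* Summing the constants gives one that serves every direction [j]. *)
exists (r, \sum_j s2val (K j)); split => //= h i j h0 hr.
have h1 : `|h| <= 1 by rewrite ltW// (lt_le_trans hr)// ge_min lexx orbT.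
have [L I] := s2valP' (K j) h i h0 hr h1.
(* For x in [Q c r] and |h| < r both endpoints stay in the cube of radius 6r, so the extension by
   zero is not seen. *)
suff GE : (fun x => \1_(Q c r) x * increment (h *: unit_vector j) (V i) x ^+ 2) =
  fun x => \1_(Q c r) x * increment (h *: unit_vector j)
    (V_fun (g i) \o wpartial Om i u \_ (Q c (6 * r))) x ^+ 2.
  split; first exact: (eq_ind_r (L1 leb) L GE).
  apply: (@le_trans _ _ (s2val (K j) * (`|h| `^ (p j / pN)) ^+ 2)).
    exact: (eq_ind_r (fun F => Int leb F <= _) I GE).
  rewrite ler_wpM2r ?sqr_ge0// (bigD1 j)//= lerDl sumr_ge0// => k _.
  exact: s2valP (K k).
apply/funext => x; rewrite !indicE; case: (boolP (x \in Q c r)) => [|_]; last by rewrite !mul0r.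
rewrite inE => Qx; congr (_ * _ ^+ 2); rewrite /increment/= !patchE !mem_set//.
  by apply: Q_mono Qx; lra.
move=> k; have := Qx k; rewrite !mxE eqxx/= => Qk.
have ak : `|h * (k == j)%:R| < r.
  by case: (k == j); rewrite ?mulr1 ?mulr0 ?normr0.
rewrite addrAC (le_lt_trans (ler_normD _ _))//; lra.
Qed.

(** The closure of [E] is compact in [Om], so finitely many of the cubes from [local_estimate] cover
    it, and the least of their radii bounds the admissible shifts. *)
Lemma besov_V i : besov_nikolskii_loc (fun j => p j / pN) 2 Om (V i).
Proof.
split; first exact: Lp_loc_V.
move=> E cE; split; first exact: Lp_loc_V.
have [oE compE sE] := cE.
have pN0 : 0 < pN by exact: lt_le_trans (p0 ord0) (pN_max ord0).
have /choice[rK HrK] c : exists rK : R * R, Om c -> 0 < rK.1 /\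
  forall h i j, 0 < `|h| -> `|h| < rK.1 ->
    let G x := \1_(Q c rK.1) x * increment (h *: unit_vector j) (V i) x ^+ 2 in
    L1 leb G /\ Int leb G <= rK.2 * (`|h| `^ (p j / pN)) ^+ 2.
  have [/local_estimate[rK H]|] := pselect (Om c); first by exists rK.
  by exists (0, 0).
have cov : closure E `<=` cover (closure E) (fun c => Q c (rK c).1).
  by move=> x Ex; exists x => // k; rewrite subrr normr0; exact: (HrK x (sE _ Ex)).1.
have [D DOm covD] : exists2 D : seq X, forall c, c \in D -> Om c &
    forall x, E x -> exists2 c, c \in D & Q c (rK c).1 x.
  move: compE; rewrite compact_cover => /(_ _ _ _ _ cov)[|D' DE covD].
    by move=> c Ec; exact: open_Q.
  exists (finmap.enum_fset D') => [c cD|x /subset_closure/covD[c cD Qx]].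
    by apply: sE; have := DE c cD; rewrite inE.
  by exists c.
have [c cD|r r0 Hr] := @finite_radius R X (fun c => (rK c).1) D.
  exact: (HrK c (DOm c cD)).1.
apply: lte_sum_pinfty => j _; apply: seminorm_lty.
- have [_] := (Lp_spaceP _ _ (ler1n R 2 : 1 <= 2)).1 (Lp_loc_V i cE).
  have -> : (fun x => `|(V i \_ E) x| `^ 2) = fun x => (V i \_ E) x ^+ 2.
    by apply/funext => x; rewrite powR_mulrn// real_normK ?num_real.
  by [].
- exists X, D, (fun c => Q c (rK c).1), r, (fun c => (rK c).2); split => //.
  move=> c h cD h0 hr; apply: (HrK c (DOm c cD)).2 => //.
  exact: lt_le_trans hr (Hr c cD).
- by rewrite divr_ge0 ?ltW.
Qed.
End local.

Theorem proposition3p2 (R : realType) (n : nat) (hN : (2 <= n.+1)%N)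
  (Om : set 'rV[R]_n.+1) (hOm : open Om)
  (p : 'I_n.+1 -> R)
  (hp2 : forall i, 2 <= p i)
  (hp : forall i j : 'I_n.+1, (i <= j)%N -> p i <= p j)
  (f : 'rV[R]_n.+1 -> R)
  (hf : W1p_loc (conjugate_exponents p) Om f)
  (g : 'I_n.+1 -> R -> R)
  (hg0 : forall i (s : R), 0 <= g i s)
  (hgC2 : forall i, C2 (g i))
  (hgconvex : forall i, convex_function [set: R^o] (g i))
  (C delta : R) (hC : 1 <= C) (hdelta : 0 <= delta)
  (hg : forall i (s : R),
     C^-1 * Num.max (`|s| - delta) 0 `^ (p i - 2) <= derive1n 2 (g i) s /\
     derive1n 2 (g i) s <= C * (`|s| `^ (p i - 2) + 1))
  (u : 'rV[R]_n.+1 -> R)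
  (hu : local_minimizer p g f Om u)
  (hubdd : Lp_loc +oo%E Om u) :
  forall i : 'I_n.+1,
    besov_nikolskii_loc
      (fun j => if j == ord_max then 1 else p j / p ord_max) 2 Om
      (fun x => V_fun (g i) (wpartial Om i u x)).
Proof.
move=> i; have C0 : 0 <= C by exact: le_trans hC.
have pmax j : p j <= p ord_max by apply: hp; exact: leq_ord.
(* The exponent 1 in the last direction is p_N / p_N, so all directions are treated alike. *)
have -> : (fun j => if j == ord_max then 1 else p j / p ord_max) = fun j => p j / p ord_max.
  apply/funext => j; case: eqP => [->|//].
  by rewrite divff// gt_eqF// (lt_le_trans _ (hp2 ord_max)).
apply: (besov_V hp2 pmax hg0 hgC2 C0 _ _ hOm hf hu hubdd) => j s.
  (* The sign of g'' is read off from the lower growth bound. *)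
  by apply: le_trans (hg j s).1; rewrite mulr_ge0 ?powR_ge0// invr_ge0.
exact: (hg j s).2.
Qed.
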